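(* Let $r,k\in\mathbb{N}$. As $n\to\infty$, $$(-1)^{r+1}\Delta^{[r]}\left(\log(b_k)\right)(n)\sim\frac{\pi\,(2r-3)!!\,\sqrt{5k+2}}{2^{r-\frac12}\sqrt{3(2k+1)}}\;n^{\frac12-r}.$$
   Context: For $k\in\mathbb{N}$, $b_k(n)$ (the number of broken $k$-diamond partitions of $n$) is defined by $\sum_{n\ge0}b_k(n)q^n=\frac{(-q;q)_\infty}{(q;q)_\infty^2(-q^{2k+1};q^{2k+1})_\infty}$, where $(a;q)_\infty:=\prod_{j\ge0}(1-aq^j)$; $\log(b_k)$ denotes the sequence $n\mapsto\log(b_k(n))$. The difference operator is $\Delta^{[1]}(a)(n):=a(n)-a(n-1)$, and for $r\ge2$, $\Delta^{[r]}(a)(n):=\Delta^{[1]}\left(\Delta^{[r-1]}(a)\right)(n)$ (considered for large $n$). The double factorial is $n!!:=\prod_{k=0}^{\lceil n/2\rceil-1}(n-2k)$, with $(-1)!!=1$ (empty product). *)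

(* Defs.v *)
From Stdlib Require Import Reals ZArith List Lra Lia.
From Coquelicot Require Import Coquelicot.
Open Scope R_scope.

(* A formal power series is its coefficient sequence [nat -> R], as in
   Coquelicot's [PS_mult], [PS_minus] and [PS_scal]. *)

Definition PS_X (m : nat) : nat -> R := fun n => if Nat.eqb n m then 1 else 0.

Definition PS_one : nat -> R := PS_X 0.

Definition PS_pow (a : nat -> R) (j : nat) : nat -> R :=
  Nat.iter j (PS_mult a) PS_one.

(* 1/a = (1/a_0) * sum_j (1 - a/a_0)^j; the j-th power has no term of degree
   below j, so the sum can be cut at j = n.  Meaningful when a_0 <> 0, see
   [PS_mult_inv]. *)
Definition PS_inv (a : nat -> R) : nat -> R := fun n =>
  sum_f_R0 (fun j => PS_pow (PS_minus PS_one (PS_scal (/ a 0%nat) a)) j n) n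
  / a 0%nat.

Fixpoint qpoch_fin (a Q : nat -> R) (N : nat) : nat -> R :=
  match N with
  | O => PS_one
  | S N' => PS_mult (qpoch_fin a Q N')
              (PS_minus PS_one (PS_mult a (PS_pow Q N')))
  end.

(* (a;Q)_oo, the infinite product being taken coefficientwise; the coefficients
   are eventually constant when a and Q have no constant term, see
   [qpoch_stable]. *)
Definition qpoch (a Q : nat -> R) : nat -> R := fun n =>
  real (Lim_seq (fun N => qpoch_fin a Q N n)).

Definition broken_diamond (k : nat) : nat -> R :=
  let q := PS_X 1 in
  let q' := PS_X (2 * k + 1) in
  PS_mult (qpoch (PS_opp q) q)
    (PS_inv (PS_mult (PS_pow (qpoch q q) 2) (qpoch (PS_opp q') q'))).

(* The value at n = 0 is irrelevant (there n - 1 = 0 in nat). *)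
Definition Delta (a : nat -> R) : nat -> R := fun n => a n - a (n - 1)%nat.

Definition Delta_iter (r : nat) (a : nat -> R) : nat -> R := Nat.iter r Delta a.

(* Defined on Z so as to cover (-1)!!; (n + 1) / 2 is the ceiling of n/2. *)
Definition double_factorial (n : Z) : Z :=
  fold_right Z.mul 1%Z
    (map (fun j => (n - 2 * Z.of_nat j)%Z) (seq 0 (Z.to_nat ((n + 1) / 2)))).

Lemma sum_f_R0_zero (f : nat -> R) (n : nat) :
  (forall i, (i <= n)%nat -> f i = 0) -> sum_f_R0 f n = 0.
Proof.
  induction n as [|n IH]; intros H; simpl.
  - now apply H.
  - rewrite IH, H; auto; lra.
Qed.

Lemma PS_mult_low (u v : nat -> R) (s t n : nat) :
  (forall i, (i < s)%nat -> u i = 0) -> (forall i, (i < t)%nat -> v i = 0) ->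
  (n < s + t)%nat -> PS_mult u v n = 0.
Proof.
  intros Hu Hv Hn. apply sum_f_R0_zero. intros i Hi.
  destruct (Nat.lt_ge_cases i s).
  - rewrite Hu by assumption. ring.
  - rewrite (Hv (n - i)%nat) by lia. ring.
Qed.

Lemma PS_pow_low (a : nat -> R) (j n : nat) :
  a 0%nat = 0 -> (n < j)%nat -> PS_pow a j n = 0.
Proof.
  intros Ha. revert n. induction j as [|j IH]; intros n Hn; [lia|].
  simpl. apply PS_mult_low with (s := 1%nat) (t := j); [|exact IH|lia].
  intros [|i] Hi; [assumption|lia].
Qed.

Lemma PS_mult_minus_r (u v w : nat -> R) (n : nat) :
  PS_mult u (PS_minus v w) n = PS_mult u v n - PS_mult u w n.
Proof.
  unfold PS_mult. rewrite <- minus_sum. apply sum_eq. intros i _.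
  unfold PS_minus, plus, opp; simpl. ring.
Qed.

Lemma PS_mult_one_r (u : nat -> R) (n : nat) : PS_mult u PS_one n = u n.
Proof.
  unfold PS_mult. destruct n as [|n].
  - simpl. unfold PS_one, PS_X. simpl. ring.
  - rewrite tech5, sum_f_R0_zero.
    + rewrite Nat.sub_diag. unfold PS_one, PS_X. simpl. ring.
    + intros i Hi. unfold PS_one, PS_X.
      destruct (Nat.eqb_spec (S n - i) 0); [lia|ring].
Qed.

Lemma PS_mult_one_l (u : nat -> R) (n : nat) : PS_mult PS_one u n = u n.
Proof.
  unfold PS_mult. destruct n as [|n].
  - simpl. unfold PS_one, PS_X. simpl. ring.
  - rewrite decomp_sum by lia. rewrite sum_f_R0_zero.
    + rewrite Nat.sub_0_r. unfold PS_one, PS_X. simpl. ring.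
    + intros i Hi. unfold PS_one, PS_X. simpl. ring.
Qed.

Lemma PS_mult_sum_r (u : nat -> R) (w : nat -> nat -> R) (m n : nat) :
  PS_mult u (fun i => sum_f_R0 (fun j => w j i) m) n =
  sum_f_R0 (fun j => PS_mult u (w j) n) m.
Proof.
  induction m as [|m IH]; simpl; [reflexivity|].
  rewrite <- IH. unfold PS_mult. rewrite <- plus_sum. apply sum_eq.
  intros i _. ring.
Qed.

Lemma PS_mult_inv (a : nat -> R) (n : nat) :
  a 0%nat <> 0 -> PS_mult a (PS_inv a) n = PS_one n.
Proof.
  intros Ha.
  set (u := PS_minus PS_one (PS_scal (/ a 0%nat) a) : nat -> R).
  assert (Hau : forall i, a i = a 0%nat * (PS_one i - u i)).
  { intros i. unfold u, PS_minus, PS_scal, plus, opp, scal; simpl.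
    unfold mult; simpl. field. exact Ha. }
  assert (Hu : u 0%nat = 0).
  { unfold u, PS_minus, PS_scal, plus, opp, scal; simpl.
    unfold mult, PS_one, PS_X; simpl. field. exact Ha. }
  set (G := fun i => sum_f_R0 (fun j => PS_pow u j i) n).
  assert (HG : forall i, (i <= n)%nat -> PS_inv a i = G i / a 0%nat).
  { intros i Hi. unfold PS_inv. fold u. f_equal. unfold G.
    destruct (Nat.eq_dec i n) as [->|Hne]; [reflexivity|].
    rewrite (tech2 _ i n) by lia.
    rewrite (sum_f_R0_zero _ (n - S i)); [ring|].
    intros j _. apply PS_pow_low; [exact Hu|lia]. }
  transitivity (PS_mult PS_one G n - PS_mult u G n).
  { unfold PS_mult. rewrite <- minus_sum. apply sum_eq. intros i Hi.
    rewrite HG by lia. rewrite (Hau i). field. exact Ha. }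
  rewrite PS_mult_one_l. unfold G at 2. rewrite PS_mult_sum_r. unfold G.
  rewrite <- minus_sum.
  transitivity (PS_pow u 0 n - PS_pow u (S n) n).
  { assert (H : forall m,
      sum_f_R0 (fun i => PS_pow u i n - PS_pow u (S i) n) m =
      PS_pow u 0 n - PS_pow u (S m) n).
    { induction m as [|m IH]; [reflexivity|]. rewrite tech5, IH. ring. }
    apply H. }
  rewrite (PS_pow_low u (S n) n) by (auto; lia). simpl. ring.
Qed.

Lemma qpoch_fin_stable (a Q : nat -> R) (n N : nat) :
  a 0%nat = 0 -> Q 0%nat = 0 -> (n <= N)%nat ->
  qpoch_fin a Q N n = qpoch_fin a Q n n.
Proof.
  intros Ha HQ HN. induction HN as [|N HN IH]; [reflexivity|].
  simpl. rewrite PS_mult_minus_r, PS_mult_one_r, IH.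
  rewrite (PS_mult_low _ _ 0 (S N)); [ring| |  |lia].
  - intros i Hi; lia.
  - intros i Hi. apply PS_mult_low with (s := 1%nat) (t := N); [| |lia].
    + intros [|i'] Hi'; [assumption|lia].
    + intros i' Hi'. now apply PS_pow_low.
Qed.

Lemma qpoch_stable (a Q : nat -> R) (n N : nat) :
  a 0%nat = 0 -> Q 0%nat = 0 -> (n <= N)%nat ->
  qpoch a Q n = qpoch_fin a Q N n.
Proof.
  intros Ha HQ HN. unfold qpoch.
  rewrite (Lim_seq_ext_loc _ (fun _ => qpoch_fin a Q n n)).
  - rewrite Lim_seq_const. simpl. now rewrite (qpoch_fin_stable a Q n N).
  - exists n. intros m Hm. now apply qpoch_fin_stable.
Qed.

(* Main.v *)
Require Import Defs.
From Stdlib Require Import Reals ZArith Lra Lia Psatz List FunctionalExtensionality.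
From Coquelicot Require Import Coquelicot.
Open Scope R_scope.

(* Logarithmic differentiation of the product gives
   n b(n) = sum_(l < n) s(n - l) b(l) with weights s(j) >= j.  Since the
   trapezoidal rule is accurate to every order for a smooth even decaying
   function, the Lambert series of the weights satisfies
   sum_j s(j) e^(-ju) = A/u^2 - 1/u - B + O(u^M) for every M.  Expanding F(x - j)
   as a polynomial times an exponential, one deduces that F(n + B), where
   x F'' + 3 F' = A F, satisfies the same recurrence up to a relative error
   O(n^(-M)).  Hence w(n) = b(n) / F(n + B) is, up to O(n^(-M)), a weighted mean
   of its earlier values; as s(j) >= j, two such means overlap enough to contract
   oscillations, so that w(n) - w(n-1) = O(n^(-M)).  The differences of log b are
   therefore those of log F, and these are governed by the Riccati equation of
   F'/F, which determines all derivatives of log F to leading order. *)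

(** * Formal power series and the recurrence *)

(** An asymptotic formula for b(n) cannot be differenced r times, so errors have to beat every power
    of 1/n; hence the free exponent [M] throughout. The equation of F is read off the recurrence:
    replacing the sum by its main part gives x F(x) = integral over 0 <= y <= x of (A y - 1) F(x -
    y), and two differentiations yield (x F)'' = A F - F'; the constant B is absorbed by the shift n
    + B. The scales are forced. F(x - y) / F(x) decays like exp(- u y) with u of order x^(-1/2), and
    the next term of its logarithm is of order y^2 x^(-3/2), so the sum must be cut between x^(1/2)
    and x^(3/4). The cut is at x^(5/8), and x = X^8 makes all exponents integral. For the
    contraction take n of order T^10. Means overlap well over distances T^5, but a window of length
    T^6 is required to make the tail of the kernel negligible, which weakens the contraction per
    block to 1 - c / T^2. T^3 blocks have total length of order T^9, so that n keeps its order of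
    magnitude, and they contract by exp(- c T). *)

Fixpoint rsum (f : nat -> R) (a n : nat) : R :=
  match n with
  | O => 0
  | S n' => rsum f a n' + f (a + n')%nat
  end.

Lemma rsum_ext (f g : nat -> R) (a n : nat) :
  (forall i, (a <= i < a + n)%nat -> f i = g i) -> rsum f a n = rsum g a n.
Proof.
  induction n as [|n IH]; intros H; simpl; [reflexivity|].
  rewrite IH, H; [reflexivity|lia|intros i Hi; apply H; lia].
Qed.

Lemma rsum_plus (f g : nat -> R) (a n : nat) :
  rsum (fun i => f i + g i) a n = rsum f a n + rsum g a n.
Proof. induction n as [|n IH]; simpl; [ring|rewrite IH; ring]. Qed.

Lemma rsum_scal (c : R) (f : nat -> R) (a n : nat) :
  rsum (fun i => c * f i) a n = c * rsum f a n.
Proof. induction n as [|n IH]; simpl; [ring|rewrite IH; ring]. Qed.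

Lemma rsum_split (f : nat -> R) (a n m : nat) :
  rsum f a (n + m) = rsum f a n + rsum f (a + n) m.
Proof.
  induction m as [|m IH]; simpl; [rewrite Nat.add_0_r; ring|].
  rewrite Nat.add_succ_r. simpl. rewrite IH, Nat.add_assoc. ring.
Qed.

Lemma rsum_le (f g : nat -> R) (a n : nat) :
  (forall i, (a <= i < a + n)%nat -> f i <= g i) -> rsum f a n <= rsum g a n.
Proof.
  induction n as [|n IH]; intros H; simpl; [lra|].
  apply Rplus_le_compat; [apply IH; intros; apply H; lia|apply H; lia].
Qed.

Lemma rsum_const (c : R) (a n : nat) : rsum (fun _ => c) a n = INR n * c.
Proof. induction n as [|n IH]; [simpl; ring|]. rewrite S_INR. simpl. rewrite IH. ring. Qed.

Lemma rsum_zero (f : nat -> R) (a n : nat) :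
  (forall i, (a <= i < a + n)%nat -> f i = 0) -> rsum f a n = 0.
Proof.
  intros H. rewrite (rsum_ext f (fun _ => 0)) by exact H. rewrite rsum_const. ring.
Qed.

Lemma rsum_pos (f : nat -> R) (a n : nat) :
  (forall i, (a <= i < a + n)%nat -> 0 <= f i) -> 0 <= rsum f a n.
Proof.
  intros H. replace 0 with (rsum (fun _ => 0) a n) by (rewrite rsum_const; ring).
  now apply rsum_le.
Qed.

Lemma rsum_abs (f : nat -> R) (a n : nat) :
  Rabs (rsum f a n) <= rsum (fun i => Rabs (f i)) a n.
Proof.
  induction n as [|n IH]; simpl; [rewrite Rabs_R0; lra|].
  eapply Rle_trans; [apply Rabs_triang|]. lra.
Qed.

Lemma rsum_swap (f : nat -> nat -> R) (a n b m : nat) :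
  rsum (fun i => rsum (fun j => f i j) b m) a n =
  rsum (fun j => rsum (fun i => f i j) a n) b m.
Proof.
  induction n as [|n IH]; simpl.
  - symmetry. now apply rsum_zero.
  - now rewrite IH, <- rsum_plus.
Qed.

Lemma rsum_single (f : nat -> R) (a n k : nat) :
  (a <= k < a + n)%nat -> (forall i, (a <= i < a + n)%nat -> i <> k -> f i = 0) ->
  rsum f a n = f k.
Proof.
  intros Hk H. replace n with ((k - a) + (1 + (a + n - k - 1)))%nat by lia.
  rewrite rsum_split, rsum_split. simpl.
  rewrite rsum_zero by (intros; apply H; lia).
  rewrite (rsum_zero _ (a + (k - a) + 1)) by (intros; apply H; lia).
  replace (a + (k - a) + 0)%nat with k by lia. ring.
Qed.

Lemma rsum_shift (f : nat -> R) (a b n : nat) :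
  rsum f (b + a) n = rsum (fun i => f (b + i)%nat) a n.
Proof. induction n as [|n IH]; simpl; [reflexivity|]. now rewrite IH, Nat.add_assoc. Qed.

Lemma rsum_first (f : nat -> R) (a n : nat) :
  rsum f a (S n) = f a + rsum f (S a) n.
Proof.
  change (S n) with (1 + n)%nat. rewrite rsum_split. simpl.
  rewrite Nat.add_0_r, Nat.add_1_r. ring.
Qed.

Lemma rsum_rev (f : nat -> R) (n : nat) :
  rsum f 0 n = rsum (fun i => f (n - 1 - i)%nat) 0 n.
Proof.
  induction n as [|n IH]; [reflexivity|].
  rewrite (rsum_first (fun i => f (S n - 1 - i)%nat)). simpl rsum at 1.
  rewrite IH, (rsum_shift _ 0 1). rewrite Rplus_comm. f_equal.
  - f_equal. lia.
  - apply rsum_ext. intros i Hi. f_equal. lia.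
Qed.

Lemma rsum_triangle (g : nat -> nat -> R) (N : nat) :
  rsum (fun i => rsum (fun j => g i j) 0 (S i)) 0 N =
  rsum (fun j => rsum (fun l => g (j + l)%nat j) 0 (N - j)) 0 N.
Proof.
  induction N as [|N IH]; [reflexivity|].
  cbn [rsum]. cbn [rsum] in IH. rewrite IH. rewrite !Nat.add_0_l.
  replace (S N - N)%nat with 1%nat by lia. cbn [rsum]. rewrite !Nat.add_0_r.
  rewrite Rplus_0_l, <- Rplus_assoc. f_equal.
  rewrite <- rsum_plus. apply rsum_ext. intros j Hj.
  replace (S N - j)%nat with (S (N - j)) by lia. cbn [rsum]. rewrite Nat.add_0_l.
  f_equal. f_equal. lia.
Qed.

Lemma sum_f_R0_rsum (f : nat -> R) (n : nat) : sum_f_R0 f n = rsum f 0 (S n).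
Proof. induction n as [|n IH]; [simpl; ring|]. rewrite tech5, IH. reflexivity. Qed.

Lemma PS_mult_rsum (a b : nat -> R) (n : nat) :
  PS_mult a b n = rsum (fun i => a i * b (n - i)%nat) 0 (S n).
Proof. unfold PS_mult. apply sum_f_R0_rsum. Qed.

Lemma PS_mult_comm (a b : nat -> R) : PS_mult a b = PS_mult b a.
Proof.
  apply functional_extensionality. intros n. rewrite !PS_mult_rsum, rsum_rev.
  apply rsum_ext. intros i Hi. rewrite Rmult_comm. f_equal; f_equal; lia.
Qed.

Lemma PS_mult_assoc (a b c : nat -> R) :
  PS_mult (PS_mult a b) c = PS_mult a (PS_mult b c).
Proof.
  apply functional_extensionality. intros n. rewrite !PS_mult_rsum.
  transitivity (rsum (fun i => rsum (fun j => a j * b (i - j)%nat * c (n - i)%nat) 0 (S i)) 0 (S n)).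
  { apply rsum_ext. intros i Hi. rewrite PS_mult_rsum, Rmult_comm, <- rsum_scal.
    apply rsum_ext. intros; ring. }
  rewrite rsum_triangle. apply rsum_ext. intros j Hj.
  rewrite PS_mult_rsum, <- rsum_scal. replace (S n - j)%nat with (S (n - j)) by lia.
  apply rsum_ext. intros l Hl. replace (j + l - j)%nat with l by lia.
  replace (n - (j + l))%nat with (n - j - l)%nat by lia. ring.
Qed.

Lemma PS_mult_plus_l (a b c : nat -> R) :
  PS_mult (fun n => a n + b n) c = (fun n => PS_mult a c n + PS_mult b c n).
Proof.
  apply functional_extensionality. intros n. rewrite !PS_mult_rsum, <- rsum_plus.
  apply rsum_ext. intros; ring.
Qed.

Lemma PS_mult_scal_l (t : R) (a c : nat -> R) :
  PS_mult (fun n => t * a n) c = (fun n => t * PS_mult a c n).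
Proof.
  apply functional_extensionality. intros n. rewrite !PS_mult_rsum, <- rsum_scal.
  apply rsum_ext. intros; ring.
Qed.

Lemma PS_mult_ext_upto (a a' b b' : nat -> R) (n : nat) :
  (forall i, (i <= n)%nat -> a i = a' i) -> (forall i, (i <= n)%nat -> b i = b' i) ->
  PS_mult a b n = PS_mult a' b' n.
Proof.
  intros Ha Hb. rewrite !PS_mult_rsum. apply rsum_ext. intros i Hi.
  rewrite Ha, Hb by lia. reflexivity.
Qed.

Lemma PS_mult_X (a : nat -> R) (d n : nat) :
  PS_mult a (PS_X d) n = if (d <=? n)%nat then a (n - d)%nat else 0.
Proof.
  rewrite PS_mult_rsum. destruct (Nat.leb_spec d n) as [H|H].
  - rewrite (rsum_single _ 0 (S n) (n - d)); [|lia|].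
    + unfold PS_X. replace (n - (n - d) =? d)%nat with true by (symmetry; apply Nat.eqb_eq; lia). ring.
    + intros i Hi Hne. unfold PS_X. destruct (Nat.eqb_spec (n - i) d); [lia|ring].
  - apply rsum_zero. intros i Hi. unfold PS_X. destruct (Nat.eqb_spec (n - i) d); [lia|ring].
Qed.

Lemma PS_pow_X (m j : nat) : PS_pow (PS_X m) j = PS_X (m * j).
Proof.
  induction j as [|j IH].
  - now rewrite Nat.mul_0_r.
  - unfold PS_pow in *. simpl. rewrite IH. apply functional_extensionality. intros n.
    rewrite PS_mult_comm, PS_mult_X. unfold PS_X. rewrite Nat.mul_succ_r.
    destruct (Nat.leb_spec m n); destruct (Nat.eqb_spec n (m * j + m));
      try (destruct (Nat.eqb_spec (n - m) (m * j))); try lia; reflexivity.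
Qed.

(** The Euler operator q d/dq. As a derivation it turns the infinite products into sums of
    logarithmic derivatives. *)
Definition theta (a : nat -> R) : nat -> R := fun n => INR n * a n.

Lemma theta_mult (a b : nat -> R) :
  theta (PS_mult a b) = (fun n => PS_mult (theta a) b n + PS_mult a (theta b) n).
Proof.
  apply functional_extensionality. intros n. unfold theta at 1.
  rewrite !PS_mult_rsum, <- rsum_plus, <- rsum_scal. apply rsum_ext. intros i Hi.
  unfold theta. rewrite (minus_INR n i) by lia. ring.
Qed.

Definition factor (e : R) (d : nat) : nat -> R := fun n => PS_one n - e * PS_X d n.

(* [- theta (factor e d) / factor e d] *)
Definition lambert (e : R) (d : nat) : nat -> R := fun n =>
  if (n =? 0)%nat then 0 else if (n mod d =? 0)%nat then INR d * e ^ (n / d) else 0.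

Lemma PS_mult_factor (a : nat -> R) (e : R) (d n : nat) :
  PS_mult a (factor e d) n = a n - e * (if (d <=? n)%nat then a (n - d)%nat else 0).
Proof.
  rewrite <- PS_mult_X. unfold factor.
  transitivity (PS_mult a PS_one n - e * PS_mult a (PS_X d) n);
    [|now rewrite PS_mult_one_r].
  rewrite !PS_mult_rsum.
  unfold Rminus. rewrite Ropp_mult_distr_l, <- rsum_scal, <- rsum_plus.
  apply rsum_ext. intros; ring.
Qed.

(** Multiplied by 1 - e q^d, the series d (e q^d + e^2 q^(2d) + ...) telescopes to d e q^d. *)
Lemma theta_factor (e : R) (d : nat) : (1 <= d)%nat ->
  theta (factor e d) = (fun n => - PS_mult (lambert e d) (factor e d) n).
Proof.
  intros Hd. apply functional_extensionality. intros n. rewrite PS_mult_factor.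
  unfold theta, factor, lambert, PS_one, PS_X.
  destruct (Nat.eqb_spec n 0) as [->|Hn].
  { destruct (Nat.leb_spec d 0); [lia|]. simpl INR. ring. }
  destruct (Nat.leb_spec d n) as [H|H].
  - destruct (Nat.eqb_spec (n - d) 0).
    + assert (n = d) by lia. subst n. rewrite Nat.eqb_refl, Nat.Div0.mod_same, Nat.div_same by lia.
      simpl. ring.
    + destruct (Nat.eqb_spec n d); [lia|].
      assert (E1 : (n mod d = (n - d) mod d)%nat).
      { rewrite <- (Nat.Div0.mod_add (n - d) 1 d). f_equal. lia. }
      assert (E2 : (n / d = S ((n - d) / d))%nat).
      { rewrite <- Nat.add_1_r, <- Nat.div_add by lia. f_equal. lia. }
      rewrite E1, E2. destruct (Nat.eqb_spec ((n - d) mod d) 0); simpl; ring.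
  - destruct (Nat.eqb_spec n d); [lia|]. rewrite Nat.mod_small by lia.
    destruct (Nat.eqb_spec n 0); [lia|]. ring.
Qed.

Lemma lambert_large (e : R) (d n : nat) : (n < d)%nat -> lambert e d n = 0.
Proof.
  intros H. unfold lambert. destruct (Nat.eqb_spec n 0) as [|Hn]; [reflexivity|].
  rewrite Nat.mod_small by lia. destruct (Nat.eqb_spec n 0); [lia|reflexivity].
Qed.

(** The sum of (m d) e^(n / (m d)) over the divisors of n of the form m d. For m >= 1, indices d > n
    contribute nothing, so the cut at d = n loses nothing. *)
Definition lsum (e : R) (m n : nat) : R := rsum (fun d => lambert e (m * d) n) 1 n.

Lemma lsum_stable (e : R) (m n N : nat) : (1 <= m)%nat -> (n <= N)%nat ->
  rsum (fun d => lambert e (m * d) n) 1 N = lsum e m n.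
Proof.
  intros Hm HN. unfold lsum. replace N with (n + (N - n))%nat by lia.
  rewrite rsum_split. rewrite (rsum_zero _ (1 + n)); [ring|].
  intros i Hi. apply lambert_large. nia.
Qed.

Section Pochhammer.
Variables (e : R) (m : nat) (a : nat -> R).
Hypothesis Hm : (1 <= m)%nat.
Hypothesis Ha : forall n, a n = e * PS_X m n.

Lemma qpoch_fin_factor (N : nat) :
  qpoch_fin a (PS_X m) (S N) = PS_mult (qpoch_fin a (PS_X m) N) (factor e (m * S N)).
Proof.
  simpl. f_equal. apply functional_extensionality. intros n.
  unfold PS_minus, factor, plus, opp. simpl. unfold Rminus. f_equal. f_equal.
  rewrite PS_pow_X, PS_mult_X. rewrite Ha. unfold PS_X.
  rewrite Nat.mul_succ_r.
  destruct (Nat.leb_spec (m * N) n); destruct (Nat.eqb_spec n (m * N + m));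
    try (destruct (Nat.eqb_spec (n - m * N) m)); try lia; ring.
Qed.

Lemma theta_qpoch_fin (N : nat) :
  theta (qpoch_fin a (PS_X m) N) =
  (fun n => - PS_mult (fun i => rsum (fun d => lambert e (m * d) i) 1 N)
                (qpoch_fin a (PS_X m) N) n).
Proof.
  induction N as [|N IH].
  - apply functional_extensionality. intros n. unfold theta. simpl.
    rewrite PS_mult_one_r. unfold PS_one, PS_X. destruct n; simpl; ring.
  - rewrite qpoch_fin_factor, theta_mult, IH, theta_factor by nia.
    set (P := qpoch_fin a (PS_X m) N). set (f := factor e (m * S N)).
    apply functional_extensionality. intros n.
    replace (fun n0 : nat => - PS_mult (fun i : nat => rsum (fun d : nat => lambert e (m * d) i) 1 N) P n0)
      with (fun n0 : nat => -1 * PS_mult (fun i : nat => rsum (fun d : nat => lambert e (m * d) i) 1 N) P n0)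
      by (apply functional_extensionality; intros; ring).
    replace (fun n0 : nat => - PS_mult (lambert e (m * S N)) f n0)
      with (fun n0 : nat => -1 * PS_mult (lambert e (m * S N)) f n0)
      by (apply functional_extensionality; intros; ring).
    rewrite PS_mult_scal_l, PS_mult_assoc.
    rewrite (PS_mult_comm P (fun n0 => -1 * _)), PS_mult_scal_l.
    rewrite PS_mult_assoc, (PS_mult_comm f P).
    change (fun i : nat => rsum (fun d : nat => lambert e (m * d) i) 1 (S N))
      with (fun i : nat => rsum (fun d : nat => lambert e (m * d) i) 1 N + lambert e (m * S N) i).
    rewrite PS_mult_plus_l. ring.
Qed.

Lemma qpoch_fin_limit (n N : nat) : (n <= N)%nat ->
  qpoch a (PS_X m) n = qpoch_fin a (PS_X m) N n.
Proof.
  intros HN. apply qpoch_stable; [| |exact HN].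
  - rewrite Ha. unfold PS_X. destruct (Nat.eqb_spec 0 m); [lia|ring].
  - unfold PS_X. destruct (Nat.eqb_spec 0 m); [lia|ring].
Qed.

Lemma theta_qpoch :
  theta (qpoch a (PS_X m)) = (fun n => - PS_mult (lsum e m) (qpoch a (PS_X m)) n).
Proof.
  apply functional_extensionality. intros n.
  transitivity (theta (qpoch_fin a (PS_X m) n) n).
  { unfold theta. now rewrite (qpoch_fin_limit n n). }
  rewrite theta_qpoch_fin. f_equal. apply PS_mult_ext_upto.
  - intros i Hi. now apply lsum_stable.
  - intros i Hi. symmetry. now apply qpoch_fin_limit.
Qed.

Lemma qpoch_at_0 : qpoch a (PS_X m) 0%nat = 1.
Proof. rewrite (qpoch_fin_limit 0 0) by lia. reflexivity. Qed.
End Pochhammer.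

(** The coefficients of [theta b / b]: a Pochhammer product contributes [- lsum] times its exponent,
    which is 1 for (-q; q), -2 for (q; q) and -1 for the product with base q^(2k+1). *)
Definition weight (k n : nat) : R :=
  2 * lsum 1 1 n - lsum (-1) 1 n + lsum (-1) (2 * k + 1) n.

Lemma PS_mult_cancel (a b : nat -> R) :
  a 0%nat <> 0 -> (forall n, PS_mult b a n = 0) -> forall n, b n = 0.
Proof.
  intros Ha H n. rewrite <- (PS_mult_one_r b n).
  replace PS_one with (PS_mult a (PS_inv a)).
  - rewrite <- PS_mult_assoc. rewrite PS_mult_rsum. apply rsum_zero.
    intros i _. rewrite H. ring.
  - apply functional_extensionality. intros i. now apply PS_mult_inv.
Qed.

Lemma PS_opp_X (m n : nat) : (PS_opp (PS_X m) : nat -> R) n = -1 * PS_X m n.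
Proof. unfold PS_opp, opp. simpl. ring. Qed.

(** With numerator P and denominator D, applying [theta] to b D = P by the product rule gives (theta
    b - weight b) D = 0, and D is invertible since its constant term is 1. *)
Lemma theta_broken_diamond (k : nat) :
  theta (broken_diamond k) = PS_mult (weight k) (broken_diamond k).
Proof.
  set (K := (2 * k + 1)%nat).
  set (P := qpoch (PS_opp (PS_X 1)) (PS_X 1)).
  set (E := qpoch (PS_X 1) (PS_X 1)).
  set (Q := qpoch (PS_opp (PS_X K)) (PS_X K)).
  set (D := PS_mult (PS_pow E 2) Q).
  set (b := broken_diamond k).
  assert (HP : theta P = (fun n => - PS_mult (lsum (-1) 1) P n)).
  { apply theta_qpoch; [lia|apply PS_opp_X]. }
  assert (HQ : theta Q = (fun n => - PS_mult (lsum (-1) K) Q n)).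
  { apply theta_qpoch; [unfold K; lia|apply PS_opp_X]. }
  assert (HE : theta E = (fun n => - PS_mult (lsum 1 1) E n)).
  { apply theta_qpoch; [lia|]. intros; ring. }
  assert (Hneg : forall u v, PS_mult (fun n => - u n) v = (fun n => - PS_mult u v n)).
  { intros u v. apply functional_extensionality. intros n. rewrite !PS_mult_rsum.
    replace (- rsum (fun i => u i * v (n - i)%nat) 0 (S n)) with
      (-1 * rsum (fun i => u i * v (n - i)%nat) 0 (S n)) by ring.
    rewrite <- rsum_scal. apply rsum_ext. intros; ring. }
  assert (HE2 : PS_pow E 2 = PS_mult E E).
  { unfold PS_pow. simpl. f_equal. apply functional_extensionality. apply PS_mult_one_r. }
  assert (HD : theta D = (fun n => - PS_mult (fun i => 2 * lsum 1 1 i + lsum (-1) K i) D n)).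
  { unfold D. rewrite HE2, theta_mult, theta_mult, HE, HQ.
    apply functional_extensionality. intros n.
    rewrite (PS_mult_comm E (fun _ => - _)), !Hneg, PS_mult_plus_l, !Hneg.
    rewrite (PS_mult_comm (PS_mult E E) (fun _ => - _)), !Hneg.
    rewrite PS_mult_plus_l, PS_mult_scal_l, !PS_mult_assoc.
    rewrite (PS_mult_comm Q (PS_mult E E)), PS_mult_assoc. ring. }
  assert (HD0 : D 0%nat = 1).
  { unfold D. rewrite HE2, !PS_mult_rsum. cbn [rsum]. rewrite PS_mult_rsum. cbn [rsum]. simpl Nat.sub.
    assert (E0 : E 0%nat = 1) by (apply (qpoch_at_0 1 1); [lia|intros; ring]).
    assert (Q0 : Q 0%nat = 1) by (apply (qpoch_at_0 (-1) K); [unfold K; lia|apply PS_opp_X]).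
    rewrite E0, Q0. simpl. rewrite E0. ring. }
  assert (HbD : PS_mult b D = P).
  { unfold b, broken_diamond. fold K. fold P E Q D.
    rewrite PS_mult_assoc, (PS_mult_comm _ D). apply functional_extensionality. intros n.
    transitivity (PS_mult P PS_one n); [|apply PS_mult_one_r].
    apply PS_mult_ext_upto; [reflexivity|]. intros i _. apply PS_mult_inv. rewrite HD0. lra. }
  assert (Hz : forall n, theta b n - PS_mult (weight k) b n = 0).
  { apply (PS_mult_cancel D); [rewrite HD0; lra|]. intros n.
    replace (fun n0 => theta b n0 - PS_mult (weight k) b n0)
      with (fun n0 => theta b n0 + -1 * PS_mult (weight k) b n0)
      by (apply functional_extensionality; intros; ring).
    rewrite PS_mult_plus_l, PS_mult_scal_l, PS_mult_assoc, HbD.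
    assert (T := theta_mult b D). rewrite HbD, HP, HD in T.
    rewrite (PS_mult_comm b (fun _ => - _)), Hneg, PS_mult_assoc, (PS_mult_comm D b), HbD in T.
    apply (f_equal (fun f => f n)) in T.
    rewrite PS_mult_plus_l, PS_mult_scal_l in T.
    assert (W : weight k = (fun i => 2 * lsum 1 1 i + (-1 * lsum (-1) 1 i + lsum (-1) K i)))
      by (apply functional_extensionality; intros; unfold weight, K; ring).
    rewrite W, !PS_mult_plus_l, !PS_mult_scal_l. lra. }
  apply functional_extensionality. intros n. specialize (Hz n). lra.
Qed.

Lemma broken_diamond_0 (k : nat) : broken_diamond k 0%nat = 1.
Proof.
  unfold broken_diamond. set (K := (2 * k + 1)%nat).
  rewrite PS_mult_rsum. cbn [rsum]. simpl Nat.sub.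
  rewrite (qpoch_at_0 (-1) 1) by (try lia; apply PS_opp_X).
  unfold PS_inv. simpl. unfold PS_mult. simpl. unfold PS_mult; simpl.
  assert (E0 : qpoch (PS_X 1) (PS_X 1) 0%nat = 1) by (apply (qpoch_at_0 1 1); [lia|intros; ring]).
  assert (Q0 : qpoch (PS_opp (PS_X K)) (PS_X K) 0%nat = 1)
    by (apply (qpoch_at_0 (-1) K); [unfold K; lia|apply PS_opp_X]).
  rewrite E0, Q0.
  unfold PS_one, PS_X. simpl. field.
Qed.

Lemma broken_diamond_rec (k n : nat) :
  INR n * broken_diamond k n =
  rsum (fun l => weight k (n - l) * broken_diamond k l) 0 n.
Proof.
  change (INR n * broken_diamond k n) with (theta (broken_diamond k) n).
  rewrite theta_broken_diamond, PS_mult_comm, PS_mult_rsum. cbn [rsum].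
  replace (n - (0 + n))%nat with 0%nat by lia.
  (* This removes the term l = n, so that b(n) depends on earlier values only. *)
  assert (W : weight k 0 = 0) by (unfold weight, lsum; simpl; ring).
  rewrite W, Rmult_0_r, Rplus_0_r. apply rsum_ext. intros; ring.
Qed.

Lemma lambert_abs (e : R) (d n : nat) : Rabs e = 1 -> (d <= n)%nat ->
  Rabs (lambert e d n) <= INR n.
Proof.
  intros He Hd. unfold lambert. destruct (n =? 0)%nat; [rewrite Rabs_R0; apply pos_INR|].
  destruct (n mod d =? 0)%nat; [|rewrite Rabs_R0; apply pos_INR].
  rewrite Rabs_mult, <- RPow_abs, He, pow1, Rmult_1_r, Rabs_pos_eq by apply pos_INR.
  now apply le_INR.
Qed.

Lemma lsum_abs (e : R) (m n : nat) : Rabs e = 1 -> Rabs (lsum e m n) <= INR n * INR n.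
Proof.
  intros He. unfold lsum. eapply Rle_trans; [apply rsum_abs|].
  rewrite <- rsum_const with (a := 1%nat). apply rsum_le. intros i Hi.
  destruct (Nat.le_gt_cases (m * i) n).
  - now apply lambert_abs.
  - rewrite lambert_large, Rabs_R0 by lia. apply pos_INR.
Qed.

Lemma weight_upper (k n : nat) : weight k n <= 4 * (INR n * INR n).
Proof.
  unfold weight.
  assert (H1 := lsum_abs 1 1 n Rabs_R1).
  assert (E : Rabs (-1) = 1) by (rewrite Rabs_left; lra).
  assert (H2 := lsum_abs (-1) 1 n E). assert (H3 := lsum_abs (-1) (2 * k + 1) n E).
  apply Rabs_le_between in H1, H2, H3. lra.
Qed.

Lemma rsum_multiples (g : nat -> R) (K N : nat) :
  (1 <= K)%nat -> (forall d, 0 <= g d) ->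
  rsum (fun j => g (K * j)%nat) 1 N <= rsum g 1 (K * N).
Proof.
  intros HK Hg. induction N as [|N IH]; [rewrite Nat.mul_0_r; simpl; lra|].
  cbn [rsum]. replace (K * S N)%nat with (K * N + ((K - 1) + 1))%nat by nia.
  rewrite !rsum_split. cbn [rsum].
  assert (0 <= rsum g (1 + K * N) (K - 1)) by (apply rsum_pos; auto).
  replace (1 + K * N + (K - 1) + 0)%nat with (K * (1 + N))%nat by nia. lra.
Qed.

(** The squared factor supplies 2 sigma(n), with sigma the sum of divisors; each of the two
    alternating sums takes away at most sigma(n). The surplus comes from the divisor d = n, which
    enters [lsum (-1) 1 n] as - n. *)
Lemma weight_lower (k n : nat) : INR n <= weight k n.
Proof.
  destruct n as [|n']; [unfold weight, lsum; simpl; lra|]. set (n := S n').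
  set (g := fun d => lambert 1 d n).
  assert (Hg : forall d, 0 <= g d).
  { intros d. unfold g, lambert. destruct (n =? 0)%nat; [lra|].
    destruct (n mod d =? 0)%nat; [|lra]. rewrite pow1. assert (H := pos_INR d). lra. }
  assert (Hp : forall i : nat, -1 <= (-1) ^ i <= 1).
  { intros i. assert (H := pow_1_abs i).
    assert (H' : Rabs ((-1) ^ i) <= 1) by lra. apply Rabs_le_between in H'. lra. }
  assert (H1 : forall d, - g d <= lambert (-1) d n <= g d).
  { intros d. unfold g, lambert. destruct (n =? 0)%nat; [lra|].
    destruct (n mod d =? 0)%nat; [|lra]. rewrite pow1. assert (H := pos_INR d).
    specialize (Hp (n / d)%nat). nra. }
  unfold weight.
  assert (A1 : - rsum g 1 n <= lsum (-1) (2 * k + 1) n).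
  { apply Rle_trans with (- rsum (fun j => g ((2 * k + 1) * j)%nat) 1 n).
    - assert (M := rsum_multiples g (2 * k + 1) n ltac:(lia) Hg).
      replace ((2 * k + 1) * n)%nat with (n + (2 * k * n))%nat in M by nia.
      rewrite rsum_split, (rsum_zero _ (1 + n)) in M; [lra|].
      intros i Hi. apply lambert_large. lia.
    - unfold lsum. replace (- rsum (fun j => g ((2 * k + 1) * j)%nat) 1 n) with
        (rsum (fun j => -1 * g ((2 * k + 1) * j)%nat) 1 n) by (rewrite rsum_scal; ring).
      apply rsum_le. intros i Hi. specialize (H1 ((2 * k + 1) * i)%nat). lra. }
  assert (E1 : lsum 1 1 n = rsum g 1 n).
  { unfold lsum, g. apply rsum_ext. intros i Hi. f_equal. lia. }
  assert (E2 : lsum (-1) 1 n <= rsum g 1 n' - INR n).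
  { unfold lsum, n. cbn [rsum]. fold n. apply Rplus_le_compat.
    - apply rsum_le. intros i Hi. replace (1 * i)%nat with i by lia. apply H1.
    - replace (1 * (1 + n'))%nat with n by (unfold n; lia). unfold lambert.
      rewrite Nat.Div0.mod_same, Nat.div_same by (unfold n; lia).
      destruct (Nat.eqb_spec n 0); [unfold n in *; lia|]. rewrite Nat.eqb_refl. simpl; lra. }
  assert (E3 : rsum g 1 n = rsum g 1 n' + INR n).
  { unfold n at 1. cbn [rsum]. f_equal. unfold g. replace (1 + n')%nat with n by (unfold n; lia).
    unfold lambert. rewrite Nat.Div0.mod_same, Nat.div_same by (unfold n; lia).
    destruct (Nat.eqb_spec n 0); [unfold n in *; lia|]. rewrite Nat.eqb_refl. simpl; lra. }
  assert (H := pos_INR n). lra.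
Qed.

Lemma broken_diamond_pos (k n : nat) : 0 < broken_diamond k n.
Proof.
  induction n as [n IH] using (well_founded_induction lt_wf).
  destruct n as [|n]; [rewrite broken_diamond_0; lra|].
  apply Rmult_lt_reg_l with (INR (S n)); [apply lt_0_INR; lia|].
  rewrite Rmult_0_r, broken_diamond_rec. cbn [rsum].
  assert (0 <= rsum (fun l => weight k (S n - l) * broken_diamond k l) 0 n).
  { apply rsum_pos. intros i Hi. apply Rmult_le_pos.
    - eapply Rle_trans; [apply pos_INR|apply weight_lower].
    - left. apply IH. lia. }
  assert (0 < weight k (S n - (0 + n)) * broken_diamond k (0 + n)).
  { apply Rmult_lt_0_compat; [|apply IH; lia].
    eapply Rlt_le_trans; [|apply weight_lower]. apply lt_0_INR. lia. }
  lra.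
Qed.

(** * Symbol calculus and the Riccati equation *)

Definition ev (P : R -> Prop) : Prop := exists x0, forall x, x0 <= x -> P x.

Lemma ev_and (P Q : R -> Prop) : ev P -> ev Q -> ev (fun x => P x /\ Q x).
Proof.
  intros [x0 H0] [x1 H1]. exists (Rmax x0 x1). intros x Hx.
  assert (A := Rmax_l x0 x1). assert (B := Rmax_r x0 x1). split; [apply H0|apply H1]; lra.
Qed.

Lemma ev_imp (P Q : R -> Prop) : ev P -> (forall x, P x -> Q x) -> ev Q.
Proof. intros [x0 H0] H. exists x0. auto. Qed.

Lemma ev_ge (c : R) : ev (fun x => c <= x).
Proof. exists c. auto. Qed.

Lemma ev_half (P : R -> Prop) : ev P -> ev (fun x => forall y, x / 2 <= y -> P y).
Proof. intros [x0 H0]. exists (2 * x0). intros x Hx y Hy. apply H0. lra. Qed.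

Lemma Rpower_pos (x a : R) : 0 < Rpower x a.
Proof. apply exp_pos. Qed.

Lemma Rpower_le_neg (x y a : R) : 0 < x <= y -> a <= 0 -> Rpower y a <= Rpower x a.
Proof.
  intros Hx Ha. unfold Rpower. assert (ln x <= ln y) by (apply ln_le; lra).
  destruct (Req_dec (a * ln y) (a * ln x)) as [->|Hne]; [lra|].
  left. apply exp_increasing. nra.
Qed.

Lemma Rpower_weaken (x a b : R) : 1 <= x -> a <= b -> Rpower x a <= Rpower x b.
Proof.
  intros Hx Hab. destruct (Req_dec x 1) as [->|].
  - unfold Rpower. rewrite ln_1, !Rmult_0_r. lra.
  - destruct (Req_dec a b) as [->|]; [lra|]. left. apply Rpower_lt; lra.
Qed.

Lemma Rpower_small (a c : R) : 0 < a -> 0 < c -> ev (fun x => Rpower x (- a) <= c).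
Proof.
  intros Ha Hc. exists (Rpower (/ c) (/ a)). intros x Hx.
  assert (P := Rpower_pos (/ c) (/ a)).
  rewrite Rpower_Ropp. apply Rle_trans with (/ Rpower (Rpower (/ c) (/ a)) a).
  - apply Rinv_le_contravar; [apply Rpower_pos|]. apply Rle_Rpower_l; lra.
  - rewrite Rpower_mult, Rinv_l, Rpower_1, Rinv_inv by (try apply Rinv_0_lt_compat; lra). lra.
Qed.

Lemma is_derive_Rpower (a x : R) : 0 < x ->
  is_derive (fun t => Rpower t a) x (a * Rpower x (a - 1)).
Proof. intros Hx. apply is_derive_Reals. now apply derivable_pt_lim_power. Qed.

Lemma Rpower_comparable (x y a : R) : 0 < x -> x / 2 <= y <= x ->
  Rpower y a <= Rpower 2 (Rabs a) * Rpower x a.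
Proof.
  intros Hx Hy. unfold Rpower. rewrite <- exp_plus.
  assert (L1 : ln y <= ln x) by (apply ln_le; lra).
  assert (L2 : ln x <= ln 2 + ln y).
  { rewrite <- ln_mult by lra. apply ln_le; lra. }
  destruct (Req_dec (a * ln y) (Rabs a * ln 2 + a * ln x)) as [->|Hne]; [lra|].
  left. apply exp_increasing.
  unfold Rabs in *. destruct (Rcase_abs a); nra.
Qed.

Lemma is_derive_Rplus (f g : R -> R) (x a b : R) :
  is_derive f x a -> is_derive g x b -> is_derive (fun t => f t + g t) x (a + b).
Proof. intros Hf Hg. exact (is_derive_plus f g x a b Hf Hg). Qed.

Lemma is_derive_Rminus (f g : R -> R) (x a b : R) :
  is_derive f x a -> is_derive g x b -> is_derive (fun t => f t - g t) x (a - b).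
Proof. intros Hf Hg. exact (is_derive_minus f g x a b Hf Hg). Qed.

Lemma is_derive_Ropp (f : R -> R) (x a : R) :
  is_derive f x a -> is_derive (fun t => - f t) x (- a).
Proof. intros Hf. exact (is_derive_opp f x a Hf). Qed.

Lemma is_derive_Rscal (c : R) (f : R -> R) (x a : R) :
  is_derive f x a -> is_derive (fun t => c * f t) x (c * a).
Proof. intros Hf. exact (is_derive_scal f x c a Hf). Qed.

Lemma is_derive_Rmult (f g : R -> R) (x a b : R) :
  is_derive f x a -> is_derive g x b -> is_derive (fun t => f t * g t) x (a * g x + f x * b).
Proof. intros Hf Hg. exact (is_derive_mult f g x a b Hf Hg Rmult_comm). Qed.

Lemma is_derive_Rconst (c x : R) : is_derive (fun _ : R => c) x 0.
Proof. exact (is_derive_const c x). Qed.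

Lemma ex_MVT (f f' : R -> R) (a b : R) : a <= b ->
  (forall x, a <= x <= b -> is_derive f x (f' x)) ->
  exists c, a <= c <= b /\ f b - f a = f' c * (b - a).
Proof.
  intros Hab H. destruct (Req_dec a b) as [->|].
  - exists b. split; [lra|ring].
  - destruct (MVT_cor2 f f' a b) as [c [E Hc]]; [lra| |].
    + intros c Hc. apply is_derive_Reals. now apply H.
    + exists c. split; [lra|exact E].
Qed.

Definition bigO (b : R) (f : R -> R) : Prop :=
  exists C, 0 < C /\ ev (fun x => Rabs (f x) <= C * Rpower x (- b)).

Lemma bigO_intro (b C : R) (f : R -> R) :
  ev (fun x => Rabs (f x) <= C * Rpower x (- b)) -> bigO b f.
Proof.
  intros H. exists (Rabs C + 1). split; [assert (A := Rabs_pos C); lra|].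
  apply (ev_imp _ _ H). intros x Hx. eapply Rle_trans; [exact Hx|].
  apply Rmult_le_compat_r; [left; apply Rpower_pos|]. assert (A := Rle_abs C). lra.
Qed.

Lemma bigO_ext (b : R) (f g : R -> R) : ev (fun x => f x = g x) -> bigO b f -> bigO b g.
Proof.
  intros E [C [HC H]]. exists C. split; [exact HC|].
  apply (ev_imp _ _ (ev_and _ _ E H)). intros x [-> Hx]. exact Hx.
Qed.

Lemma bigO_weaken (b b' : R) (f : R -> R) : b' <= b -> bigO b f -> bigO b' f.
Proof.
  intros Hb [C [HC H]]. exists C. split; [exact HC|].
  apply (ev_imp _ _ (ev_and _ _ (ev_ge 1) H)). intros x [H1 Hx].
  eapply Rle_trans; [exact Hx|]. apply Rmult_le_compat_l; [lra|].
  apply Rpower_weaken; lra.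
Qed.

Lemma bigO_plus (b : R) (f g : R -> R) :
  bigO b f -> bigO b g -> bigO b (fun x => f x + g x).
Proof.
  intros [C [HC H]] [D [HD H']]. exists (C + D). split; [lra|].
  apply (ev_imp _ _ (ev_and _ _ H H')). intros x [Hf Hg].
  eapply Rle_trans; [apply Rabs_triang|]. lra.
Qed.

Lemma bigO_mult (b c : R) (f g : R -> R) :
  bigO b f -> bigO c g -> bigO (b + c) (fun x => f x * g x).
Proof.
  intros [C [HC H]] [D [HD H']]. exists (C * D). split; [nra|].
  apply (ev_imp _ _ (ev_and _ _ H H')). intros x [Hf Hg].
  rewrite Rabs_mult. replace (- (b + c)) with (- b + - c) by ring. rewrite Rpower_plus.
  replace (C * D * (Rpower x (- b) * Rpower x (- c))) with
    ((C * Rpower x (- b)) * (D * Rpower x (- c))) by ring.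
  apply Rmult_le_compat; auto using Rabs_pos.
Qed.

Lemma bigO_power (a : R) : bigO (- a) (fun x => Rpower x a).
Proof.
  exists 1. split; [lra|]. exists 0. intros x _.
  rewrite Rabs_pos_eq by (left; apply Rpower_pos). rewrite Ropp_involutive. lra.
Qed.

Lemma bigO_const (c : R) : bigO 0 (fun _ => c).
Proof.
  apply (bigO_intro 0 (Rabs c)). exists 1. intros x Hx. rewrite Ropp_0, Rpower_O; lra.
Qed.

Lemma bigO_scal (b c : R) (f : R -> R) : bigO b f -> bigO b (fun x => c * f x).
Proof.
  intros H. replace b with (0 + b) by ring. apply bigO_mult; [apply bigO_const|exact H].
Qed.

(* Symbols of order [-b] up to [k] derivatives: [f^(i) = O(x^(-b-i))] for [i <= k]. *)
Fixpoint Sym (k : nat) (b : R) (f : R -> R) : Prop :=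
  bigO b f /\
  match k with
  | O => True
  | S k' => exists f', ev (fun x => is_derive f x (f' x)) /\ Sym k' (b + 1) f'
  end.

Lemma Sym_bigO (k : nat) (b : R) (f : R -> R) : Sym k b f -> bigO b f.
Proof. destruct k; simpl; tauto. Qed.

Lemma Sym_lower (k : nat) (b : R) (f : R -> R) : Sym (S k) b f -> Sym k b f.
Proof.
  revert b f. induction k as [|k IH]; intros b f [H0 [f' [H1 H2]]]; split; auto.
  exists f'. split; auto.
Qed.

Lemma Sym_weaken (k : nat) (b b' : R) (f : R -> R) : b' <= b -> Sym k b f -> Sym k b' f.
Proof.
  revert b b' f. induction k as [|k IH]; intros b b' f Hb [H0 H1].
  - split; [now apply (bigO_weaken b)|exact I].
  - split; [now apply (bigO_weaken b)|]. destruct H1 as [f' [H1 H2]].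
    exists f'. split; [exact H1|]. apply (IH (b + 1)); [lra|exact H2].
Qed.

Lemma is_derive_ev_ext (f g f' : R -> R) :
  ev (fun x => f x = g x) -> ev (fun x => is_derive f x (f' x)) ->
  ev (fun x => is_derive g x (f' x)).
Proof.
  intros [x0 E] [x1 H]. exists (Rmax (x0 + 1) x1). intros x Hx.
  assert (A := Rmax_l (x0 + 1) x1). assert (B := Rmax_r (x0 + 1) x1).
  apply (is_derive_ext_loc f).
  - exists (mkposreal 1 Rlt_0_1). intros y Hy. apply E.
    unfold ball in Hy; simpl in Hy; unfold AbsRing_ball, abs, minus, plus, opp in Hy; simpl in Hy.
    apply Rabs_lt_between in Hy. lra.
  - apply H. lra.
Qed.

Lemma Sym_ext (k : nat) (b : R) (f g : R -> R) :
  ev (fun x => f x = g x) -> Sym k b f -> Sym k b g.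
Proof.
  intros E. destruct k as [|k]; intros [H0 H1].
  - split; [now apply (bigO_ext b f)|exact I].
  - split; [now apply (bigO_ext b f)|]. destruct H1 as [f' [H1 H2]].
    exists f'. split; [now apply (is_derive_ev_ext f)|exact H2].
Qed.

Lemma Sym_plus (k : nat) (b : R) (f g : R -> R) :
  Sym k b f -> Sym k b g -> Sym k b (fun x => f x + g x).
Proof.
  revert b f g. induction k as [|k IH]; intros b f g [F0 F1] [G0 G1].
  - split; [now apply bigO_plus|exact I].
  - split; [now apply bigO_plus|]. destruct F1 as [f' [F1 F2]], G1 as [g' [G1 G2]].
    exists (fun x => f' x + g' x). split; [|now apply IH].
    apply (ev_imp _ _ (ev_and _ _ F1 G1)). intros x [A B]. now apply is_derive_Rplus.
Qed.

Lemma Sym_mult (k : nat) (b c : R) (f g : R -> R) :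
  Sym k b f -> Sym k c g -> Sym k (b + c) (fun x => f x * g x).
Proof.
  revert b c f g. induction k as [|k IH]; intros b c f g HF HG.
  - split; [apply bigO_mult; [apply HF|apply HG]|exact I].
  - assert (LF := Sym_lower _ _ _ HF). assert (LG := Sym_lower _ _ _ HG).
    destruct HF as [F0 [f' [F1 F2]]], HG as [G0 [g' [G1 G2]]].
    split; [now apply bigO_mult|].
    exists (fun x => f' x * g x + f x * g' x). split.
    + apply (ev_imp _ _ (ev_and _ _ F1 G1)). intros x [A B].
      now apply is_derive_Rmult.
    + apply Sym_plus.
      * replace (b + c + 1) with (b + 1 + c) by ring. now apply IH.
      * replace (b + c + 1) with (b + (c + 1)) by ring. now apply IH.
Qed.

Lemma Sym_const (k : nat) (c : R) : Sym k 0 (fun _ => c).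
Proof.
  assert (Z : forall k b, Sym k b (fun _ => 0)).
  { clear k. induction k as [|k IH]; intros b.
    - split; [|exact I]. apply (bigO_intro b 0). exists 0. intros. rewrite Rabs_R0. lra.
    - split; [apply (Sym_bigO k), IH|]. exists (fun _ => 0). split; [|apply IH].
      exists 0. intros x _. apply is_derive_Rconst. }
  destruct k as [|k]; (split; [apply bigO_const|]); [exact I|].
  exists (fun _ => 0). split; [|apply Z]. exists 0. intros x _. apply is_derive_Rconst.
Qed.

Lemma Sym_scal (k : nat) (b c : R) (f : R -> R) : Sym k b f -> Sym k b (fun x => c * f x).
Proof.
  intros H. replace b with (0 + b) by ring. apply Sym_mult; [apply Sym_const|exact H].
Qed.

Lemma Sym_minus (k : nat) (b : R) (f g : R -> R) :
  Sym k b f -> Sym k b g -> Sym k b (fun x => f x - g x).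
Proof.
  intros F G. apply (Sym_ext _ _ (fun x => f x + -1 * g x)).
  - exists 0. intros; ring.
  - apply Sym_plus; [exact F|now apply Sym_scal].
Qed.

Lemma Sym_power (k : nat) (a : R) : Sym k (- a) (fun x => Rpower x a).
Proof.
  revert a. induction k as [|k IH]; intros a.
  - split; [apply bigO_power|exact I].
  - split; [apply bigO_power|]. exists (fun x => a * Rpower x (a - 1)). split.
    + exists 1. intros x Hx. apply is_derive_Rpower. lra.
    + apply Sym_scal. replace (- a + 1) with (- (a - 1)) by ring. apply IH.
Qed.

Lemma Sym_derive (k : nat) (b : R) (f f' : R -> R) :
  bigO b f -> ev (fun x => is_derive f x (f' x)) -> Sym k (b + 1) f' -> Sym (S k) b f.
Proof. intros. split; [assumption|]. now exists f'. Qed.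

(** If f(b) were positive, let s be the last point before b with f(s) <= 0. Between s and b the
    function is positive, hence has derivative <= 0, and the mean value theorem on [s, b]
    contradicts f(s) <= 0 < f(b). *)
Lemma barrier (f f' : R -> R) (a : R) :
  (forall x, a <= x -> is_derive f x (f' x)) -> f a <= 0 ->
  (forall x, a <= x -> 0 < f x -> f' x <= 0) -> forall b, a <= b -> f b <= 0.
Proof.
  intros Hd Ha Hf b Hb. apply Rnot_lt_le. intros Hpos.
  set (E := fun t => a <= t <= b /\ f t <= 0).
  destruct (completeness E) as [s [Hub Hlub]].
  { exists b. intros t [Ht _]. lra. }
  { exists a. split; [lra|exact Ha]. }
  assert (Has : a <= s) by (apply Hub; split; [lra|exact Ha]).
  assert (Hsb : s <= b) by (apply Hlub; intros t [Ht _]; lra).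
  assert (Hcont : forall x, a <= x -> continuous f x).
  { intros x Hx. apply (ex_derive_continuous f). exists (f' x). now apply Hd. }
  assert (Hs : f s <= 0).
  { apply Rnot_lt_le. intros Hs.
    destruct (Hcont s Has (fun y => 0 < y)) as [d Hd'].
    { exists (mkposreal _ Hs). intros y Hy. unfold ball in Hy; simpl in Hy.
      unfold AbsRing_ball, abs, minus, plus, opp in Hy; simpl in Hy.
      apply Rabs_lt_between in Hy. lra. }
    assert (H : s <= s - d / 2); [|destruct d as [d Hd0]; simpl in *; lra].
    apply Hlub. intros t [Ht Hft]. apply Rnot_lt_le. intros Hlt.
    assert (Hts : t <= s) by (apply Hub; split; assumption).
    assert (0 < f t); [|lra]. apply Hd'. unfold ball; simpl.
    unfold AbsRing_ball, abs, minus, plus, opp; simpl.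
    destruct d as [d Hd0]; simpl in *. apply Rabs_lt_between. lra. }
  destruct (MVT_cor2 f f' s b) as [c [Ec Hc]].
  { destruct (Req_dec s b) as [->|]; lra. }
  { intros c Hc. apply is_derive_Reals. apply Hd. lra. }
  assert (Hfc : 0 < f c).
  { apply Rnot_le_lt. intros Hle. assert (c <= s); [|lra]. apply Hub. split; [lra|exact Hle]. }
  assert (f' c <= 0) by (apply Hf; lra). nra.
Qed.

Section LinearODE.
Variables (q : R -> R) (c : R).
Hypothesis Hc : 0 < c.
Hypothesis Hq : ev (fun x => c * Rpower x (- (1 / 2)) <= q x).

(* The curve [K x ^ (1/2 - b)] is a barrier that [y] cannot cross upwards. *)
Lemma damped_upper (y h : R -> R) (b : R) :
  ev (fun x => is_derive y x (- q x * y x + h x)) -> bigO b h ->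
  exists K, ev (fun x => y x <= K * Rpower x (1 / 2 - b)).
Proof.
  intros Hy [C [HC Hh]]. set (d := Rabs (1 / 2 - b)).
  assert (Hd : 0 <= d) by apply Rabs_pos.
  assert (Hs := Rpower_small (1 / 2) (c / (4 * (d + 1))) ltac:(lra)
    ltac:(apply Rdiv_lt_0_compat; lra)).
  destruct (ev_and _ _ (ev_and _ _ Hq Hy) (ev_and _ _ Hh (ev_and _ _ Hs (ev_ge 1)))) as [x0 H].
  set (x1 := Rmax x0 1).
  assert (X0 : x0 <= x1) by apply Rmax_l. assert (X1 : 1 <= x1) by apply Rmax_r.
  (* The first summand keeps the forcing below a quarter of the damping; the second puts the barrier
     above [y] at the starting point [x1]. The derivative of the power costs another quarter, by the
     choice of [Hs]. *)
  set (K := 4 * C / c + Rabs (y x1) * Rpower x1 (b - 1 / 2)).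
  assert (HK0 : 0 <= Rabs (y x1) * Rpower x1 (b - 1 / 2)).
  { apply Rmult_le_pos; [apply Rabs_pos|left; apply Rpower_pos]. }
  assert (HK1 : 4 * C <= c * K).
  { unfold K. rewrite Rmult_plus_distr_l. replace (c * (4 * C / c)) with (4 * C) by (field; lra). nra. }
  assert (HKp : 0 < K) by nra.
  exists K. exists x1. intros x Hx.
  cut (y x - K * Rpower x (1 / 2 - b) <= 0); [lra|].
  apply (barrier (fun x => y x - K * Rpower x (1 / 2 - b))
    (fun x => (- q x * y x + h x) - K * ((1 / 2 - b) * Rpower x (1 / 2 - b - 1))) x1);
    [| | |exact Hx].
  - intros t Ht. apply is_derive_Rminus; [apply H; lra|].
    apply is_derive_Rscal. apply is_derive_Rpower. lra.
  - cbv beta. unfold K. rewrite Rmult_plus_distr_r, Rmult_assoc, <- Rpower_plus.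
    replace (b - 1 / 2 + (1 / 2 - b)) with 0 by ring. rewrite Rpower_O by lra.
    assert (A := Rle_abs (y x1)).
    assert (0 <= 4 * C / c * Rpower x1 (1 / 2 - b)); [|lra].
    apply Rmult_le_pos; [apply Rdiv_le_0_compat; lra|left; apply Rpower_pos].
  - intros t Ht Hpos. cbv beta in Hpos.
    destruct (H t ltac:(lra)) as [[Hqt Hyt] [Hht [Hst H1t]]].
    set (P := Rpower t (- b)). assert (HP : 0 < P) by apply Rpower_pos.
    set (S := Rpower t (- (1 / 2))) in *. assert (HS : 0 < S) by apply Rpower_pos.
    assert (E1 : Rpower t (1 / 2 - b) * S = P).
    { unfold S, P. rewrite <- Rpower_plus. f_equal. ring. }
    assert (E2 : Rpower t (1 / 2 - b - 1) = S * P).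
    { unfold S, P. rewrite <- Rpower_plus. f_equal. field. }
    rewrite E2. fold P in Hht. apply Rabs_le_between in Hht.
    assert (Q1 : K * c * P <= q t * y t).
    { rewrite <- E1. assert (T := Rpower_pos t (1 / 2 - b)).
      set (R0 := Rpower t (1 / 2 - b)) in *.
      apply Rle_trans with ((c * S) * (K * R0)); [right; ring|].
      apply Rmult_le_compat; nra. }
    assert (D1 : - (1 / 2 - b) * S <= c / 4).
    { apply Rle_trans with (d * S).
      - apply Rmult_le_compat_r; [lra|]. unfold d. assert (A := Rle_abs (- (1 / 2 - b))).
        rewrite Rabs_Ropp in A. exact A.
      - apply Rle_trans with ((d + 1) * (c / (4 * (d + 1)))); [|right; field; lra].
        apply Rmult_le_compat; lra. }
    assert (D2 : - K * ((1 / 2 - b) * (S * P)) <= c * K * P / 4).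
    { replace (- K * ((1 / 2 - b) * (S * P))) with ((K * P) * (- (1 / 2 - b) * S)) by ring.
      replace (c * K * P / 4) with ((K * P) * (c / 4)) by field.
      apply Rmult_le_compat_l; nra. }
    nra.
Qed.

Lemma damped_bigO (y h : R -> R) (b : R) :
  ev (fun x => is_derive y x (- q x * y x + h x)) -> bigO b h -> bigO (b - 1 / 2) y.
Proof.
  intros Hy Hh. destruct (damped_upper y h b Hy Hh) as [K1 H1].
  destruct (damped_upper (fun x => - y x) (fun x => - h x) b) as [K2 H2].
  - apply (ev_imp _ _ Hy). intros x Hx.
    replace (- q x * - y x + - h x) with (- (- q x * y x + h x)) by ring.
    now apply is_derive_Ropp.
  - apply (bigO_ext b (fun x => -1 * h x)); [exists 0; intros; ring|now apply bigO_scal].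
  - apply (bigO_intro _ (Rabs K1 + Rabs K2)).
    apply (ev_imp _ _ (ev_and _ _ H1 H2)). intros x [A B].
    replace (- (b - 1 / 2)) with (1 / 2 - b) by ring.
    assert (P := Rpower_pos x (1 / 2 - b)).
    assert (A1 := Rle_abs K1). assert (A2 := Rle_abs K2).
    assert (A3 := Rabs_pos K1). assert (A4 := Rabs_pos K2).
    apply Rabs_le. split; nra.
Qed.

(** Differentiating the equation gives y'' = - q y' + (h' - q' y), so that y' solves an equation
    with the same damping and a source one order smaller, to which the induction hypothesis
    applies. *)
Lemma damped_Sym (k : nat) : Sym k (1 / 2) q -> forall (y h : R -> R) (b : R),
  ev (fun x => is_derive y x (- q x * y x + h x)) -> Sym k b h -> Sym k (b - 1 / 2) y.
Proof.
  induction k as [|k IH]; intros HQ y h b Hy HH.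
  - split; [|exact I]. apply (damped_bigO y h b Hy). apply HH.
  - assert (LQ := Sym_lower _ _ _ HQ). assert (LH := Sym_lower _ _ _ HH).
    assert (LY := IH LQ y h b Hy LH).
    destruct HQ as [Q0 [q' [Q1 Q2]]]. destruct HH as [H0 [h' [H1 H2]]].
    split; [apply (damped_bigO y h b Hy H0)|].
    exists (fun x => - q x * y x + h x). split; [exact Hy|].
    replace (b - 1 / 2 + 1) with (b + 1 - 1 / 2) by ring.
    apply (IH LQ _ (fun x => h' x - q' x * y x)).
    + apply (ev_imp _ _ (ev_and _ _ Hy (ev_and _ _ Q1 H1))). intros x [A [B D]].
      assert (E := is_derive_Rplus (fun x => - q x * y x) h x _ _
        (is_derive_Rmult (fun x => - q x) y x _ _ (is_derive_Ropp q x _ B) A) D).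
      replace (- q x * (- q x * y x + h x) + (h' x - q' x * y x)) with
        (- q' x * y x + - q x * (- q x * y x + h x) + h' x) by ring. exact E.
    + apply Sym_minus; [exact H2|]. replace (b + 1) with (1 / 2 + 1 + (b - 1 / 2)) by field.
      now apply Sym_mult.
Qed.
End LinearODE.

Section Riccati.
Variables (A : R) (u : R -> R).
Hypothesis HA : 0 < A.
Hypothesis Hu : forall x, 0 < x -> 0 < u x.
Hypothesis Hd : forall x, 0 < x -> is_derive u x (A / x - 3 * u x / x - u x * u x).

(** With phi = sqrt(A) x^(-1/2), which solves phi^2 = A / x, the difference e = u - phi satisfies a
    linear equation, because u^2 - phi^2 = (u + phi) e. Its damping u + phi + 3 / x is at least phi
    since u > 0, and its source is - phi' - 3 phi / x, which explains the constant - 5/2. *)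
Lemma riccati_Sym (k : nat) :
  Sym k 1 (fun x => u x - sqrt A * Rpower x (- (1 / 2))).
Proof.
  set (e := fun x => u x - sqrt A * Rpower x (- (1 / 2))).
  set (phi := fun x => sqrt A * Rpower x (- (1 / 2))).
  set (q := fun x => u x + phi x + 3 * Rpower x (- 1)).
  set (g := fun x => (- (5 / 2) * sqrt A) * Rpower x (- (3 / 2))).
  assert (HsA : 0 < sqrt A) by now apply sqrt_lt_R0.
  assert (Hq : ev (fun x => sqrt A * Rpower x (- (1 / 2)) <= q x)).
  { exists 1. intros x Hx. unfold q, phi. assert (P := Rpower_pos x (- 1)).
    assert (U := Hu x ltac:(lra)). lra. }
  assert (He : ev (fun x => is_derive e x (- q x * e x + g x))).
  { exists 1. intros x Hx.
    assert (D := is_derive_Rminus u phi x _ _ (Hd x ltac:(lra))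
      (is_derive_Rscal (sqrt A) _ x _ (is_derive_Rpower (- (1 / 2)) x ltac:(lra)))).
    match type of D with is_derive _ _ ?v => replace (- q x * e x + g x) with v; [exact D|] end.
    unfold q, e, g, phi. set (S := Rpower x (- (1 / 2))).
    assert (E3 : Rpower x (- 1) = / x) by (rewrite <- (Rpower_1 x) at 2 by lra; now rewrite <- Rpower_Ropp).
    assert (E1 : Rpower x (- (3 / 2)) = S / x).
    { unfold Rdiv at 2. rewrite <- E3. unfold S. rewrite <- Rpower_plus. f_equal. field. }
    assert (E2 : Rpower x (- (1 / 2) - 1) = S / x).
    { rewrite <- E1. f_equal. field. }
    assert (E4 : S * S = / x).
    { unfold S. rewrite <- Rpower_plus, <- E3. f_equal. field. }
    assert (E5 : sqrt A * sqrt A = A) by (apply sqrt_sqrt; lra).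
    rewrite E1, E2, E3. replace (A / x) with ((sqrt A * sqrt A) * (S * S)) by (rewrite E4, E5; reflexivity).
    field. lra. }
  assert (Hg : forall k, Sym k (3 / 2) g).
  { intros k'. unfold g. apply Sym_scal. rewrite <- (Ropp_involutive (3 / 2)) at 1. apply Sym_power. }
  assert (Hrest : forall k, Sym k (1 / 2) (fun x => 2 * phi x + 3 * Rpower x (- 1))).
  { intros k'. apply Sym_plus.
    - apply Sym_scal. unfold phi. apply Sym_scal.
      rewrite <- (Ropp_involutive (1 / 2)) at 1. apply Sym_power.
    - apply Sym_scal. apply (Sym_weaken _ 1); [lra|].
      rewrite <- (Ropp_involutive 1) at 1. apply Sym_power. }
  assert (HqS : forall k, Sym k (1 / 2) e -> Sym k (1 / 2) q).
  { intros k' H. apply (Sym_ext _ _ (fun x => e x + (2 * phi x + 3 * Rpower x (- 1)))).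
    - exists 0. intros; unfold e, q, phi; ring.
    - now apply Sym_plus. }
  induction k as [|k IH].
  - split; [|exact I]. replace 1 with (3 / 2 - 1 / 2) by field.
    apply (damped_bigO q (sqrt A) HsA Hq e g); [exact He|]. apply (Sym_bigO 0), Hg.
  (* The equation itself provides one more derivative of [e], at the cost of half a power. This is
     enough to make [q] a symbol of order 1/2 with one more derivative, after which [damped_Sym]
     restores the full order 1. *)
  - assert (W : Sym (S k) (1 / 2) e).
    { apply (Sym_derive _ _ _ (fun x => - q x * e x + g x)); [|exact He|].
      - apply (bigO_weaken 1); [lra|]. now apply (Sym_bigO k).
      - apply (Sym_ext _ _ (fun x => -1 * (q x * e x) + g x)); [exists 0; intros; ring|].
        apply Sym_plus.
        + apply Sym_scal. replace (1 / 2 + 1) with (1 / 2 + 1) by ring. apply Sym_mult; [|exact IH].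
          apply HqS. apply (Sym_weaken _ 1); [lra|exact IH].
        + replace (1 / 2 + 1) with (3 / 2) by field. apply Hg. }
    replace 1 with (3 / 2 - 1 / 2) by field.
    apply (damped_Sym q (sqrt A) HsA Hq (S k) (HqS _ W) e g); [exact He|apply Hg].
Qed.
End Riccati.

(** * Backward differences of symbols *)

Definition diff1 (f : R -> R) : R -> R := fun x => f x - f (x - 1).

Lemma ev_shift (P : R -> Prop) : ev P -> ev (fun x => P (x - 1)).
Proof. intros [x0 H]. exists (x0 + 1). intros x Hx. apply H. lra. Qed.

Lemma is_derive_diff1 (f f' : R -> R) :
  ev (fun x => is_derive f x (f' x)) -> ev (fun x => is_derive (diff1 f) x (diff1 f' x)).
Proof.
  intros H. apply (ev_imp _ _ (ev_and _ _ H (ev_shift _ H))). intros x [A B].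
  apply is_derive_Rminus; [exact A|].
  replace (f' (x - 1)) with (scal 1 (f' (x - 1))) by apply Rmult_1_l.
  apply (is_derive_comp f (fun t => t - 1)); [exact B|].
  auto_derive; [exact I|ring].
Qed.

Lemma bigO_diff1 (b : R) (f f' : R -> R) :
  ev (fun x => is_derive f x (f' x)) -> bigO b f' -> bigO b (diff1 f).
Proof.
  intros Hd [C [HC H]].
  apply (bigO_intro _ (C * Rpower 2 (Rabs (- b)))).
  apply (ev_imp _ _ (ev_and _ _ (ev_half _ Hd) (ev_and _ _ (ev_half _ H) (ev_ge 2)))).
  intros x [A [B Hx]].
  destruct (ex_MVT f f' (x - 1) x) as [c [Hc E]]; [lra|intros; apply A; lra|].
  unfold diff1. rewrite E. replace (x - (x - 1)) with 1 by ring. rewrite Rmult_1_r.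
  eapply Rle_trans; [apply B; lra|]. rewrite Rmult_assoc. apply Rmult_le_compat_l; [lra|].
  apply Rpower_comparable; lra.
Qed.

Lemma Sym_diff1 (k : nat) (b : R) (f : R -> R) : Sym (S k) b f -> Sym k (b + 1) (diff1 f).
Proof.
  revert b f. induction k as [|k IH]; intros b f [F0 [f' [F1 F2]]].
  - split; [|exact I]. apply (bigO_diff1 _ f f' F1). apply F2.
  - split; [apply (bigO_diff1 _ f f' F1); now apply (Sym_bigO (S k))|].
    exists (diff1 f'). split; [now apply is_derive_diff1|]. now apply IH.
Qed.

(** The bound itself is the mean value theorem applied twice; the derivative of the expression is a
    times the same expression for the exponent a - 1, so the induction runs over all exponents at
    once. *)
Lemma Sym_diff1_power (k : nat) (a : R) :
  Sym k (2 - a) (fun x => diff1 (fun t => Rpower t a) x - a * Rpower x (a - 1)).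
Proof.
  assert (B : forall a, bigO (2 - a) (fun x => diff1 (fun t => Rpower t a) x - a * Rpower x (a - 1))).
  { clear a. intros a. apply (bigO_intro _ (Rabs (a * (a - 1)) * Rpower 2 (Rabs (a - 2)))).
    exists 2. intros x Hx. unfold diff1.
    destruct (ex_MVT (fun t => Rpower t a) (fun t => a * Rpower t (a - 1)) (x - 1) x) as [c [Hc E]];
      [lra|intros; apply is_derive_Rpower; lra|].
    destruct (ex_MVT (fun t => a * Rpower t (a - 1)) (fun t => a * ((a - 1) * Rpower t (a - 1 - 1))) c x) as [d [Hd' E2]];
      [lra|intros; apply is_derive_Rscal; apply is_derive_Rpower; lra|].
    rewrite E. replace (x - (x - 1)) with 1 by ring. rewrite Rmult_1_r.
    rewrite Rabs_minus_sym, E2.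
    replace (a - 1 - 1) with (a - 2) by ring. replace (- (2 - a)) with (a - 2) by ring.
    replace (a * ((a - 1) * Rpower d (a - 2)) * (x - c)) with
      ((a * (a - 1)) * (Rpower d (a - 2) * (x - c))) by ring.
    rewrite Rabs_mult, Rmult_assoc. apply Rmult_le_compat_l; [apply Rabs_pos|].
    rewrite Rabs_pos_eq by (apply Rmult_le_pos; [left; apply Rpower_pos|lra]).
    apply Rle_trans with (Rpower d (a - 2) * 1).
    - apply Rmult_le_compat_l; [left; apply Rpower_pos|lra].
    - rewrite Rmult_1_r. apply Rpower_comparable; lra. }
  revert a. induction k as [|k IH]; intros a; [split; [apply B|exact I]|].
  apply (Sym_derive _ _ _ (fun x => a * (diff1 (fun t => Rpower t (a - 1)) x - (a - 1) * Rpower x (a - 1 - 1)))).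
  - apply B.
  - assert (H1 := is_derive_diff1 (fun t => Rpower t a) (fun t => a * Rpower t (a - 1))
      ltac:(exists 1; intros; apply is_derive_Rpower; lra)).
    apply (ev_imp _ _ (ev_and _ _ H1 (ev_ge 2))). intros x [H2 Hx].
    replace (a * (diff1 (fun t => Rpower t (a - 1)) x - (a - 1) * Rpower x (a - 1 - 1))) with
      (diff1 (fun t => a * Rpower t (a - 1)) x - a * ((a - 1) * Rpower x (a - 1 - 1)))
      by (unfold diff1; ring).
    apply is_derive_Rminus; [exact H2|]. apply is_derive_Rscal. apply is_derive_Rpower; lra.
  - apply Sym_scal. replace (2 - a + 1) with (2 - (a - 1)) by ring. apply IH.
Qed.

(** The falling factorial (1/2)(1/2 - 1)...(1/2 - r + 1), the coefficient in the r-th derivative of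
    x^(1/2). *)
Fixpoint half_falling (r : nat) : R :=
  match r with O => 1 | S r' => (1 / 2 - INR r') * half_falling r' end.

Lemma diff_sqrt_Sym (r k : nat) :
  Sym k (INR r + 1 / 2)
    (fun x => Nat.iter r diff1 (fun t => Rpower t (1 / 2)) x - half_falling r * Rpower x (1 / 2 - INR r)).
Proof.
  revert k. induction r as [|r IH]; intros k.
  - apply (Sym_ext _ _ (fun _ => 0)).
    + exists 0. intros. simpl. rewrite Rminus_0_r. ring.
    + apply (Sym_ext _ _ (fun x => 0 * Rpower x (- (INR 0 + 1 / 2)))); [exists 0; intros; ring|].
      apply Sym_scal. rewrite <- (Ropp_involutive (INR 0 + 1 / 2)) at 1. apply Sym_power.
  - assert (H1 := Sym_diff1 k _ _ (IH (S k))).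
    assert (H2 := Sym_scal k _ (half_falling r) _ (Sym_diff1_power k (1 / 2 - INR r))).
    replace (2 - (1 / 2 - INR r)) with (INR r + 1 / 2 + 1) in H2 by field.
    rewrite S_INR. replace (INR r + 1 + 1 / 2) with (INR r + 1 / 2 + 1) by ring.
    refine (Sym_ext _ _ _ _ _ (Sym_plus _ _ _ _ H1 H2)).
    exists 0. intros x _. simpl. unfold diff1.
    replace (1 / 2 - (INR r + 1)) with (1 / 2 - INR r - 1) by ring. ring.
Qed.

Lemma diff_Sym (r k : nat) (b : R) (f : R -> R) :
  Sym (r + k) b f -> Sym k (b + INR r) (Nat.iter r diff1 f).
Proof.
  revert k. induction r as [|r IH]; intros k H.
  - simpl. now rewrite Rplus_0_r.
  - rewrite S_INR. replace (b + (INR r + 1)) with (b + INR r + 1) by ring.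
    simpl. apply Sym_diff1. apply IH. now rewrite Nat.add_succ_r.
Qed.

(** * The value of zeta(2) *)

(** The double angle formula. Writing the cosine as the sine of the complementary angle gives both
    terms the same shape, so that the identity can be iterated. *)
Lemma inv_sin2_halve (x : R) : 0 < x < PI ->
  / (sin x)² = / 4 * (/ (sin (x / 2))² + / (sin (PI / 2 - x / 2))²).
Proof.
  intros Hx. rewrite sin_shift.
  assert (H1 : 0 < sin (x / 2)) by (apply sin_gt_0; lra).
  assert (H2 : 0 < cos (x / 2)) by (apply cos_gt_0; lra).
  replace x with (2 * (x / 2)) at 1 by field. rewrite sin_2a.
  assert (E := sin2_cos2 (x / 2)). unfold Rsqr in *.
  set (s := sin (x / 2)) in *. set (c := cos (x / 2)) in *.
  replace (/ (s * s) + / (c * c)) with ((s * s + c * c) / ((s * c) * (s * c))) by (field; lra).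
  rewrite E. field. lra.
Qed.

Lemma tan_gt_id (x : R) : 0 < x < PI / 2 -> x < tan x.
Proof.
  intros Hx.
  assert (Hc : forall c, 0 <= c <= x -> 0 < cos c) by (intros c Hc; apply cos_gt_0; lra).
  destruct (MVT_cor2 tan (fun c => 1 + (tan c)²) 0 x) as [c [E Hcx]]; [lra| |].
  - intros c Hcc. specialize (Hc c Hcc). unfold Rsqr.
    replace (1 + tan c * tan c) with (tan c ^ 2 + 1) by ring. apply is_derive_Reals, is_derive_tan. now apply Rgt_not_eq.
  - rewrite tan_0 in E. assert (0 < tan c) by (apply tan_gt_0; lra).
    unfold Rsqr in E. set (t := tan c) in *. assert (0 < t * t) by (now apply Rmult_lt_0_compat). assert (0 < x * (t * t)) by (apply Rmult_lt_0_compat; [tauto|assumption]). lra.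
Qed.

Lemma inv_sin2_bounds (x : R) : 0 < x < PI / 2 ->
  / (sin x)² - 1 <= / x² <= / (sin x)².
Proof.
  intros Hx.
  assert (Hs : 0 < sin x) by (apply sin_gt_0; lra).
  assert (Hc : 0 < cos x) by (apply cos_gt_0; lra).
  assert (Hl := sin_lt_x x ltac:(lra)).
  assert (Ht := tan_gt_id x Hx). unfold tan in Ht.
  assert (E := sin2_cos2 x). unfold Rsqr in *. split.
  - replace (/ (sin x * sin x) - 1) with ((cos x / sin x) * (cos x / sin x)).
    + rewrite Rinv_mult. assert (0 < cos x / sin x) by (apply Rdiv_lt_0_compat; lra).
      assert (cos x / sin x <= / x); [|apply Rmult_le_compat; lra].
      apply Rmult_le_reg_r with x; [lra|]. rewrite Rinv_l by lra.
      apply Rmult_le_reg_l with (sin x / cos x); [apply Rdiv_lt_0_compat; lra|].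
      replace (sin x / cos x * (cos x / sin x * x)) with x by (field; lra). lra.
    + replace (cos x / sin x * (cos x / sin x)) with ((cos x * cos x) / (sin x * sin x)) by (field; lra).
      replace (cos x * cos x) with (1 - sin x * sin x) by lra. field. lra.
  - apply Rinv_le_contravar; nra.
Qed.

Lemma INR_two_pow (n : nat) : INR (2 ^ n) = 2 ^ n.
Proof. rewrite pow_INR. f_equal. Qed.

Definition odd_angle (n j : nat) : R := (2 * INR j + 1) * PI / 2 ^ (n + 2).

(** Each angle of level n splits into its half and the complement of its half. The halves are the
    first 2^n angles of level n + 1, the complements the remaining ones in reverse order; the factor
    4 comes from [inv_sin2_halve]. *)
Lemma sum_inv_sin2 (n : nat) :
  rsum (fun j => / (sin (odd_angle n j))²) 0 (2 ^ n) = 2 * 4 ^ n.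
Proof.
  induction n as [|n IH].
  - simpl. unfold odd_angle. simpl. replace ((2 * 0 + 1) * PI / (2 * (2 * 1))) with (PI / 4) by field.
    rewrite sin_PI4. unfold Rsqr. assert (H := sqrt_sqrt 2 ltac:(lra)).
    assert (0 < sqrt 2) by (apply sqrt_lt_R0; lra).
    replace (1 / sqrt 2 * (1 / sqrt 2)) with (/ (sqrt 2 * sqrt 2)) by (field; lra). rewrite H. field.
  - assert (E : (2 ^ S n = 2 ^ n + 2 ^ n)%nat) by (simpl; lia).
    rewrite E, rsum_split, (rsum_rev (fun j => / (sin (odd_angle (S n) j))²)).
    replace (2 * 4 ^ S n) with (4 * (2 * 4 ^ n)) by (simpl; ring). rewrite <- IH, <- rsum_scal.
    rewrite <- (Nat.add_0_r (0 + 2 ^ n)), rsum_shift, <- (rsum_rev (fun j => / (sin (odd_angle (S n) j))²)).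
    rewrite (rsum_rev (fun i => / (sin (odd_angle (S n) (0 + 2 ^ n + i)))²)).
    rewrite <- rsum_plus. apply rsum_ext. intros j Hj.
    assert (P2 : 0 < 2 ^ n) by (apply pow_lt; lra).
    assert (HP := PI_RGT_0).
    assert (Hjn : 2 * INR j + 1 <= 2 * 2 ^ n).
    { assert (INR (j + 1) <= INR (2 ^ n)) by (apply le_INR; lia).
      rewrite plus_INR, INR_two_pow in H. simpl in H. lra. }
    rewrite (inv_sin2_halve (odd_angle n j)).
    + replace (odd_angle n j / 2) with (odd_angle (S n) j).
      * replace (odd_angle (S n) (0 + 2 ^ n + (2 ^ n - 1 - j))) with (PI / 2 - odd_angle (S n) j).
        { lra. }
        unfold odd_angle. replace (0 + 2 ^ n + (2 ^ n - 1 - j))%nat with (2 ^ n + 2 ^ n - (1 + j))%nat by lia.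
        rewrite minus_INR, !plus_INR, !INR_two_pow by lia. simpl INR. rewrite !pow_add. simpl. field. lra.
      * unfold odd_angle. simpl. rewrite pow_add. field. apply pow_nonzero. lra.
    + unfold odd_angle. rewrite pow_add. simpl. pose proof (pos_INR j). split.
      * apply Rdiv_lt_0_compat; [apply Rmult_lt_0_compat; lra|lra].
      * apply Rmult_lt_reg_r with (2 ^ n * (2 * (2 * 1))); [lra|].
        unfold Rdiv at 1. rewrite Rmult_assoc, Rinv_l by lra.
        assert ((2 * INR j + 1) * PI <= 2 * 2 ^ n * PI) by (apply Rmult_le_compat_r; lra).
        assert (0 < 2 ^ n * PI) by (apply Rmult_lt_0_compat; lra). lra.
Qed.

Lemma is_lim_seq_two_pow : filterlim (fun n => (2 ^ n)%nat) eventually eventually.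
Proof.
  intros P [N H]. exists N. intros n Hn. apply H.
  assert (n < 2 ^ n)%nat by (apply Nat.pow_gt_lin_r; lia). lia.
Qed.

(** Up to the factor PI^2 / (16 * 4^n) this is the sum of 1 / x^2 over the odd angles. It differs
    from the exact sum 2 * 4^n of 1 / sin^2 by at most 1 per term, hence by 2^n in all, which is
    negligible against 4^n. *)
Lemma sum_inv_odd_squares :
  is_lim_seq (fun n => rsum (fun j => / (2 * INR j + 1)²) 0 (2 ^ n)) (PI ^ 2 / 8).
Proof.
  assert (HP := PI_RGT_0).
  assert (B : forall n, PI ^ 2 / 8 - PI ^ 2 / 16 * (/ 2) ^ n <=
    rsum (fun j => / (2 * INR j + 1)²) 0 (2 ^ n) <= PI ^ 2 / 8).
  { intros n. assert (S := sum_inv_sin2 n).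
    assert (P2 : 0 < 2 ^ n) by (apply pow_lt; lra).
    assert (E4 : 4 ^ n = 2 ^ n * 2 ^ n) by (rewrite <- Rpow_mult_distr; f_equal; ring).
    assert (Eh : (/ 2) ^ n = / 2 ^ n) by (apply pow_inv).
    assert (E : rsum (fun j => / (2 * INR j + 1)²) 0 (2 ^ n) =
      PI ^ 2 / (16 * 4 ^ n) * rsum (fun j => / (odd_angle n j)²) 0 (2 ^ n)).
    { rewrite <- rsum_scal. apply rsum_ext. intros j _. unfold odd_angle.
      rewrite E4, pow_add. unfold Rsqr. assert (H := pos_INR j). field.
      repeat split; lra. }
    assert (Hang : forall j, (0 <= j < 0 + 2 ^ n)%nat -> 0 < odd_angle n j < PI / 2).
    { intros j Hj. unfold odd_angle. rewrite pow_add. simpl. assert (Hj' := pos_INR j).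
      assert (INR (j + 1) <= INR (2 ^ n)) by (apply le_INR; lia).
      rewrite plus_INR, INR_two_pow in H. simpl in H. split.
      - apply Rdiv_lt_0_compat; [apply Rmult_lt_0_compat; lra|lra].
      - apply Rmult_lt_reg_r with (2 ^ n * (2 * (2 * 1))); [lra|].
        unfold Rdiv at 1. rewrite Rmult_assoc, Rinv_l by lra.
        assert ((2 * INR j + 1) * PI < 2 * 2 ^ n * PI) by (apply Rmult_lt_compat_r; lra). lra. }
    assert (U : rsum (fun j => / (odd_angle n j)²) 0 (2 ^ n) <= 2 * 4 ^ n).
    { rewrite <- S. apply rsum_le. intros j Hj. apply inv_sin2_bounds. now apply Hang. }
    assert (L : 2 * 4 ^ n - 2 ^ n <= rsum (fun j => / (odd_angle n j)²) 0 (2 ^ n)).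
    { rewrite <- S. apply Rle_trans with
        (rsum (fun j => / (sin (odd_angle n j))² + - 1) 0 (2 ^ n)).
      - rewrite rsum_plus, rsum_const, INR_two_pow. lra.
      - apply rsum_le. intros j Hj. apply inv_sin2_bounds. now apply Hang. }
    rewrite E, Eh. rewrite E4 in *. set (t := 2 ^ n) in *.
    assert (Ht2 : 0 < t * t) by (now apply Rmult_lt_0_compat).
    assert (Hc : 0 < PI ^ 2 / (16 * (t * t))) by (apply Rdiv_lt_0_compat; [apply pow_lt|]; lra).
    split.
    - apply Rle_trans with (PI ^ 2 / (16 * (t * t)) * (2 * (t * t) - t)).
      + right. field. lra.
      + apply Rmult_le_compat_l; lra.
    - apply Rle_trans with (PI ^ 2 / (16 * (t * t)) * (2 * (t * t))).
      + apply Rmult_le_compat_l; lra.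
      + right. field. lra. }
  apply is_lim_seq_le_le with (u := fun n => PI ^ 2 / 8 - PI ^ 2 / 16 * (/ 2) ^ n) (w := fun _ => PI ^ 2 / 8).
  - exact B.
  - replace (Finite (PI ^ 2 / 8)) with (Finite (PI ^ 2 / 8 - PI ^ 2 / 16 * 0)) by (f_equal; ring).
    apply is_lim_seq_minus'; [apply is_lim_seq_const|].
    apply is_lim_seq_mult'; [apply is_lim_seq_const|].
    apply is_lim_seq_geom. rewrite Rabs_pos_eq; lra.
  - apply is_lim_seq_const.
Qed.

Definition zeta2_partial (n : nat) : R := rsum (fun m => / (INR m)²) 1 n.

Lemma zeta2_partial_even (N : nat) :
  zeta2_partial (2 * N) = rsum (fun j => / (2 * INR j + 1)²) 0 N + / 4 * zeta2_partial N.
Proof.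
  unfold zeta2_partial. induction N as [|N IH]; [simpl; ring|].
  replace (2 * S N)%nat with (S (S (2 * N))) by lia. cbn [rsum]. rewrite IH.
  replace (INR (1 + 2 * N)) with (2 * INR N + 1) by (rewrite plus_INR, mult_INR; simpl; ring).
  replace (1 + S (2 * N))%nat with (2 * (1 + N))%nat by lia.
  rewrite (mult_INR 2 (1 + N)). change (INR 2) with 2.
  assert (0 < INR (1 + N)) by (apply lt_0_INR; lia).
  replace (/ (2 * INR (1 + N))²) with (/ 4 * / (INR (1 + N))²) by (unfold Rsqr; field; lra).
  rewrite Nat.add_0_l. ring.
Qed.

(** Monotone and bounded partial sums give a limit z; separating odd and even indices gives z = PI^2
    / 8 + z / 4. *)
Lemma zeta2_lim : is_lim_seq zeta2_partial (PI ^ 2 / 6).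
Proof.
  assert (Hterm : forall m, 0 <= / (INR (S m))²).
  { intros m. left. apply Rinv_0_lt_compat, Rsqr_pos_lt. apply not_0_INR. lia. }
  assert (Hb : forall n, zeta2_partial (S n) <= 2 - / INR (S n)).
  { intros n. unfold zeta2_partial. induction n as [|n IH].
    - simpl. unfold Rsqr. lra.
    - cbn [rsum] in *. eapply Rle_trans; [apply Rplus_le_compat_r, IH|].
      change (1 + S n)%nat with (S (S n)). rewrite (S_INR (S n)).
      assert (0 < INR (S n)) by (apply lt_0_INR; lia). set (t := INR (S n)) in *.
      unfold Rsqr. assert (/ ((t + 1) * (t + 1)) <= / t - / (t + 1)); [|lra].
      replace (/ t - / (t + 1)) with (/ (t * (t + 1))) by (field; lra).
      apply Rinv_le_contravar; nra. }
  assert (Hex : ex_finite_lim_seq zeta2_partial).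
  { apply (ex_finite_lim_seq_incr _ 2).
    - intros n. unfold zeta2_partial. cbn [rsum]. specialize (Hterm n). change (1 + n)%nat with (S n). lra.
    - intros [|n]; [unfold zeta2_partial; simpl; lra|]. specialize (Hb n).
      assert (0 < / INR (S n)) by (apply Rinv_0_lt_compat, lt_0_INR; lia). lra. }
  destruct Hex as [z Hz].
  assert (H1 : is_lim_seq (fun n => zeta2_partial (2 ^ n)) z).
  { apply (filterlim_comp _ _ _ _ _ _ _ _ is_lim_seq_two_pow Hz). }
  assert (H2 : is_lim_seq (fun n => zeta2_partial (2 ^ S n)) z) by now apply is_lim_seq_incr_1 in H1.
  assert (H3 : is_lim_seq (fun n => zeta2_partial (2 ^ S n)) (PI ^ 2 / 8 + / 4 * z)).
  { apply is_lim_seq_ext with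
      (fun n => rsum (fun j => / (2 * INR j + 1)²) 0 (2 ^ n) + / 4 * zeta2_partial (2 ^ n)).
    - intros n. now rewrite <- zeta2_partial_even.
    - apply is_lim_seq_plus'; [exact sum_inv_odd_squares|].
      apply is_lim_seq_mult'; [apply is_lim_seq_const|exact H1]. }
  assert (E : Finite z = Finite (PI ^ 2 / 8 + / 4 * z)).
  { rewrite <- (is_lim_seq_unique _ _ H2). now apply is_lim_seq_unique. }
  injection E as E. replace (PI ^ 2 / 6) with z by lra. exact Hz.
Qed.

(** * Decay of the Bose kernel *)

Lemma CV_radius_ge_1 (a : nat -> R) (M : R) :
  (forall n, Rabs (a n) <= M) -> Rbar_le 1 (CV_radius a).
Proof.
  intros H. apply (CV_radius_bounded a). exists M. intros n.
  rewrite pow1, Rmult_1_r. apply H.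
Qed.

Lemma CV_radius_lt (a : nat -> R) (y : R) :
  Rbar_le 1 (CV_radius a) -> Rabs y < 1 -> Rbar_lt (Rabs y) (CV_radius a).
Proof. intros H Hy. apply Rbar_lt_le_trans with 1; [exact Hy|exact H]. Qed.

(* [y / (exp y - 1) = sum_n bern n * y ^ n] *)
Definition bern : nat -> R := PS_inv (fun n => / INR (fact (S n))).

Lemma bern_rec (n : nat) :
  rsum (fun i => / INR (fact (S i)) * bern (n - i)) 0 (S n) = PS_one n.
Proof.
  rewrite <- PS_mult_rsum. apply (PS_mult_inv (fun n => / INR (fact (S n)))).
  simpl. rewrite Rinv_1. lra.
Qed.

Lemma bern_0 : bern 0 = 1.
Proof. assert (H := bern_rec 0). unfold PS_one, PS_X in H. simpl in H. lra. Qed.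

Lemma bern_1 : bern 1 = - (1 / 2).
Proof. assert (H := bern_rec 1). unfold PS_one, PS_X in H. simpl in H. rewrite bern_0 in H. lra. Qed.

Lemma bern_2 : bern 2 = 1 / 12.
Proof.
  assert (H := bern_rec 2). unfold PS_one, PS_X in H. simpl in H.
  rewrite bern_0, bern_1 in H. lra.
Qed.

Lemma inv_fact_le (i : nat) : / INR (fact (S (S i))) <= (/ 2) ^ S i.
Proof.
  rewrite pow_inv. apply Rinv_le_contravar; [apply pow_lt; lra|].
  rewrite <- INR_two_pow. apply le_INR. induction i as [|i IH]; [simpl; lia|].
  rewrite (Nat.pow_succ_r _ (S i)) by lia.
  change (fact (S (S (S i)))) with (S (S (S i)) * fact (S (S i)))%nat. nia.
Qed.

(** In the recurrence the coefficients 1 / (i + 1)! are at most 2^(-i), and these sum to less than 1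
    over i >= 1. The bound yields a disc of radius 1 on which the kernel is given by a power
    series. *)
Lemma bern_abs (n : nat) : Rabs (bern n) <= 1.
Proof.
  induction n as [n IH] using (well_founded_induction lt_wf).
  destruct n as [|n]; [rewrite bern_0, Rabs_R1; lra|].
  assert (H := bern_rec (S n)). rewrite rsum_first in H.
  replace (PS_one (S n)) with 0 in H by reflexivity.
  replace (/ INR (fact 1)) with 1 in H by (simpl; lra). rewrite Nat.sub_0_r in H.
  replace (bern (S n)) with (- rsum (fun i => / INR (fact (S i)) * bern (S n - i)) 1 (S n)) by lra.
  rewrite Rabs_Ropp. eapply Rle_trans; [apply rsum_abs|].
  apply Rle_trans with (rsum (fun i => (/ 2) ^ i) 1 (S n)).
  - apply rsum_le. intros [|i] Hi; [lia|]. rewrite Rabs_mult.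
    rewrite Rabs_pos_eq by (left; apply Rinv_0_lt_compat, INR_fact_lt_0).
    rewrite <- (Rmult_1_r ((/ 2) ^ S i)). apply Rmult_le_compat.
    + left; apply Rinv_0_lt_compat, INR_fact_lt_0.
    + apply Rabs_pos.
    + apply inv_fact_le.
    + apply IH. lia.
  - assert (E : forall m, rsum (fun i => (/ 2) ^ i) 1 m = 1 - (/ 2) ^ m).
    { induction m as [|m IHm]; [simpl; lra|]. cbn [rsum]. rewrite IHm. simpl. lra. }
    rewrite E. assert (0 < (/ 2) ^ S n) by (apply pow_lt; lra). lra.
Qed.

Lemma bern_radius : Rbar_le 1 (CV_radius bern).
Proof. apply (CV_radius_ge_1 _ 1), bern_abs. Qed.

Lemma bern_series (y : R) : Rabs y < 1 -> y <> 0 -> / (exp y - 1) = / y + PSeries (PS_decr_1 bern) y.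
Proof.
  intros Hy Hy0.
  set (E := fun n => / INR (fact n)). set (a := fun n => / INR (fact (S n))).
  assert (HE : Rbar_le 1 (CV_radius E)).
  { apply (CV_radius_ge_1 _ 1). intros n. unfold E.
    rewrite Rabs_pos_eq by (left; apply Rinv_0_lt_compat, INR_fact_lt_0).
    rewrite <- Rinv_1. apply Rinv_le_contravar; [lra|]. apply (le_INR 1). apply lt_O_fact. }
  assert (Ha : Rbar_le 1 (CV_radius a)) by (rewrite <- (CV_radius_decr_1 E) in HE; exact HE).
  assert (X1 : exp y = 1 + y * PSeries a y).
  { rewrite <- (is_pseries_unique _ _ _ (is_exp_Reals y)).
    rewrite PSeries_decr_1 by (apply CV_radius_inside, CV_radius_lt; assumption).
    simpl. rewrite Rinv_1. reflexivity. }
  assert (X2 : PSeries a y * PSeries bern y = 1).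
  { rewrite <- PSeries_mult by (apply CV_radius_lt; auto using bern_radius).
    rewrite (PSeries_ext _ PS_one).
    - rewrite PSeries_decr_1.
      + rewrite (PSeries_ext _ (fun _ => 0)); [|reflexivity]. rewrite PSeries_const_0.
        unfold PS_one, PS_X. simpl. ring.
      + apply CV_radius_inside, CV_radius_lt; [|exact Hy].
        apply (CV_radius_ge_1 _ 1). intros n. unfold PS_one, PS_X.
        destruct (n =? 0)%nat; [rewrite Rabs_R1|rewrite Rabs_R0]; lra.
    - intros n. apply PS_mult_inv. unfold a. simpl. rewrite Rinv_1. lra. }
  assert (X3 : PSeries bern y = 1 + y * PSeries (PS_decr_1 bern) y).
  { rewrite PSeries_decr_1 at 1 by (apply CV_radius_inside, CV_radius_lt; auto using bern_radius).
    now rewrite bern_0. }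
  assert (Hne : PSeries a y <> 0) by (intros Z; rewrite Z in X2; lra).
  rewrite X1. replace (1 + y * PSeries a y - 1) with (y * PSeries a y) by ring.
  rewrite Rinv_mult.
  replace (/ PSeries a y) with (PSeries bern y) by (field_simplify_eq; [lra|exact Hne]).
  rewrite X3. field. exact Hy0.
Qed.

(** For y > 0 this is the sum of d e^(- d y) over d >= 1, the kernel to which a Lambert series
    reduces when one of its two indices is summed. *)
Definition planck (y : R) : R := exp y / (exp y - 1) ^ 2.

(** The double pole split off here sums to zeta(2) / u^2 over the positive multiples of u; - 1/12 is
    the limit at 0. *)
Definition kappa (y : R) : R := if Req_EM_T y 0 then - (1 / 12) else planck y - / y ^ 2.

(** An antiderivative of [- kappa] that tends to 0 at +infinity, so that the integral of [kappa]
    over the positive half-line is [beta 0]. *)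
Definition beta (y : R) : R := if Req_EM_T y 0 then - (1 / 2) else / (exp y - 1) - / y.

Lemma exp_minus_1_neq (y : R) : y <> 0 -> exp y - 1 <> 0.
Proof. intros Hy H. apply Hy. apply exp_inv. rewrite exp_0. lra. Qed.

Lemma beta_series (y : R) : Rabs y < 1 -> beta y = PSeries (PS_decr_1 bern) y.
Proof.
  intros Hy. unfold beta. destruct (Req_EM_T y 0) as [->|H].
  - rewrite PSeries_0. unfold PS_decr_1. now rewrite bern_1.
  - rewrite bern_series by assumption. ring.
Qed.

Lemma locally_lt_1 (y : R) : Rabs y < 1 -> locally y (fun t => Rabs t < 1).
Proof.
  intros Hy. exists (mkposreal (1 - Rabs y) ltac:(lra)). intros t Ht.
  unfold ball in Ht; simpl in Ht; unfold AbsRing_ball, abs, minus, plus, opp in Ht; simpl in Ht.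
  assert (A := Rabs_triang (t + - y) y). assert (E : @eq R (t + - y + y) t) by ring. rewrite E in A. lra.
Qed.

Lemma locally_neq_0 (y : R) : y <> 0 -> locally y (fun t => t <> 0).
Proof.
  intros Hy. exists (mkposreal (Rabs y) (Rabs_pos_lt y Hy)). intros t Ht ->.
  unfold ball in Ht; simpl in Ht; unfold AbsRing_ball, abs, minus, plus, opp in Ht; simpl in Ht.
  rewrite Rplus_0_l, Rabs_Ropp in Ht. lra.
Qed.

Lemma beta_derive_far (y : R) : y <> 0 -> is_derive beta y (- kappa y).
Proof.
  intros Hy. apply (is_derive_ext_loc (fun t => / (exp t - 1) - / t)).
  - apply (filter_imp (fun t => t <> 0)); [|now apply locally_neq_0].
    intros t Ht. unfold beta. destruct (Req_EM_T t 0); [contradiction|reflexivity].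
  - unfold kappa, planck. destruct (Req_EM_T y 0); [contradiction|].
    assert (E := exp_minus_1_neq y Hy). auto_derive; [tauto|]. field. tauto.
Qed.

Lemma kappa_series (y : R) : Rabs y < 1 ->
  kappa y = PSeries (PS_opp (PS_derive (PS_decr_1 bern))) y.
Proof.
  intros Hy. rewrite PSeries_opp. destruct (Req_EM_T y 0) as [->|Hn].
  - rewrite PSeries_0. unfold PS_derive, PS_decr_1. rewrite bern_2. unfold kappa.
    destruct (Req_EM_T 0 0); [|lra]. simpl. lra.
  - rewrite <- Derive_PSeries.
    2:{ apply CV_radius_lt; [rewrite CV_radius_decr_1; apply bern_radius|exact Hy]. }
    rewrite <- (Derive_ext_loc beta).
    + rewrite (is_derive_unique _ _ _ (beta_derive_far y Hn)). ring.
    + apply (filter_imp (fun t => Rabs t < 1)); [|now apply locally_lt_1].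
      apply beta_series.
Qed.

Lemma beta_derive (y : R) : is_derive beta y (- kappa y).
Proof.
  destruct (Req_EM_T y 0) as [->|H]; [|now apply beta_derive_far].
  assert (H0 : Rabs 0 < 1) by (rewrite Rabs_R0; lra).
  apply (is_derive_ext_loc (PSeries (PS_decr_1 bern))).
  - apply (filter_imp (fun t => Rabs t < 1)); [|now apply locally_lt_1].
    intros t Ht. now rewrite beta_series.
  - rewrite (kappa_series 0 H0), PSeries_opp, Ropp_involutive. apply is_derive_PSeries.
    apply CV_radius_lt; [rewrite CV_radius_decr_1; apply bern_radius|exact H0].
Qed.

Lemma kappa_even (y : R) : kappa (- y) = kappa y.
Proof.
  unfold kappa. destruct (Req_EM_T (- y) 0) as [E|E], (Req_EM_T y 0) as [E'|E']; try lra.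
  unfold planck. rewrite exp_Ropp. assert (A := exp_minus_1_neq y E'). assert (B := exp_pos y).
  field. repeat split; try lra.
Qed.

(** * Functions whose derivatives decay like 1 / (1 + y^2) *)

Definition wt (y : R) : R := / (1 + y ^ 2).

Lemma wt_pos (y : R) : 0 < wt y.
Proof. unfold wt. apply Rinv_0_lt_compat. nra. Qed.

Lemma wt_le_1 (y : R) : wt y <= 1.
Proof. unfold wt. rewrite <- Rinv_1. apply Rinv_le_contravar; nra. Qed.

(** The region [U] is a parameter because [kappa] is controlled by its power series near 0 and by
    its closed formula elsewhere; the estimates are glued by [Dec_union]. *)
Fixpoint Dec (U : R -> Prop) (p : nat) (f : R -> R) : Prop :=
  (exists C, forall y, U y -> Rabs (f y) <= C * wt y) /\
  match p with
  | O => True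
  | S p' => (forall y, U y -> ex_derive f y) /\ Dec U p' (Derive f)
  end.

Lemma Dec_union (U V : R -> Prop) (p : nat) (f : R -> R) :
  Dec U p f -> Dec V p f -> Dec (fun y => U y \/ V y) p f.
Proof.
  revert f. induction p as [|p IH]; intros f [[C HC] HU] [[D HD] HV].
  1,2: split; [exists (Rmax C D); intros y [Hy|Hy];
    (eapply Rle_trans; [eauto|]);
    (apply Rmult_le_compat_r; [left; apply wt_pos|]); [apply Rmax_l|apply Rmax_r]|].
  - exact I.
  - destruct HU, HV. split; [|now apply IH]. intros y [Hy|Hy]; auto.
Qed.

Lemma Dec_subset (U V : R -> Prop) (p : nat) (f : R -> R) :
  (forall y, V y -> U y) -> Dec U p f -> Dec V p f.
Proof.
  intros HS. revert f. induction p as [|p IH]; intros f [[C HC] H]; (split; [exists C; auto|]).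
  - exact I.
  - destruct H. split; auto.
Qed.

Lemma Dec_ext (U : R -> Prop) (p : nat) (f g : R -> R) : open U ->
  (forall y, U y -> f y = g y) -> Dec U p f -> Dec U p g.
Proof.
  intros HU. revert f g. induction p as [|p IH]; intros f g E [[C HC] H].
  - split; [|exact I]. exists C. intros y Hy. rewrite <- E; auto.
  - split; [exists C; intros y Hy; rewrite <- E; auto|]. destruct H as [H1 H2].
    assert (L : forall y, U y -> locally y (fun t => f t = g t)).
    { intros y Hy. apply (filter_imp U); [exact E|now apply HU]. }
    split.
    + intros y Hy. apply (ex_derive_ext_loc f); auto.
    + apply (IH (Derive f)); [|exact H2]. intros y Hy. apply Derive_ext_loc; auto.
Qed.

Lemma Dec_lower (U : R -> Prop) (p : nat) (f : R -> R) : Dec U (S p) f -> Dec U p f.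
Proof.
  revert f. induction p as [|p IH]; intros f [H0 [H1 H2]]; split; auto.
Qed.

Lemma Dec_derive (U : R -> Prop) (p : nat) (f f' : R -> R) : open U ->
  (exists C, forall y, U y -> Rabs (f y) <= C * wt y) ->
  (forall y, U y -> is_derive f y (f' y)) -> Dec U p f' -> Dec U (S p) f.
Proof.
  intros HU HC Hd H. split; [exact HC|]. split.
  - intros y Hy. exists (f' y). auto.
  - apply (Dec_ext U p f'); auto. intros y Hy. symmetry. apply is_derive_unique. auto.
Qed.

Lemma Dec_scal (U : R -> Prop) (p : nat) (c : R) (f : R -> R) : open U ->
  Dec U p f -> Dec U p (fun y => c * f y).
Proof.
  intros HU. revert f. induction p as [|p IH]; intros f [[C HC] H].
  1,2: assert (B : exists D, forall y, U y -> Rabs (c * f y) <= D * wt y) by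
    (exists (Rabs c * C); intros y Hy; rewrite Rabs_mult, Rmult_assoc;
     apply Rmult_le_compat_l; [apply Rabs_pos|auto]).
  - split; [exact B|exact I].
  - destruct H as [H1 H2]. apply (Dec_derive U p _ (fun y => c * Derive f y)); auto.
    intros y Hy. apply is_derive_Rscal, Derive_correct. auto.
Qed.

Lemma Dec_plus (U : R -> Prop) (p : nat) (f g : R -> R) : open U ->
  Dec U p f -> Dec U p g -> Dec U p (fun y => f y + g y).
Proof.
  intros HU. revert f g. induction p as [|p IH]; intros f g [[C HC] H] [[D HD] H'].
  1,2: assert (B : exists E, forall y, U y -> Rabs (f y + g y) <= E * wt y) by
    (exists (C + D); intros y Hy; specialize (HC y Hy); specialize (HD y Hy);
     eapply Rle_trans; [apply Rabs_triang|]; lra).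
  - split; [exact B|exact I].
  - destruct H as [H1 H2], H' as [H3 H4].
    apply (Dec_derive U p _ (fun y => Derive f y + Derive g y)); auto.
    intros y Hy. apply is_derive_Rplus; apply Derive_correct; auto.
Qed.

Lemma Dec_mult (U : R -> Prop) (p : nat) (f g : R -> R) : open U ->
  Dec U p f -> Dec U p g -> Dec U p (fun y => f y * g y).
Proof.
  intros HU. revert f g. induction p as [|p IH]; intros f g F G.
  1,2: assert (B : exists E, forall y, U y -> Rabs (f y * g y) <= E * wt y).
  1,3: destruct F as [[C HC] _], G as [[D HD] _]; exists (Rabs C * Rabs D); intros y Hy;
    specialize (HC y Hy); specialize (HD y Hy); rewrite Rabs_mult;
    assert (W := wt_pos y); assert (W1 := wt_le_1 y);
    assert (A1 := Rle_abs C); assert (A2 := Rle_abs D);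
    assert (P1 := Rabs_pos C); assert (P2 := Rabs_pos D);
    assert (Q1 := Rabs_pos (f y)); assert (Q2 := Rabs_pos (g y));
    apply Rle_trans with ((Rabs C * wt y) * Rabs D);
    [apply Rmult_le_compat; nra|right; ring].
  - split; [exact B|exact I].
  - assert (F' := Dec_lower _ _ _ F). assert (G' := Dec_lower _ _ _ G).
    destruct F as [_ [F1 F2]], G as [_ [G1 G2]].
    apply (Dec_derive U p _ (fun y => Derive f y * g y + f y * Derive g y)); auto.
    + intros y Hy. apply is_derive_Rmult; apply Derive_correct; auto.
    + apply Dec_plus; auto.
Qed.

Lemma Dec_reflect (U : R -> Prop) (p : nat) (f : R -> R) : open (fun y => U (- y)) ->
  Dec U p f -> Dec (fun y => U (- y)) p (fun y => f (- y)).
Proof.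
  intros HU. revert f. induction p as [|p IH]; intros f [[C HC] H].
  1,2: assert (B : exists D, forall y, U (- y) -> Rabs (f (- y)) <= D * wt y) by
    (exists C; intros y Hy; replace (wt y) with (wt (- y)) by (unfold wt; f_equal; ring); auto).
  - split; [exact B|exact I].
  - destruct H as [H1 H2].
    apply (Dec_derive _ p _ (fun y => -1 * Derive f (- y))); auto.
    + intros y Hy. apply (is_derive_comp f (fun t => - t)).
      * apply Derive_correct. auto.
      * auto_derive; [exact I|reflexivity].
    + apply Dec_scal; [exact HU|]. now apply (IH (Derive f)).
Qed.

Definition near (y : R) : Prop := Rabs y < 3 / 4.
Definition right_far (y : R) : Prop := 1 / 2 < y.

Lemma open_near : open near.
Proof.
  intros y Hy. unfold near in *. exists (mkposreal (3 / 4 - Rabs y) ltac:(lra)). intros t Ht.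
  unfold ball in Ht; simpl in Ht; unfold AbsRing_ball, abs, minus, plus, opp in Ht; simpl in Ht.
  assert (A := Rabs_triang (t + - y) y). assert (E : @eq R (t + - y + y) t) by ring. rewrite E in A. lra.
Qed.

Lemma open_right_far : open right_far.
Proof. apply open_gt. Qed.

Lemma open_left_far : open (fun y => right_far (- y)).
Proof.
  apply (open_ext (fun y => y < - (1 / 2))); [intros y; unfold right_far; lra|]. apply open_lt.
Qed.

Lemma Dec_PSeries (p : nat) (a : nat -> R) : Rbar_le 1 (CV_radius a) ->
  Dec near p (PSeries a).
Proof.
  revert a. induction p as [|p IH]; intros a Ha.
  1,2: assert (B : exists C, forall y, near y -> Rabs (PSeries a y) <= C * wt y).
  1,3: exists (2 * Series (fun n => Rabs (a n * (3 / 4) ^ n))); intros y Hy; unfold near in Hy;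
    assert (E1 : ex_series (fun n => Rabs (a n * (3 / 4) ^ n))) by
      (apply CV_disk_inside, CV_radius_lt; [exact Ha|rewrite Rabs_pos_eq; lra]);
    assert (E2 : ex_series (fun n => Rabs (a n * y ^ n))) by
      (apply CV_disk_inside, CV_radius_lt; [exact Ha|lra]);
    assert (L : Rabs (PSeries a y) <= Series (fun n => Rabs (a n * (3 / 4) ^ n))) by
      (eapply Rle_trans; [apply Series_Rabs; exact E2|]; apply Series_le; [|exact E1];
       intros n; split; [apply Rabs_pos|]; rewrite !Rabs_mult;
       apply Rmult_le_compat_l; [apply Rabs_pos|]; rewrite <- !RPow_abs; apply pow_incr;
       split; [apply Rabs_pos|rewrite (Rabs_pos_eq (3 / 4)); lra]);
    assert (W : 1 <= 2 * wt y) by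
      (unfold wt; apply Rmult_le_reg_r with (1 + y ^ 2); [nra|];
       rewrite Rmult_assoc, Rinv_l by nra; apply Rabs_lt_between in Hy; nra);
    assert (P := Rabs_pos (PSeries a y)); nra.
  - split; [exact B|exact I].
  - apply (Dec_derive near p _ (PSeries (PS_derive a))); [exact open_near|exact B| |].
    + intros y Hy. unfold near in Hy. apply is_derive_PSeries, CV_radius_lt; [exact Ha|lra].
    + apply IH. now rewrite CV_radius_derive.
Qed.

Lemma Dec_inv_pow (p j : nat) : Dec right_far p (fun y => / y ^ (j + 2)).
Proof.
  revert j. induction p as [|p IH]; intros j.
  1,2: assert (B : exists C, forall y, right_far y -> Rabs (/ y ^ (j + 2)) <= C * wt y).
  1,3: exists (5 * 2 ^ j); intros y Hy; unfold right_far in Hy;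
    assert (Hyj : 0 < y ^ j) by (apply pow_lt; lra);
    assert (H2j : 0 < 2 ^ j) by (apply pow_lt; lra);
    rewrite Rabs_pos_eq by (left; apply Rinv_0_lt_compat, pow_lt; lra);
    rewrite pow_add, Rinv_mult, (Rmult_comm 5), Rmult_assoc;
    apply Rmult_le_compat;
    [left; apply Rinv_0_lt_compat; exact Hyj|left; apply Rinv_0_lt_compat; nra|
     rewrite <- pow_inv; apply pow_incr; split;
       [left; apply Rinv_0_lt_compat; lra|rewrite <- (Rinv_inv 2); apply Rinv_le_contravar; lra]|
     unfold wt; apply Rmult_le_reg_r with (y ^ 2); [nra|]; rewrite Rinv_l by nra;
     apply Rmult_le_reg_r with (1 + y ^ 2); [nra|];
     replace (5 * / (1 + y ^ 2) * y ^ 2 * (1 + y ^ 2)) with (5 * y ^ 2) by (field; nra); nra].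
  - split; [exact B|exact I].
  - apply (Dec_derive _ p _ (fun y => - INR (j + 2) * / y ^ (S j + 2))); [exact open_right_far|exact B| |].
    + intros y Hy. unfold right_far in Hy. auto_derive; [apply pow_nonzero; lra|].
      replace (Init.Nat.pred (j + 2)) with (j + 1)%nat by lia. rewrite !pow_add. simpl. field.
      split; [lra|apply pow_nonzero; lra].
    + apply Dec_scal; [exact open_right_far|apply IH].
Qed.

(** The function g = 1 / (e^y - 1) satisfies g' = - (g + g^2), so all its derivatives are
    polynomials in g without constant term and inherit its decay. *)
Lemma Dec_bose (p : nat) : Dec right_far p (fun y => / (exp y - 1)).
Proof.
  induction p as [|p IH].
  1,2: assert (B : exists C, forall y, right_far y -> Rabs (/ (exp y - 1)) <= C * wt y).
  1,3: exists 2; intros y Hy; unfold right_far in Hy;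
    assert (E : 1 + y + y ^ 2 / 2 <= exp y) by
      (eapply Rle_trans; [|apply (exp_ge_taylor y 2); lra]; simpl; lra);
    rewrite Rabs_pos_eq by (left; apply Rinv_0_lt_compat; nra);
    unfold wt; rewrite <- (Rinv_inv 2), <- Rinv_mult; apply Rinv_le_contravar; nra.
  - split; [exact B|exact I].
  - apply (Dec_derive _ p _ (fun y => -1 * (/ (exp y - 1) + / (exp y - 1) * / (exp y - 1))));
      [exact open_right_far|exact B| |].
    + intros y Hy. unfold right_far in Hy. assert (E := exp_minus_1_neq y ltac:(lra)).
      auto_derive; [tauto|]. field. tauto.
    + apply Dec_scal; [exact open_right_far|]. apply Dec_plus; [exact open_right_far|exact IH|].
      apply Dec_mult; [exact open_right_far|exact IH|exact IH].
Qed.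

(** The line is covered by the overlapping open sets |y| < 3/4, y > 1/2 and y < - 1/2. On the second
    one [kappa] is g + g^2 - 1 / y^2 with g = 1 / (e^y - 1); the third follows by evenness. *)
Lemma Dec_kappa (p : nat) : Dec (fun _ => True) p kappa.
Proof.
  assert (N : Dec near p kappa).
  { apply (Dec_ext near p (PSeries (PS_opp (PS_derive (PS_decr_1 bern))))); [exact open_near| |].
    - intros y Hy. unfold near in Hy. symmetry. apply kappa_series. lra.
    - apply Dec_PSeries. rewrite CV_radius_opp, CV_radius_derive, CV_radius_decr_1. apply bern_radius. }
  assert (F : Dec right_far p kappa).
  { apply (Dec_ext _ p (fun y => (/ (exp y - 1) + / (exp y - 1) * / (exp y - 1)) + -1 * / y ^ (0 + 2)));
      [exact open_right_far| |].
    - intros y Hy. unfold right_far in Hy. unfold kappa, planck.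
      destruct (Req_EM_T y 0); [lra|]. assert (E := exp_minus_1_neq y ltac:(lra)).
      simpl. field. lra.
    - apply Dec_plus; [exact open_right_far| |apply Dec_scal; [exact open_right_far|apply Dec_inv_pow]].
      apply Dec_plus; [exact open_right_far|apply Dec_bose|].
      apply Dec_mult; [exact open_right_far|apply Dec_bose|apply Dec_bose]. }
  assert (L : Dec (fun y => right_far (- y)) p kappa).
  { apply (Dec_ext _ p (fun y => kappa (- y))); [exact open_left_far| |].
    - intros y _. apply kappa_even.
    - apply Dec_reflect; [exact open_left_far|exact F]. }
  apply (Dec_subset (fun y => (near y \/ right_far y) \/ right_far (- y))).
  - intros y _. unfold near, right_far. destruct (Rle_or_lt y (- (1 / 2))) as [H|H].
    + destruct (Req_dec y (- (1 / 2))) as [->|]; [left; left|right; lra].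
      rewrite Rabs_left; lra.
    + left. destruct (Rle_or_lt y (1 / 2)); [left|right; lra]. apply Rabs_lt_between. lra.
  - apply Dec_union; [|exact L]. now apply Dec_union.
Qed.

(** * Trapezoidal sums *)

Definition fdiff (h : R) (f : R -> R) : R -> R := fun y => f y - f (y + h).

Lemma wt_shift (y z h : R) : 0 <= h <= 1 -> y <= z <= y + h -> wt z <= 3 * wt y.
Proof.
  intros Hh Hz. unfold wt. rewrite <- (Rinv_inv 3), <- Rinv_mult.
  assert ((z - y) * (z - y) <= 1) by nra. assert (P := pow2_ge_0 (2 * z - y)).
  apply Rinv_le_contravar; nra.
Qed.

Lemma fdiff_iter_derive (h : R) (p : nat) (f : R -> R) :
  (forall y, ex_derive f y) ->
  forall y, is_derive (Nat.iter p (fdiff h) f) y (Nat.iter p (fdiff h) (Derive f) y).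
Proof.
  intros Hf. induction p as [|p IH]; intros y.
  - simpl. now apply Derive_correct.
  - simpl. apply is_derive_Rminus; [apply IH|].
    replace (Nat.iter p (fdiff h) (Derive f) (y + h)) with
      (scal 1 (Nat.iter p (fdiff h) (Derive f) (y + h))) by apply Rmult_1_l.
    apply (is_derive_comp (Nat.iter p (fdiff h) f) (fun t => t + h)); [apply IH|].
    auto_derive; [exact I|ring].
Qed.

(** Differencing commutes with differentiation, so the mean value theorem trades one difference for
    a factor h and a derivative. The intermediate point changes the weight by a factor at most 3. *)
Lemma fdiff_bound (p : nat) (f : R -> R) : Dec (fun _ => True) p f ->
  exists C, 0 <= C /\ forall h, 0 < h <= 1 -> forall y,
    Rabs (Nat.iter p (fdiff h) f y) <= C * h ^ p * wt y.
Proof.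
  revert f. induction p as [|p IH]; intros f H.
  - destruct H as [[C HC] _]. exists (Rabs C). split; [apply Rabs_pos|]. intros h Hh y. simpl.
    rewrite Rmult_1_r. eapply Rle_trans; [now apply HC|].
    apply Rmult_le_compat_r; [left; apply wt_pos|apply Rle_abs].
  - destruct H as [_ [H1 H2]]. destruct (IH _ H2) as [C [HC0 HC]].
    exists (3 * C). split; [lra|]. intros h Hh y. simpl. unfold fdiff at 1.
    destruct (ex_MVT _ _ y (y + h) ltac:(lra)
      (fun x _ => fdiff_iter_derive h p f (fun z => H1 z I) x)) as [c [Hc E]].
    rewrite Rabs_minus_sym, E. replace (y + h - y) with h by ring.
    rewrite Rabs_mult, (Rabs_pos_eq h) by lra.
    assert (W := wt_shift y c h ltac:(lra) Hc). specialize (HC h Hh c).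
    assert (Hp : 0 <= C * h ^ p) by (apply Rmult_le_pos; [exact HC0|apply pow_le; lra]).
    apply Rle_trans with ((C * h ^ p * (3 * wt y)) * h); [|right; ring].
    apply Rmult_le_compat_r; [lra|]. eapply Rle_trans; [exact HC|].
    now apply Rmult_le_compat_l.
Qed.

Definition alt_sum (N : nat) (h : R) (f : R -> R) : R :=
  rsum (fun j => (-1) ^ j * f ((INR j - INR N) * h)) 0 (2 * N + 1).

Lemma rsum_alternating (g : nat -> R) (n : nat) :
  rsum (fun j => (-1) ^ j * (g j - g (S j))) 0 n =
  2 * rsum (fun j => (-1) ^ j * g j) 0 n - g 0%nat + (-1) ^ n * g n.
Proof. induction n as [|n IH]; [simpl; ring|]. cbn [rsum]. rewrite IH, Nat.add_0_l. simpl. ring. Qed.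

(** Summation by parts: f is replaced by its difference in an alternating sum at the cost of
    boundary terms, which disappear as N grows. Each repetition gains a factor h. *)
Lemma alt_sum_fdiff (N : nat) (h : R) (f : R -> R) :
  alt_sum N h f =
  / 2 * (alt_sum N h (fdiff h f) + f (- (INR N * h)) + f ((INR N + 1) * h)).
Proof.
  unfold alt_sum. set (g := fun j => f ((INR j - INR N) * h)).
  assert (E := rsum_alternating g (2 * N + 1)).
  rewrite (rsum_ext (fun j => (-1) ^ j * fdiff h f ((INR j - INR N) * h))
    (fun j => (-1) ^ j * (g j - g (S j)))).
  - rewrite E. replace ((-1) ^ (2 * N + 1)) with (-1) by (rewrite pow_add, pow_1_even; ring).
    unfold g at 2 3. replace ((INR 0 - INR N) * h) with (- (INR N * h)) by (simpl; ring).
    replace (INR (2 * N + 1) - INR N) with (INR N + 1)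
      by (rewrite plus_INR, mult_INR; simpl; ring).
    unfold g. field.
  - intros j _. unfold g, fdiff. rewrite S_INR. f_equal. f_equal. f_equal. ring.
Qed.

(** On each cell the weight is smallest at the right end, so the sum is below the integral of 1 / (1
    + t^2), an arctangent. *)
Lemma sum_wt (N : nat) (h : R) : 0 < h -> rsum (fun m => h * wt (INR m * h)) 1 N <= 2.
Proof.
  intros Hh. apply Rle_trans with (atan (INR N * h)).
  - induction N as [|N IH]; [simpl; rewrite Rmult_0_l, atan_0; lra|].
    cbn [rsum]. change (1 + N)%nat with (S N). rewrite S_INR.
    destruct (MVT_cor2 atan (fun t => / (1 + t ^ 2)) (INR N * h) ((INR N + 1) * h)) as [c [E Hc]];
      [lra| |].
    + intros c _. apply derivable_pt_lim_atan.
    + assert (W : wt ((INR N + 1) * h) <= / (1 + c ^ 2)).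
      { unfold wt. assert (P := Rmult_le_pos _ _ (pos_INR N) (Rlt_le _ _ Hh)).
        apply Rinv_le_contravar; [assert (Q := pow2_ge_0 c); lra|].
        apply Rplus_le_compat_l, pow_incr. lra. }
      replace ((INR N + 1) * h - INR N * h) with h in E by ring.
      assert (h * wt ((INR N + 1) * h) <= h * / (1 + c ^ 2)) by (apply Rmult_le_compat_l; lra). lra.
  - assert (B := atan_bound (INR N * h)). assert (P := PI_4). lra.
Qed.

Lemma sum_wt_two_sided (N : nat) (h : R) : 0 < h <= 1 ->
  rsum (fun j => h * wt ((INR j - INR N) * h)) 0 (2 * N + 1) <= 5.
Proof.
  intros Hh. replace (2 * N + 1)%nat with (N + (1 + N))%nat by lia.
  rewrite !rsum_split, (rsum_rev _ N). cbn [rsum].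
  assert (S := sum_wt N h ltac:(lra)).
  rewrite (rsum_ext (fun i => h * wt ((INR (N - 1 - i) - INR N) * h))
    (fun i => h * wt (INR (1 + i) * h))).
  - rewrite <- (rsum_shift (fun m => h * wt (INR m * h)) 0 1).
    replace (0 + N + 1)%nat with (N + 1)%nat by lia.
    rewrite (rsum_shift _ 1 N).
    rewrite (rsum_ext (fun i => h * wt ((INR (N + i) - INR N) * h)) (fun m => h * wt (INR m * h))).
    + change (1 + 0)%nat with 1%nat. assert (W := wt_le_1 ((INR (0 + N + 0) - INR N) * h)).
      assert (W0 := wt_pos ((INR (0 + N + 0) - INR N) * h)). nra.
    + intros i _. rewrite plus_INR. f_equal. f_equal. ring.
  - intros i Hi. rewrite !minus_INR by lia. rewrite plus_INR. simpl INR.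
    replace ((INR N - 1 - INR i - INR N) * h) with (- ((1 + INR i) * h)) by ring.
    unfold wt. f_equal. f_equal. ring.
Qed.

Lemma alt_sum_bound (p : nat) (f : R -> R) : (forall p, Dec (fun _ => True) p f) ->
  exists C D, forall h N, 0 < h <= 1 -> Rabs (alt_sum N h f) <= C * h ^ p + D * wt (INR N * h).
Proof.
  intros Hf.
  assert (Step : forall p, exists D, 0 <= D /\ forall h N, 0 < h <= 1 ->
    Rabs (alt_sum N h f) <= Rabs (alt_sum N h (Nat.iter p (fdiff h) f)) + D * wt (INR N * h)).
  { clear p. induction p as [|p [D [HD0 IH]]].
    - exists 0. split; [lra|]. intros h N Hh. simpl. lra.
    - destruct (fdiff_bound p f (Hf p)) as [C [HC0 HC]]. exists (D + C). split; [lra|].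
      intros h N Hh. specialize (IH h N Hh). simpl.
      set (g := Nat.iter p (fdiff h) f) in *.
      rewrite (alt_sum_fdiff N h g) in IH.
      assert (B1 := HC h Hh (- (INR N * h))). assert (B2 := HC h Hh ((INR N + 1) * h)).
      fold g in B1, B2.
      assert (W1 : wt (- (INR N * h)) = wt (INR N * h)) by (unfold wt; f_equal; ring).
      assert (W2 : wt ((INR N + 1) * h) <= wt (INR N * h)).
      { unfold wt. assert (P := Rmult_le_pos _ _ (pos_INR N) (Rlt_le _ _ (proj1 Hh))).
        apply Rinv_le_contravar; [assert (Q := pow2_ge_0 (INR N * h)); lra|].
        apply Rplus_le_compat_l, pow_incr. lra. }
      rewrite W1 in B1. assert (Hp : h ^ p <= 1) by (rewrite <- (pow1 p); apply pow_incr; lra).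
      assert (Hp0 : 0 <= h ^ p) by (apply pow_le; lra).
      assert (W := wt_pos (INR N * h)). assert (W' := wt_pos ((INR N + 1) * h)).
      assert (Cp : 0 <= C * h ^ p <= C) by nra.
      assert (T := Rabs_triang (alt_sum N h (fdiff h g) + g (- (INR N * h))) (g ((INR N + 1) * h))).
      assert (T' := Rabs_triang (alt_sum N h (fdiff h g)) (g (- (INR N * h)))).
      rewrite Rabs_mult, (Rabs_pos_eq (/ 2)) in IH by lra.
      assert (A := Rabs_pos (alt_sum N h (fdiff h g))).
      assert (C * h ^ p * wt ((INR N + 1) * h) <= C * wt (INR N * h)) by (apply Rmult_le_compat; lra).
      assert (C * h ^ p * wt (INR N * h) <= C * wt (INR N * h)) by (apply Rmult_le_compat_r; lra).
      lra. }
  (* One difference more than the exponent asked for, because summing the weights over the lattice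
     costs a factor 1 / h. *)
  destruct (Step (S p)) as [D [HD0 HD]]. destruct (fdiff_bound (S p) f (Hf (S p))) as [C [HC0 HC]].
  exists (5 * C), D. intros h N Hh. eapply Rle_trans; [now apply HD|].
  apply Rplus_le_compat_r. unfold alt_sum. eapply Rle_trans; [apply rsum_abs|].
  apply Rle_trans with (rsum (fun j => C * h ^ p * (h * wt ((INR j - INR N) * h))) 0 (2 * N + 1)).
  - apply rsum_le. intros j _. rewrite Rabs_mult, pow_1_abs, Rmult_1_l.
    eapply Rle_trans; [now apply HC|]. simpl. right; ring.
  - rewrite rsum_scal. assert (S := sum_wt_two_sided N h Hh).
    assert (0 <= C * h ^ p) by (apply Rmult_le_pos; [lra|apply pow_le; lra]). nra.
Qed.

(** It makes an alternating sum over the multiples of h a combination of plain sums over the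
    multiples of 2h and of h, hence a comparison of two trapezoidal rules. *)
Lemma rsum_alt_split (g : nat -> R) (N : nat) :
  rsum (fun m => (-1) ^ m * g m) 1 (2 * N) =
  2 * rsum (fun m => g (2 * m)%nat) 1 N - rsum g 1 (2 * N).
Proof.
  induction N as [|N IH]; [simpl; ring|].
  replace (2 * S N)%nat with (S (S (2 * N))) by lia. cbn [rsum]. rewrite IH.
  replace ((-1) ^ (1 + 2 * N)) with (-1) by (rewrite pow_add, pow_1_even; ring).
  replace (1 + S (2 * N))%nat with (2 * (1 + N))%nat by lia. rewrite pow_1_even. ring.
Qed.

Lemma alt_sum_even (N : nat) (h : R) (f : R -> R) : (forall y, f (- y) = f y) ->
  alt_sum (2 * N) h f = f 0 + 2 * rsum (fun m => (-1) ^ m * f (INR m * h)) 1 (2 * N).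
Proof.
  intros Hf. unfold alt_sum. set (M := (2 * N)%nat).
  replace (2 * M + 1)%nat with (M + (1 + M))%nat by lia.
  rewrite !rsum_split, (rsum_rev _ M). cbn [rsum].
  rewrite (rsum_ext (fun i => (-1) ^ (M - 1 - i) * f ((INR (M - 1 - i) - INR M) * h))
    (fun i => (-1) ^ (1 + i) * f (INR (1 + i) * h))).
  - rewrite <- (rsum_shift (fun m => (-1) ^ m * f (INR m * h)) 0 1).
    replace (0 + M + 1)%nat with (M + 1)%nat by lia. rewrite (rsum_shift _ 1 M).
    rewrite (rsum_ext (fun i => (-1) ^ (M + i) * f ((INR (M + i) - INR M) * h))
      (fun m => (-1) ^ m * f (INR m * h))).
    + replace (0 + M + 0)%nat with M by lia. change (1 + 0)%nat with 1%nat.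
      replace ((INR M - INR M) * h) with 0 by ring. unfold M at 2. rewrite pow_1_even. ring.
    + intros i _. rewrite pow_add, plus_INR. unfold M at 1. rewrite pow_1_even.
      replace (INR M + INR i - INR M) with (INR i) by ring. ring.
  - intros i Hi. f_equal.
    + assert (E : (-1) ^ (M - 1 - i) * (-1) ^ (1 + i) = 1).
      { rewrite <- pow_add. replace (M - 1 - i + (1 + i))%nat with (2 * N)%nat by lia. apply pow_1_even. }
      assert (E2 : (-1) ^ (1 + i) * (-1) ^ (1 + i) = 1).
      { rewrite <- pow_add. replace (1 + i + (1 + i))%nat with (2 * (1 + i))%nat by lia. apply pow_1_even. }
      assert ((-1) ^ (1 + i) <> 0) by (apply pow_nonzero; lra). nra.
    + rewrite <- Hf. f_equal. rewrite !minus_INR, plus_INR by lia. simpl INR. ring.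
Qed.

Lemma rsum_cv_pos (f : nat -> R) (M : R) : (forall m, 0 <= f m) ->
  (forall N, rsum f 1 N <= M) -> ex_finite_lim_seq (rsum f 1).
Proof.
  intros Hf HM. apply (ex_finite_lim_seq_incr _ M); [|exact HM].
  intros n. cbn [rsum]. specialize (Hf (1 + n)%nat). lra.
Qed.

Lemma rsum_cv_abs (f : nat -> R) (M : R) :
  (forall N, rsum (fun m => Rabs (f m)) 1 N <= M) -> ex_finite_lim_seq (rsum f 1).
Proof.
  intros HM.
  destruct (rsum_cv_pos (fun m => Rabs (f m)) M) as [l1 H1]; [intros; apply Rabs_pos|exact HM|].
  destruct (rsum_cv_pos (fun m => f m + Rabs (f m)) (2 * M)) as [l2 H2].
  - intros m. assert (A := Rle_abs (- f m)). rewrite Rabs_Ropp in A. lra.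
  - intros N. apply Rle_trans with (rsum (fun m => 2 * Rabs (f m)) 1 N).
    + apply rsum_le. intros i _. assert (A := Rle_abs (f i)). lra.
    + rewrite rsum_scal. specialize (HM N). lra.
  - exists (l2 - l1). apply is_lim_seq_ext with
      (fun N => rsum (fun m => f m + Rabs (f m)) 1 N - rsum (fun m => Rabs (f m)) 1 N).
    + intros N. rewrite rsum_plus. ring.
    + now apply is_lim_seq_minus'.
Qed.

Lemma filterlim_double : filterlim (fun n => (2 * n)%nat) eventually eventually.
Proof. intros P [N H]. exists N. intros n Hn. apply H. lia. Qed.

Lemma is_lim_seq_double (u : nat -> R) (l : Rbar) :
  is_lim_seq u l -> is_lim_seq (fun n => u (2 * n)%nat) l.
Proof. intros H. exact (filterlim_comp _ _ _ _ _ _ _ _ filterlim_double H). Qed.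

Lemma wt_lim (h : R) : 0 < h -> is_lim_seq (fun N => wt (INR N * h)) 0.
Proof.
  intros Hh. apply is_lim_seq_le_le_loc with (u := fun _ => 0) (w := fun N => / h * / INR N).
  - exists 1%nat. intros N HN. split; [left; apply wt_pos|]. unfold wt.
    assert (P : 0 < INR N) by (apply lt_0_INR; lia).
    assert (Q : 0 < INR N * h) by nra. set (t := INR N * h) in *.
    replace (/ h * / INR N) with (/ t) by (unfold t; field; lra).
    apply Rinv_le_contravar; nra.
  - apply is_lim_seq_const.
  - replace (Finite 0) with (Rbar_mult (/ h) 0) by (simpl; f_equal; ring).
    apply is_lim_seq_scal_l. apply (is_lim_seq_inv INR p_infty); [apply is_lim_seq_INR|discriminate].
Qed.

Definition kappa_partial (h : R) (N : nat) : R := rsum (fun m => kappa (INR m * h)) 1 N.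

Definition kappa_sum (h : R) : R := real (Lim_seq (kappa_partial h)).

Lemma kappa_sum_lim (h : R) : 0 < h -> is_lim_seq (kappa_partial h) (kappa_sum h).
Proof.
  intros Hh. destruct (Dec_kappa 0) as [[C HC] _].
  destruct (rsum_cv_abs (fun m => kappa (INR m * h)) (/ h * (Rabs C * 2))) as [l Hl].
  - intros N. apply Rle_trans with (rsum (fun m => / h * (Rabs C * (h * wt (INR m * h)))) 1 N).
    + apply rsum_le. intros m _. eapply Rle_trans; [now apply HC|].
      replace (/ h * (Rabs C * (h * wt (INR m * h)))) with (Rabs C * wt (INR m * h)) by (field; lra).
      apply Rmult_le_compat_r; [left; apply wt_pos|apply Rle_abs].
    + rewrite (rsum_scal (/ h)), (rsum_scal (Rabs C)). apply Rmult_le_compat_l; [left; now apply Rinv_0_lt_compat|].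
      apply Rmult_le_compat_l; [apply Rabs_pos|now apply sum_wt].
  - unfold kappa_sum. change (rsum (fun m => kappa (INR m * h)) 1) with (kappa_partial h) in Hl.
    rewrite (is_lim_seq_unique _ _ Hl). exact Hl.
Qed.

(* [h] times the sum of [kappa] over the lattice [h Z] *)
Definition lattice_sum (h : R) : R := h * (kappa 0 + 2 * kappa_sum h).

(* The difference is an alternating sum over [h Z], which repeated differencing of
   [kappa] makes as small as desired. *)
Lemma lattice_sum_double (p : nat) :
  exists C, 0 <= C /\ forall h, 0 < h <= 1 -> Rabs (lattice_sum (2 * h) - lattice_sum h) <= C * h ^ p.
Proof.
  destruct (alt_sum_bound p kappa Dec_kappa) as [C [D H]].
  exists (Rabs C). split; [apply Rabs_pos|]. intros h Hh.
  assert (L : Rabs (kappa 0 + 2 * (2 * kappa_sum (2 * h) - kappa_sum h)) <= C * h ^ p + D * 0).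
  { apply (is_lim_seq_le (fun N => Rabs (alt_sum (2 * N) h kappa)) (fun N => C * h ^ p + D * wt (INR (2 * N) * h))
      (Rabs (kappa 0 + 2 * (2 * kappa_sum (2 * h) - kappa_sum h))) (C * h ^ p + D * 0)).
    - intros N. now apply H.
    - apply (is_lim_seq_abs _ (Finite (kappa 0 + 2 * (2 * kappa_sum (2 * h) - kappa_sum h)))).
      apply is_lim_seq_ext with
        (fun N => kappa 0 + 2 * (2 * kappa_partial (2 * h) N - kappa_partial h (2 * N))).
      + intros N. rewrite (alt_sum_even N h kappa kappa_even), rsum_alt_split.
        unfold kappa_partial. do 4 f_equal. apply rsum_ext. intros i _.
        rewrite mult_INR. simpl INR. f_equal. ring.
      + apply is_lim_seq_plus'; [apply is_lim_seq_const|].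
        apply is_lim_seq_mult'; [apply is_lim_seq_const|]. apply is_lim_seq_minus'.
        * apply is_lim_seq_mult'; [apply is_lim_seq_const|]. apply kappa_sum_lim. lra.
        * apply (is_lim_seq_double (kappa_partial h)). apply kappa_sum_lim. lra.
    - apply is_lim_seq_plus'; [apply is_lim_seq_const|].
      apply is_lim_seq_mult'; [apply is_lim_seq_const|].
      apply (is_lim_seq_double (fun N => wt (INR N * h))). apply wt_lim. lra. }
  unfold lattice_sum.
  replace (2 * h * (kappa 0 + 2 * kappa_sum (2 * h)) - h * (kappa 0 + 2 * kappa_sum h)) with
    (h * (kappa 0 + 2 * (2 * kappa_sum (2 * h) - kappa_sum h))) by ring.
  rewrite Rabs_mult, (Rabs_pos_eq h) by lra.
  assert (P : 0 <= h ^ p) by (apply pow_le; lra). assert (A := Rle_abs C).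
  assert (B := Rabs_pos (kappa 0 + 2 * (2 * kappa_sum (2 * h) - kappa_sum h))).
  assert (C * h ^ p <= Rabs C * h ^ p) by (apply Rmult_le_compat_r; assumption). nra.
Qed.

Lemma beta_lim (h : R) : 0 < h -> is_lim_seq (fun N => beta (INR N * h)) 0.
Proof.
  intros Hh. apply is_lim_seq_abs_0.
  apply is_lim_seq_le_le_loc with (u := fun _ => 0) (w := fun N => / h * / INR N).
  - exists 1%nat. intros N HN. split; [apply Rabs_pos|].
    assert (P : 0 < INR N) by (apply lt_0_INR; lia).
    assert (Q : 0 < INR N * h) by nra. set (t := INR N * h) in *.
    replace (/ h * / INR N) with (/ t) by (unfold t; field; lra).
    unfold beta. destruct (Req_EM_T t 0); [lra|].
    assert (E := exp_ineq1_le t).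
    assert (0 < / (exp t - 1)) by (apply Rinv_0_lt_compat; lra).
    assert (/ (exp t - 1) <= / t) by (apply Rinv_le_contravar; lra).
    apply Rabs_le. lra.
  - apply is_lim_seq_const.
  - replace (Finite 0) with (Rbar_mult (/ h) 0) by (simpl; f_equal; ring).
    apply is_lim_seq_scal_l. apply (is_lim_seq_inv INR p_infty); [apply is_lim_seq_INR|discriminate].
Qed.

(** A first order Riemann sum for the integral of [kappa] over the positive half-line, which is
    [beta 0] = - 1/2. It identifies the limit of [lattice_sum], which comparing meshes h and 2h
    cannot detect. *)
Lemma kappa_riemann :
  exists C, 0 <= C /\ forall h, 0 < h <= 1 -> Rabs (h * kappa_sum h + 1 / 2) <= C * h.
Proof.
  destruct (Dec_kappa 1) as [_ [Hd [[C HC] _]]]. exists (Rabs C * 9). split.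
  { assert (A := Rabs_pos C). lra. }
  intros h Hh.
  assert (Hb0 : beta 0 = - (1 / 2)) by (unfold beta; destruct (Req_EM_T 0 0); lra).
  assert (S : forall N, Rabs (h * kappa_partial h N + beta (INR N * h) - beta 0) <=
     Rabs C * 3 * h * rsum (fun m => h * wt (INR m * h)) 0 N).
  { induction N as [|N IH].
    - unfold kappa_partial. simpl. rewrite Rmult_0_l, Rmult_0_r.
      replace (0 + beta 0 - beta 0) with 0 by ring. rewrite Rabs_R0. lra.
    - unfold kappa_partial in *. cbn [rsum]. rewrite Nat.add_0_l. change (1 + N)%nat with (S N).
      rewrite S_INR.
      destruct (ex_MVT beta (fun y => - kappa y) (INR N * h) ((INR N + 1) * h)) as [c [Hc E]];
        [nra|intros; apply beta_derive|].
      destruct (ex_MVT kappa (Derive kappa) c ((INR N + 1) * h)) as [d [Hd' E2]];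
        [lra|intros; now apply Derive_correct, Hd|].
      assert (W := wt_shift (INR N * h) d h ltac:(lra) ltac:(lra)).
      specialize (HC d I).
      assert (X : h * (rsum (fun m => kappa (INR m * h)) 1 N + kappa ((INR N + 1) * h)) + beta ((INR N + 1) * h) - beta 0 =
        (h * rsum (fun m => kappa (INR m * h)) 1 N + beta (INR N * h) - beta 0) +
        h * (Derive kappa d * ((INR N + 1) * h - c))).
      { rewrite <- E2. replace (beta ((INR N + 1) * h)) with (beta (INR N * h) + - kappa c * h); [ring|].
        replace h with ((INR N + 1) * h - INR N * h) at 2 by ring. lra. }
      rewrite X. eapply Rle_trans; [apply Rabs_triang|]. rewrite Rmult_plus_distr_l.
      apply Rplus_le_compat; [exact IH|].
      rewrite !Rabs_mult, (Rabs_pos_eq h), (Rabs_pos_eq ((INR N + 1) * h - c)) by lra.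
      assert (Y : Rabs (Derive kappa d) <= Rabs C * (3 * wt (INR N * h))).
      { eapply Rle_trans; [exact HC|]. assert (A := Rle_abs C). assert (W0 := wt_pos d).
        assert (A0 := Rabs_pos C). nra. }
      assert (Y0 := Rabs_pos (Derive kappa d)).
      assert (Z : Rabs (Derive kappa d) * ((INR N + 1) * h - c) <= Rabs C * (3 * wt (INR N * h)) * h)
        by (apply Rmult_le_compat; lra).
      apply Rle_trans with (h * (Rabs C * (3 * wt (INR N * h)) * h)).
      + apply Rmult_le_compat_l; [lra|exact Z].
      + right; ring. }
  assert (L : Rabs (h * kappa_sum h + 0 - beta 0) <= Rabs C * 9 * h).
  { apply (is_lim_seq_le (fun N => Rabs (h * kappa_partial h N + beta (INR N * h) - beta 0))
      (fun _ => Rabs C * 9 * h) (Rabs (h * kappa_sum h + 0 - beta 0)) (Rabs C * 9 * h)).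
    - intros N. eapply Rle_trans; [apply S|].
      assert (B : rsum (fun m => h * wt (INR m * h)) 0 N <= 3).
      { destruct N as [|N]; [simpl; lra|]. rewrite rsum_first.
        assert (W := sum_wt N h ltac:(lra)). assert (W1 := wt_le_1 (INR 0 * h)).
        assert (W0 := wt_pos (INR 0 * h)). nra. }
      assert (A0 := Rabs_pos C). assert (0 <= Rabs C * 3 * h) by (apply Rmult_le_pos; lra). nra.
    - apply (is_lim_seq_abs _ (Finite (h * kappa_sum h + 0 - beta 0))).
      apply is_lim_seq_minus'; [|apply is_lim_seq_const].
      apply is_lim_seq_plus'; [|apply beta_lim; lra].
      apply is_lim_seq_mult'; [apply is_lim_seq_const|]. apply kappa_sum_lim; lra.
    - apply is_lim_seq_const. }
  rewrite Hb0 in L. replace (h * kappa_sum h + 1 / 2) with (h * kappa_sum h + 0 - - (1 / 2)) by lra.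
  exact L.
Qed.

(** The differences between the meshes h, h/2, h/4, ... form a convergent geometric sum of size
    h^(p+1), and by [kappa_riemann] the sums tend to - 1 as the mesh shrinks. *)
Lemma lattice_sum_asymptotic (p : nat) :
  exists C, 0 <= C /\ forall h, 0 < h <= 1 -> Rabs (lattice_sum h + 1) <= C * h ^ S p.
Proof.
  destruct (lattice_sum_double (S p)) as [C [HC0 HC]]. destruct kappa_riemann as [D [HD0 HD]].
  exists (2 * C). split; [lra|]. intros h Hh.
  assert (T : forall h, 0 < h <= 1 -> Rabs (lattice_sum h + 1) <= (Rabs (kappa 0) + 2 * D) * h).
  { intros t Ht. unfold lattice_sum.
    replace (t * (kappa 0 + 2 * kappa_sum t) + 1) with (t * kappa 0 + 2 * (t * kappa_sum t + 1 / 2)) by field.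
    eapply Rle_trans; [apply Rabs_triang|]. rewrite !Rabs_mult, (Rabs_pos_eq t), (Rabs_pos_eq 2) by lra.
    specialize (HD t Ht). lra. }
  assert (Hp0 : 0 <= C * h ^ S p) by (apply Rmult_le_pos; [exact HC0|apply pow_le; lra]).
  assert (Hn : forall n, 0 < h * (/ 2) ^ n <= h).
  { intros n. assert (0 < (/ 2) ^ n) by (apply pow_lt; lra).
    assert ((/ 2) ^ n <= 1) by (rewrite <- (pow1 n); apply pow_incr; lra). nra. }
  assert (S : forall n, Rabs (lattice_sum h - lattice_sum (h * (/ 2) ^ n)) <= 2 * (C * h ^ S p) * (1 - (/ 2) ^ n)).
  { induction n as [|n IH].
    - simpl. rewrite Rmult_1_r. replace (lattice_sum h - lattice_sum h) with 0 by ring.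
      rewrite Rabs_R0. lra.
    - assert (Hn' := Hn (S n)). assert (B := HC (h * (/ 2) ^ S n) ltac:(lra)).
      replace (2 * (h * (/ 2) ^ S n)) with (h * (/ 2) ^ n) in B by (simpl; field).
      replace (lattice_sum h - lattice_sum (h * (/ 2) ^ S n)) with
        ((lattice_sum h - lattice_sum (h * (/ 2) ^ n)) + (lattice_sum (h * (/ 2) ^ n) - lattice_sum (h * (/ 2) ^ S n))) by ring.
      eapply Rle_trans; [apply Rabs_triang|].
      assert (Q : C * (h * (/ 2) ^ S n) ^ S p <= C * h ^ S p * (/ 2) ^ S n).
      { rewrite Rpow_mult_distr, <- Rmult_assoc. apply Rmult_le_compat_l; [exact Hp0|].
        assert (0 < (/ 2) ^ S n <= 1).
        { split; [apply pow_lt; lra|]. rewrite <- (pow1 (S n)). apply pow_incr; lra. }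
        set (x := (/ 2) ^ S n) in *. simpl. assert (x ^ p <= 1) by (rewrite <- (pow1 p); apply pow_incr; lra).
        nra. }
      assert (B' := Rle_trans _ _ _ B Q). clear B Q Hn'.
      change ((/ 2) ^ S n) with (/ 2 * (/ 2) ^ n) in *.
      set (a := (/ 2) ^ n) in *. set (Y := C * h ^ S p) in *. assert (0 <= Y * a) by (apply Rmult_le_pos; [exact Hp0|apply pow_le; lra]). lra. }
  apply le_epsilon. intros eps Heps.
  set (M := Rabs (kappa 0) + 2 * D + 1).
  assert (HM : 0 < M) by (unfold M; assert (A := Rabs_pos (kappa 0)); lra).
  destruct (pow_lt_1_zero (/ 2) ltac:(rewrite Rabs_pos_eq; lra) (eps / M) ltac:(now apply Rdiv_lt_0_compat)) as [n Hn2].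
  specialize (Hn2 n (le_n n)). rewrite Rabs_pos_eq in Hn2 by (apply pow_le; lra).
  assert (T' := T (h * (/ 2) ^ n) ltac:(specialize (Hn n); lra)). specialize (S n). specialize (Hn n).
  replace (lattice_sum h + 1) with ((lattice_sum h - lattice_sum (h * (/ 2) ^ n)) + (lattice_sum (h * (/ 2) ^ n) + 1)) by ring.
  eapply Rle_trans; [apply Rabs_triang|].
  assert (0 < (/ 2) ^ n) by (apply pow_lt; lra).
  assert (M * (h * (/ 2) ^ n) <= eps).
  { apply Rle_trans with (M * (eps / M)); [|right; field; lra].
    apply Rmult_le_compat_l; [lra|]. nra. }
  assert ((Rabs (kappa 0) + 2 * D) * (h * (/ 2) ^ n) <= M * (h * (/ 2) ^ n)) by (unfold M; nra).
  assert (2 * (C * h ^ Datatypes.S p) * (1 - (/ 2) ^ n) <= 2 * C * h ^ Datatypes.S p) by nra.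
  lra.
Qed.

Definition planck_partial (u : R) (N : nat) : R := rsum (fun m => planck (INR m * u)) 1 N.

Definition planck_sum (u : R) : R := kappa_sum u + PI ^ 2 / 6 / u ^ 2.

Lemma planck_sum_lim (u : R) : 0 < u -> is_lim_seq (planck_partial u) (planck_sum u).
Proof.
  intros Hu. apply is_lim_seq_ext with (fun N => kappa_partial u N + zeta2_partial N * / u ^ 2).
  - intros N. unfold kappa_partial, zeta2_partial, planck_partial.
    rewrite (Rmult_comm (rsum _ 1 N)), <- rsum_scal, <- rsum_plus. apply rsum_ext. intros m Hm.
    assert (P : 0 < INR m) by (apply lt_0_INR; lia).
    assert (Q : 0 < INR m * u) by nra. unfold kappa.
    destruct (Req_EM_T (INR m * u) 0); [lra|]. unfold Rsqr. field. lra.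
  - unfold planck_sum. apply is_lim_seq_plus'; [now apply kappa_sum_lim|].
    apply is_lim_seq_mult'; [apply zeta2_lim|apply is_lim_seq_const].
Qed.

(** Solving u (kappa 0 + 2 kappa_sum u) = - 1 for the sum gives the terms - 1 / (2u) and - kappa 0 /
    2 = 1/24; the division by 2u costs one power. *)
Lemma planck_sum_asymptotic (p : nat) :
  exists C, 0 <= C /\ forall u, 0 < u <= 1 ->
    Rabs (planck_sum u - (PI ^ 2 / 6 / u ^ 2 - 1 / (2 * u) + 1 / 24)) <= C * u ^ p.
Proof.
  destruct (lattice_sum_asymptotic p) as [C [HC0 HC]]. exists C. split; [exact HC0|]. intros u Hu.
  specialize (HC u Hu). unfold planck_sum.
  assert (K0 : kappa 0 = - (1 / 12)) by (unfold kappa; destruct (Req_EM_T 0 0); lra).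
  replace (kappa_sum u + PI ^ 2 / 6 / u ^ 2 - (PI ^ 2 / 6 / u ^ 2 - 1 / (2 * u) + 1 / 24)) with
    ((lattice_sum u + 1) / (2 * u)) by (unfold lattice_sum; rewrite K0; field; lra).
  unfold Rdiv. rewrite Rabs_mult, (Rabs_pos_eq (/ (2 * u))) by (left; apply Rinv_0_lt_compat; lra).
  apply Rmult_le_reg_r with (2 * u); [lra|]. rewrite Rmult_assoc, Rinv_l by lra.
  simpl in HC. assert (0 <= C * u ^ p) by (apply Rmult_le_pos; [exact HC0|apply pow_le; lra]). nra.
Qed.

(** * The Lambert series of the weights *)

Lemma pow_exp_bound (t : R) (p : nat) : 0 <= t -> t ^ p * exp (- t) <= INR (fact p).
Proof.
  intros Ht. assert (F := INR_fact_lt_0 p). assert (E := exp_pos t).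
  assert (H : t ^ p / INR (fact p) <= exp t).
  { eapply Rle_trans; [|apply (exp_ge_taylor t p Ht)].
    destruct p as [|p]; [simpl; lra|]. rewrite tech5.
    assert (0 <= sum_f_R0 (fun k => t ^ k / INR (fact k)) p); [|lra].
    apply cond_pos_sum. intros j. apply Rdiv_le_0_compat; [now apply pow_le|apply INR_fact_lt_0]. }
  rewrite exp_Ropp. apply Rmult_le_reg_r with (exp t); [exact E|].
  rewrite Rmult_assoc, Rinv_l, Rmult_1_r by lra.
  apply Rmult_le_reg_r with (/ INR (fact p)); [now apply Rinv_0_lt_compat|].
  replace (INR (fact p) * exp t * / INR (fact p)) with (exp t) by (field; lra). exact H.
Qed.

Lemma pow_geom_lim (c u : R) (p : nat) : 0 < u ->
  is_lim_seq (fun J => c * (INR J ^ p * exp (- (INR J * u)))) 0.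
Proof.
  intros Hu. replace (Finite 0) with (Rbar_mult c 0) by (simpl; f_equal; ring).
  apply is_lim_seq_scal_l.
  apply is_lim_seq_le_le_loc with (u := fun _ => 0) (w := fun J => (INR (fact (S p)) / u ^ S p) * / INR J).
  - exists 1%nat. intros J HJ. assert (P : 0 < INR J) by (apply lt_0_INR; lia).
    assert (Q : 0 < INR J * u) by now apply Rmult_lt_0_compat.
    assert (Up : 0 < u ^ S p) by now apply pow_lt.
    split; [apply Rmult_le_pos; [apply pow_le; lra|left; apply exp_pos]|].
    assert (H := pow_exp_bound (INR J * u) (S p) (Rlt_le _ _ Q)).
    rewrite Rpow_mult_distr in H. apply Rmult_le_reg_r with (INR J * u ^ S p); [now apply Rmult_lt_0_compat|].
    replace (INR (fact (S p)) / u ^ S p * / INR J * (INR J * u ^ S p)) with (INR (fact (S p))).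
    + eapply Rle_trans; [|exact H]. right. simpl. ring.
    + field. lra.
  - apply is_lim_seq_const.
  - replace (Finite 0) with (Rbar_mult (INR (fact (S p)) / u ^ S p) 0) by (simpl; f_equal; ring).
    apply is_lim_seq_scal_l. apply (is_lim_seq_inv INR p_infty); [apply is_lim_seq_INR|discriminate].
Qed.

Lemma rsum_linear_geom (y : R) (J : nat) :
  (1 - y) ^ 2 * rsum (fun d => INR d * y ^ d) 1 J =
  y - (INR J + 1) * y ^ S J + INR J * y ^ S (S J).
Proof.
  induction J as [|J IH]; [simpl; ring|]. cbn [rsum]. rewrite Rmult_plus_distr_l, IH.
  change (1 + J)%nat with (S J). rewrite S_INR. simpl. ring.
Qed.

Lemma exp_neg_INR_mult (d : nat) (w : R) : exp (- (INR d * w)) = exp (- w) ^ d.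
Proof.
  induction d as [|d IH]; [simpl; rewrite Rmult_0_l, Ropp_0, exp_0; reflexivity|].
  rewrite S_INR. simpl. rewrite <- IH, <- exp_plus. f_equal. ring.
Qed.

(** The remainder of the series sum of d y^d is explicit and increases with y = e^(- w). Bounding it
    by its value at u makes it uniform over all arguments w >= u, which is needed when summing over
    the other index. *)
Lemma planck_tail (w u : R) (J : nat) : 0 < u <= w ->
  Rabs (planck w - rsum (fun d => INR d * exp (- (INR d * w))) 1 J) <=
  / (1 - exp (- u)) ^ 2 * ((INR J + 1) * exp (- (INR J * u))).
Proof.
  intros Hu. set (y := exp (- w)). set (x := exp (- u)).
  assert (Hy : 0 < y) by apply exp_pos.
  assert (Hx : x < 1) by (unfold x; rewrite <- exp_0; apply exp_increasing; lra).
  assert (Hyx : y <= x).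
  { unfold y, x. destruct (Req_dec w u) as [->|]; [lra|]. left. apply exp_increasing. lra. }
  assert (E : forall d, exp (- (INR d * w)) = y ^ d).
  { intros d. apply exp_neg_INR_mult. }
  assert (Ex : exp (- (INR J * u)) = x ^ J).
  { apply exp_neg_INR_mult. }
  rewrite (rsum_ext _ (fun d => INR d * y ^ d)) by (intros; now rewrite E). rewrite Ex.
  assert (P : planck w = y / (1 - y) ^ 2).
  { unfold planck, y. rewrite exp_Ropp. assert (W := exp_pos w).
    assert (1 < exp w) by (rewrite <- exp_0; apply exp_increasing; lra). field. lra. }
  assert (L := rsum_linear_geom y J). rewrite P.
  assert (D : 0 < (1 - y) ^ 2) by (apply pow_lt; lra).
  assert (Dx : 0 < (1 - x) ^ 2) by (apply pow_lt; lra).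
  replace (rsum (fun d => INR d * y ^ d) 1 J) with
    ((y - (INR J + 1) * y ^ S J + INR J * y ^ S (S J)) / (1 - y) ^ 2) by (rewrite <- L; field; lra).
  replace (y / (1 - y) ^ 2 - (y - (INR J + 1) * y ^ S J + INR J * y ^ S (S J)) / (1 - y) ^ 2)
    with (/ (1 - y) ^ 2 * ((1 + INR J * (1 - y)) * y ^ S J)) by (simpl; field; lra).
  assert (HJ := pos_INR J). assert (HyJ : 0 < y ^ S J) by now apply pow_lt.
  assert (Q : 0 <= INR J * (1 - y)) by (apply Rmult_le_pos; lra).
  rewrite Rabs_pos_eq.
  2:{ apply Rmult_le_pos; [left; now apply Rinv_0_lt_compat|]. apply Rmult_le_pos; lra. }
  apply Rmult_le_compat.
  - left; now apply Rinv_0_lt_compat.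
  - apply Rmult_le_pos; lra.
  - apply Rinv_le_contravar; [exact Dx|]. apply pow_incr. lra.
  - apply Rmult_le_compat; try lra.
    + assert (INR J * (1 - y) <= INR J * 1) by (apply Rmult_le_compat_l; lra). lra.
    + simpl. assert (y ^ J <= x ^ J) by (apply pow_incr; lra).
      assert (0 < y ^ J) by now apply pow_lt.
      apply Rle_trans with (1 * y ^ J); [apply Rmult_le_compat_r; lra|lra].
Qed.

Lemma rsum_lambert (e : R) (D J : nat) (g : nat -> R) : (1 <= D)%nat ->
  rsum (fun n => lambert e D n * g n) 1 J =
  rsum (fun i => INR D * e ^ i * g (D * i)%nat) 1 (J / D).
Proof.
  intros HD.
  induction J as [|J IH]; [rewrite Nat.Div0.div_0_l; reflexivity|].
  cbn [rsum]. rewrite IH. change (1 + J)%nat with (S J). unfold lambert at 1.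
  destruct (Nat.eqb_spec (S J) 0) as [H|_]; [lia|].
  assert (E1 := Nat.div_mod_eq (S J) D). assert (E2 := Nat.mod_upper_bound (S J) D ltac:(lia)).
  destruct (Nat.eqb_spec (S J mod D) 0) as [H|H].
  - assert (Hq : (1 <= S J / D)%nat) by (destruct (S J / D)%nat; lia).
    assert (HJ : (J / D = S J / D - 1)%nat).
    { symmetry. apply (Nat.div_unique J D _ (D - 1)); [lia|].
      rewrite Nat.mul_sub_distr_l.
      assert (D * 1 <= D * (S J / D))%nat by (apply Nat.mul_le_mono_l; exact Hq). lia. }
    replace (S J / D)%nat with (S (J / D)) at 2 by lia. cbn [rsum].
    replace (1 + J / D)%nat with (S J / D)%nat by lia.
    replace (D * (S J / D))%nat with (S J) by lia. reflexivity.
  - assert (HJ : (J / D = S J / D)%nat).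
    { symmetry. apply (Nat.div_unique J D _ (S J mod D - 1)); lia. }
    rewrite HJ. ring.
Qed.

Lemma is_lim_seq_squeeze_0 (u v w : nat -> R) (l : R) :
  (forall n, Rabs (u n - v n) <= w n) -> is_lim_seq w 0 -> is_lim_seq v l -> is_lim_seq u l.
Proof.
  intros H Hw Hv. apply is_lim_seq_ext with (fun n => v n + (u n - v n)); [intros; ring|].
  replace (Finite l) with (Finite (l + 0)) by (f_equal; ring).
  apply is_lim_seq_plus'; [exact Hv|]. apply is_lim_seq_abs_0.
  apply is_lim_seq_le_le with (u := fun _ => 0) (w := w); [|apply is_lim_seq_const|exact Hw].
  intros n. split; [apply Rabs_pos|apply H].
Qed.

Lemma exp_le (x y : R) : x <= y -> exp x <= exp y.
Proof. intros [H| ->]; [left; now apply exp_increasing|lra]. Qed.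

Section Lambert.
Variables (e u : R) (m : nat).
Hypothesis He : Rabs e = 1.
Hypothesis Hm : (1 <= m)%nat.
Hypothesis Hu : 0 < u.

Let v := fun n => exp (- (INR n * u)).

Lemma pow_e_abs (i : nat) : Rabs (e ^ i) = 1.
Proof. now rewrite <- RPow_abs, He, pow1. Qed.

Lemma INR_m_ge_1 : 1 <= INR m.
Proof. apply (le_INR 1). exact Hm. Qed.

Lemma lsum_square (J : nat) :
  Rabs (rsum (fun n => lsum e m n * v n) 1 J -
    rsum (fun i => e ^ i * INR m * rsum (fun d => INR d * v (m * d * i)%nat) 1 J) 1 J) <=
  INR m * (INR J ^ 3 * v J).
Proof.
  replace (rsum (fun n => lsum e m n * v n) 1 J) with
    (rsum (fun d => rsum (fun n => lambert e (m * d) n * v n) 1 J) 1 J).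
  2:{ rewrite rsum_swap. apply rsum_ext. intros n Hn.
      rewrite <- (lsum_stable e m n J) by lia. rewrite Rmult_comm, <- rsum_scal.
      apply rsum_ext. intros; ring. }
  replace (rsum (fun i => e ^ i * INR m * rsum (fun d => INR d * v (m * d * i)%nat) 1 J) 1 J) with
    (rsum (fun d => rsum (fun i => INR (m * d) * e ^ i * v (m * d * i)%nat) 1 J) 1 J).
  2:{ rewrite rsum_swap. apply rsum_ext. intros i Hi. rewrite <- rsum_scal.
      apply rsum_ext. intros d Hd. rewrite mult_INR. ring. }
  assert (Hv : forall n, 0 < v n) by (intros; apply exp_pos).
  assert (R1 := INR_m_ge_1).
  assert (HJ := pos_INR J).
  unfold Rminus.
  replace (- rsum (fun d => rsum (fun i => INR (m * d) * e ^ i * v (m * d * i)%nat) 1 J) 1 J) with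
    (rsum (fun d => -1 * rsum (fun i => INR (m * d) * e ^ i * v (m * d * i)%nat) 1 J) 1 J)
    by (rewrite rsum_scal; ring).
  rewrite <- rsum_plus.
  eapply Rle_trans; [apply rsum_abs|].
  apply Rle_trans with (rsum (fun _ => INR m * (INR J ^ 2 * v J)) 1 J).
  2:{ rewrite rsum_const. right. simpl. ring. }
  apply rsum_le. intros d Hd. rewrite rsum_lambert by nia.
  assert (Hmd : (1 <= m * d)%nat) by nia.
  assert (Hdiv : (J / (m * d) <= J)%nat).
  { apply Nat.Div0.div_le_upper_bound. rewrite <- (Nat.mul_1_l J) at 1. now apply Nat.mul_le_mono_r. }
  assert (EJ : (J = J / (m * d) + (J - J / (m * d)))%nat) by (rewrite Nat.add_comm; symmetry; now apply Nat.sub_add).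
  replace (rsum (fun i => INR (m * d) * e ^ i * v (m * d * i)%nat) 1 J) with
    (rsum (fun i => INR (m * d) * e ^ i * v (m * d * i)%nat) 1 (J / (m * d) + (J - J / (m * d))))
    by (now rewrite <- EJ).
  rewrite rsum_split.
  match goal with |- Rabs (?a + -1 * (?a + ?b)) <= _ => replace (a + -1 * (a + b)) with (- b) by ring end.
  rewrite Rabs_Ropp. eapply Rle_trans; [apply rsum_abs|].
  apply Rle_trans with (rsum (fun _ => INR m * (INR J * v J)) (1 + J / (m * d)) (J - J / (m * d))).
  - apply rsum_le. intros i Hi. rewrite !Rabs_mult, pow_e_abs, Rmult_1_r.
    rewrite (Rabs_pos_eq (INR (m * d))) by apply pos_INR. rewrite (Rabs_pos_eq (v _)) by (left; apply Hv).
    rewrite mult_INR, Rmult_assoc. apply Rmult_le_compat_l; [lra|].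
    apply Rmult_le_compat; [apply pos_INR|left; apply Hv|apply le_INR; lia|].
    unfold v. apply exp_le. apply Ropp_le_contravar, Rmult_le_compat_r; [lra|]. apply le_INR.
    assert (E1 := Nat.div_mod_eq J (m * d)). assert (E2 := Nat.mod_upper_bound J (m * d) ltac:(nia)).
    assert (m * d * (1 + J / (m * d)) <= m * d * i)%nat by (apply Nat.mul_le_mono_l; lia). lia.
  - rewrite rsum_const. assert (INR (J - J / (m * d)) <= INR J) by (apply le_INR; lia).
    assert (0 <= INR m * (INR J * v J)).
    { apply Rmult_le_pos; [lra|]. apply Rmult_le_pos; [lra|left; apply Hv]. }
    apply Rle_trans with (INR J * (INR m * (INR J * v J))); [apply Rmult_le_compat_r; lra|].
    right. simpl. ring.
Qed.

Lemma lsum_planck (J : nat) :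
  Rabs (rsum (fun n => lsum e m n * v n) 1 J -
    rsum (fun i => e ^ i * INR m * planck (INR i * (INR m * u))) 1 J) <=
  INR m * (INR J ^ 3 * v J) + (INR m * / (1 - exp (- u)) ^ 2) * ((INR J ^ 2 + INR J) * v J).
Proof.
  set (S2 := rsum (fun i => e ^ i * INR m * rsum (fun d => INR d * v (m * d * i)%nat) 1 J) 1 J).
  replace (rsum (fun n => lsum e m n * v n) 1 J - rsum (fun i => e ^ i * INR m * planck (INR i * (INR m * u))) 1 J)
    with ((rsum (fun n => lsum e m n * v n) 1 J - S2) +
      (S2 - rsum (fun i => e ^ i * INR m * planck (INR i * (INR m * u))) 1 J)) by ring.
  eapply Rle_trans; [apply Rabs_triang|]. apply Rplus_le_compat; [apply lsum_square|].
  assert (R1 := INR_m_ge_1).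
  unfold S2. replace (rsum (fun i => e ^ i * INR m * planck (INR i * (INR m * u))) 1 J) with
    (-1 * rsum (fun i => -1 * (e ^ i * INR m * planck (INR i * (INR m * u)))) 1 J)
    by (rewrite rsum_scal; ring).
  unfold Rminus. replace (- (-1 * rsum (fun i => -1 * (e ^ i * INR m * planck (INR i * (INR m * u)))) 1 J)) with
    (rsum (fun i => -1 * (e ^ i * INR m * planck (INR i * (INR m * u)))) 1 J) by ring.
  rewrite <- rsum_plus. eapply Rle_trans; [apply rsum_abs|].
  set (c := INR m * / (1 + - exp (- u)) ^ 2).
  apply Rle_trans with (rsum (fun _ => c * ((INR J + 1) * v J)) 1 J).
  2:{ rewrite rsum_const. right. simpl. ring. }
  apply rsum_le. intros i Hi.
  replace (e ^ i * INR m * rsum (fun d => INR d * v (m * d * i)%nat) 1 J + -1 * (e ^ i * INR m * planck (INR i * (INR m * u))))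
    with (- (e ^ i * (INR m * (planck (INR i * (INR m * u)) - rsum (fun d => INR d * v (m * d * i)%nat) 1 J)))) by ring.
  rewrite Rabs_Ropp, !Rabs_mult, pow_e_abs, Rmult_1_l, (Rabs_pos_eq (INR m)) by lra.
  unfold c. rewrite Rmult_assoc. apply Rmult_le_compat_l; [lra|].
  assert (Hi1 : 1 <= INR i) by (apply (le_INR 1); lia).
  eapply Rle_trans; [|apply (planck_tail (INR i * (INR m * u)) u J)].
  - right. f_equal. f_equal. apply rsum_ext. intros d Hd. unfold v. rewrite !mult_INR. f_equal. f_equal. ring.
  - split; [exact Hu|]. assert (u <= INR m * u) by nra. nra.
Qed.

Lemma lambert_series (l : R) :
  is_lim_seq (fun J => rsum (fun i => e ^ i * planck (INR i * (INR m * u))) 1 J) l ->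
  is_lim_seq (fun J => rsum (fun n => lsum e m n * v n) 1 J) (INR m * l).
Proof.
  intros H. eapply is_lim_seq_squeeze_0; [apply lsum_planck| |].
  - replace (Finite 0) with (Finite (0 + (0 + 0))) by (f_equal; ring).
    apply is_lim_seq_ext with (fun J => INR m * (INR J ^ 3 * v J) +
      ((INR m * / (1 - exp (- u)) ^ 2) * (INR J ^ 2 * v J) + (INR m * / (1 - exp (- u)) ^ 2) * (INR J ^ 1 * v J))).
    + intros J. simpl. ring.
    + repeat apply is_lim_seq_plus'; now apply pow_geom_lim.
  - apply is_lim_seq_ext with (fun J => INR m * rsum (fun i => e ^ i * planck (INR i * (INR m * u))) 1 J).
    + intros J. rewrite <- rsum_scal. apply rsum_ext. intros; ring.
    + apply is_lim_seq_mult'; [apply is_lim_seq_const|exact H].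
Qed.
End Lambert.

Lemma planck_pos (w : R) : 0 < w -> 0 < planck w.
Proof.
  intros Hw. unfold planck. assert (1 < exp w) by (rewrite <- exp_0; apply exp_increasing; lra).
  apply Rdiv_lt_0_compat; [lra|]. apply pow_lt. lra.
Qed.

(** Absolute convergence yields some limit; the partial sums of even length identify it through
    [rsum_alt_split]. *)
Lemma planck_alt_lim (u : R) : 0 < u ->
  is_lim_seq (fun J => rsum (fun i => (-1) ^ i * planck (INR i * u)) 1 J)
    (2 * planck_sum (2 * u) - planck_sum u).
Proof.
  intros Hu.
  assert (L := planck_sum_lim u Hu).
  assert (Hpos : forall m, (1 <= m)%nat -> 0 < planck (INR m * u)).
  { intros m Hm. apply planck_pos, Rmult_lt_0_compat; [apply lt_0_INR; lia|exact Hu]. }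
  destruct (rsum_cv_abs (fun i => (-1) ^ i * planck (INR i * u)) (planck_sum u)) as [l Hl].
  { intros N. rewrite (rsum_ext _ (fun m => planck (INR m * u))).
    - change (rsum (fun m => planck (INR m * u)) 1 N) with (planck_partial u N).
      apply (is_lim_seq_incr_compare _ _ L). intros n. unfold planck_partial. cbn [rsum].
      assert (H := Hpos (1 + n)%nat ltac:(lia)). lra.
    - intros i Hi. rewrite Rabs_mult, pow_1_abs, Rmult_1_l. apply Rabs_pos_eq. left. apply Hpos. lia. }
  assert (H2 := is_lim_seq_double _ _ Hl).
  assert (H3 : is_lim_seq (fun N => rsum (fun i => (-1) ^ i * planck (INR i * u)) 1 (2 * N))
    (2 * planck_sum (2 * u) - planck_sum u)).
  { apply is_lim_seq_ext with (fun N => 2 * planck_partial (2 * u) N - planck_partial u (2 * N)).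
    - intros N. rewrite rsum_alt_split. f_equal. f_equal. unfold planck_partial. apply rsum_ext.
      intros i _. rewrite mult_INR. simpl INR. f_equal. ring.
    - apply is_lim_seq_minus'; [|now apply is_lim_seq_double].
      apply is_lim_seq_mult'; [apply is_lim_seq_const|]. apply planck_sum_lim. lra. }
  assert (E : Finite l = Finite (2 * planck_sum (2 * u) - planck_sum u)).
  { rewrite <- (is_lim_seq_unique _ _ H2). now apply is_lim_seq_unique. }
  rewrite <- E. exact Hl.
Qed.

(** The value at q = e^(- u) of the generating function of the weights: sign 1 gives [planck_sum],
    sign -1 the alternating combination of [planck_alt_lim], and the third series is rescaled by
    K. *)
Definition weight_sum (k : nat) (u : R) : R :=
  let K := INR (2 * k + 1) in
  2 * planck_sum u - (2 * planck_sum (2 * u) - planck_sum u) +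
  K * (2 * planck_sum (2 * (K * u)) - planck_sum (K * u)).

Lemma weight_sum_lim (k : nat) (u : R) : 0 < u ->
  is_lim_seq (fun N => rsum (fun n => weight k n * exp (- (INR n * u))) 1 N) (weight_sum k u).
Proof.
  intros Hu. unfold weight_sum. set (K := (2 * k + 1)%nat).
  assert (HK : 0 < INR K) by (apply lt_0_INR; unfold K; lia).
  assert (A1 : Rabs (-1) = 1) by (rewrite Rabs_left; lra).
  assert (L1 : is_lim_seq (fun J => rsum (fun n => lsum 1 1 n * exp (- (INR n * u))) 1 J) (INR 1 * planck_sum u)).
  { apply (lambert_series 1 u 1 Rabs_R1 (le_n 1) Hu).
    apply is_lim_seq_ext with (planck_partial u); [|now apply planck_sum_lim].
    intros N. apply rsum_ext. intros i _. rewrite pow1, !Rmult_1_l. reflexivity. }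
  assert (L2 : is_lim_seq (fun J => rsum (fun n => lsum (-1) 1 n * exp (- (INR n * u))) 1 J)
     (INR 1 * (2 * planck_sum (2 * u) - planck_sum u))).
  { apply (lambert_series (-1) u 1 A1 (le_n 1) Hu).
    apply is_lim_seq_ext with (2 := planck_alt_lim u Hu).
    intros N. apply rsum_ext. intros i _. now rewrite Rmult_1_l. }
  assert (L3 : is_lim_seq (fun J => rsum (fun n => lsum (-1) K n * exp (- (INR n * u))) 1 J)
     (INR K * (2 * planck_sum (2 * (INR K * u)) - planck_sum (INR K * u)))).
  { apply (lambert_series (-1) u K A1 ltac:(unfold K; lia) Hu). apply planck_alt_lim. nra. }
  rewrite Rmult_1_l in L1, L2.
  apply is_lim_seq_ext with (fun N => 2 * rsum (fun n => lsum 1 1 n * exp (- (INR n * u))) 1 N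
    - rsum (fun n => lsum (-1) 1 n * exp (- (INR n * u))) 1 N
    + rsum (fun n => lsum (-1) K n * exp (- (INR n * u))) 1 N).
  - intros N. unfold Rminus. rewrite <- rsum_scal.
    replace (- rsum (fun n => lsum (-1) 1 n * exp (- (INR n * u))) 1 N) with
      (rsum (fun n => -1 * (lsum (-1) 1 n * exp (- (INR n * u)))) 1 N) by (rewrite rsum_scal; ring).
    rewrite <- !rsum_plus. apply rsum_ext. intros n _. unfold weight, K. ring.
  - apply is_lim_seq_plus'; [|exact L3]. apply is_lim_seq_minus'; [|exact L2].
    apply is_lim_seq_mult'; [apply is_lim_seq_const|exact L1].
Qed.

(** The constants A and B of the expansion. With K = 2k + 1, the u^(-2) terms add up to (PI^2 /
    6)(5/2 - 1 / (2K)) and the constants to (K + 1) / 24. The alternating series have no 1 / u term,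
    so that coefficient is - 1 for every k. *)
Definition rate (k : nat) : R := PI ^ 2 * (5 * INR k + 2) / (6 * (2 * INR k + 1)).
Definition offset (k : nat) : R := - (INR k + 1) / 12.

Lemma weight_sum_asymptotic (k p : nat) :
  exists C u0, 0 <= C /\ 0 < u0 /\ forall u, 0 < u <= u0 ->
    Rabs (weight_sum k u - (rate k / u ^ 2 - 1 / u - offset k)) <= C * u ^ p.
Proof.
  destruct (planck_sum_asymptotic p) as [C [HC0 HC]].
  set (K := INR (2 * k + 1)). assert (Hk := pos_INR k).
  assert (EK : K = 2 * INR k + 1) by (unfold K; rewrite plus_INR, mult_INR; simpl; ring).
  exists (C * (3 + 2 * 2 ^ p + 2 * K * (2 * K) ^ p + K * K ^ p)), (/ (2 * K)).
  assert (K1 : 1 <= K) by lra.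
  assert (P1 : 0 <= 2 ^ p) by (apply pow_le; lra).
  assert (P2 : 0 <= (2 * K) ^ p) by (apply pow_le; lra).
  assert (P3 : 0 <= K ^ p) by (apply pow_le; lra).
  split; [|split].
  - apply Rmult_le_pos; [exact HC0|]. assert (0 <= K * (2 * K) ^ p) by (apply Rmult_le_pos; lra).
    assert (0 <= K * K ^ p) by (apply Rmult_le_pos; lra). lra.
  - apply Rinv_0_lt_compat. lra.
  - intros u Hu.
    assert (HKu : 2 * (K * u) <= 1).
    { apply Rmult_le_reg_r with (/ (2 * K)); [apply Rinv_0_lt_compat; lra|].
      replace (2 * (K * u) * / (2 * K)) with u by (field; lra). lra. }
    assert (Ku : u <= K * u) by nra.
    assert (H1 := HC u ltac:(lra)). assert (H2 := HC (2 * u) ltac:(lra)).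
    assert (H3 := HC (2 * (K * u)) ltac:(lra)). assert (H4 := HC (K * u) ltac:(lra)).
    rewrite <- Rmult_assoc in H3.
    rewrite (Rpow_mult_distr 2 u p) in H2. rewrite (Rpow_mult_distr (2 * K) u p) in H3.
    rewrite (Rpow_mult_distr K u p) in H4.
    set (M := fun v => PI ^ 2 / 6 / v ^ 2 - 1 / (2 * v) + 1 / 24) in *.
    change (Rabs (planck_sum u - M u) <= C * u ^ p) in H1.
    change (Rabs (planck_sum (2 * u) - M (2 * u)) <= C * (2 ^ p * u ^ p)) in H2.
    change (Rabs (planck_sum (2 * K * u) - M (2 * K * u)) <= C * ((2 * K) ^ p * u ^ p)) in H3.
    change (Rabs (planck_sum (K * u) - M (K * u)) <= C * (K ^ p * u ^ p)) in H4.
    unfold weight_sum. fold K. rewrite <- (Rmult_assoc 2 K u).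
    replace (rate k / u ^ 2 - 1 / u - offset k) with
      (2 * M u - (2 * M (2 * u) - M u) + K * (2 * M (2 * K * u) - M (K * u))).
    2:{ unfold M, rate, offset. rewrite EK. field. split; lra. }
    set (d1 := planck_sum u - M u) in *. set (d2 := planck_sum (2 * u) - M (2 * u)) in *.
    set (d3 := planck_sum (2 * K * u) - M (2 * K * u)) in *.
    set (d4 := planck_sum (K * u) - M (K * u)) in *.
    match goal with |- Rabs ?x <= _ => replace x with (3 * d1 - 2 * d2 + K * (2 * d3 - d4))
      by (unfold d1, d2, d3, d4; ring) end.
    apply Rabs_le_between in H1, H2, H3, H4.
    set (t1 := C * u ^ p) in *.
    assert (X3 : Rabs (K * (2 * d3 - d4)) <= K * (2 * (C * ((2 * K) ^ p * u ^ p)) + C * (K ^ p * u ^ p))).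
    { rewrite Rabs_mult, (Rabs_pos_eq K) by lra. apply Rmult_le_compat_l; [lra|].
      apply Rabs_le. lra. }
    apply Rabs_le_between in X3. apply Rabs_le.
    match goal with |- _ <= _ <= ?x => replace x with
      (3 * t1 + 2 * (C * (2 ^ p * u ^ p)) + K * (2 * (C * ((2 * K) ^ p * u ^ p)) + C * (K ^ p * u ^ p)))
      by (unfold t1; ring) end. lra.
Qed.

(** * The comparison function *)

Lemma is_derive_rsum (f f' : nat -> R -> R) (a n : nat) (y : R) :
  (forall i, (a <= i < a + n)%nat -> is_derive (f i) y (f' i y)) ->
  is_derive (fun t => rsum (fun i => f i t) a n) y (rsum (fun i => f' i y) a n).
Proof.
  induction n as [|n IH]; intros H; simpl; [apply is_derive_Rconst|].
  apply is_derive_Rplus; [apply IH; intros; apply H; lia|apply H; lia].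
Qed.

(** An expansion of f'(x - y) in y is integrated term by term: the remainder for f vanishes at y = 0
    and its y-derivative is minus the remainder for f', so the mean value theorem gains a factor
    y. *)
Lemma taylor_step (f f' : R -> R) (c : nat -> R -> R) (b C : R) (k : nat) :
  0 < C -> ev (fun x => is_derive f x (f' x)) ->
  ev (fun x => forall y, 0 <= y <= x / 2 ->
    Rabs (f' (x - y) - rsum (fun i => c i x * y ^ i) 0 k) <= C * y ^ k * Rpower x (- (b + INR k))) ->
  ev (fun x => forall y, 0 <= y <= x / 2 ->
    Rabs (f (x - y) - f x + rsum (fun i => c i x / INR (S i) * y ^ S i) 0 k) <=
      C * y ^ S k * Rpower x (- (b + INR k))).
Proof.
  intros HC Hd H.
  apply (ev_imp _ _ (ev_and _ _ (ev_half _ Hd) (ev_and _ _ H (ev_ge 1)))).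
  intros x [D [E Hx]] y Hy.
  set (Psi := fun y => f (x - y) - f x + rsum (fun i => c i x / INR (S i) * y ^ S i) 0 k).
  destruct (ex_MVT Psi (fun y => - (f' (x - y) - rsum (fun i => c i x * y ^ i) 0 k)) 0 y) as [t [Ht Et]];
    [lra| |].
  - intros z Hz. unfold Psi.
    replace (- (f' (x - z) - rsum (fun i => c i x * z ^ i) 0 k)) with
      ((- f' (x - z) - 0) + rsum (fun i => c i x * z ^ i) 0 k) by ring.
    apply is_derive_Rplus.
    + apply is_derive_Rminus; [|apply is_derive_Rconst].
      replace (- f' (x - z)) with (scal (-1) (f' (x - z))) by (unfold scal; simpl; unfold mult; simpl; ring).
      apply (is_derive_comp f (fun t => x - t)); [apply D; lra|]. auto_derive; [exact I|ring].
    + apply (is_derive_rsum (fun i t => c i x / INR (S i) * t ^ S i) (fun i t => c i x * t ^ i)).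
      intros i _. assert (P : 0 < INR (S i)) by (apply lt_0_INR; lia).
      auto_derive; [exact I|]. simpl Init.Nat.pred.
      change (match i with O => 1 | S _ => INR i + 1 end) with (INR (S i)). field. lra.
  - assert (P0 : Psi 0 = 0).
    { unfold Psi. rewrite Rminus_0_r, rsum_zero; [ring|]. intros i _. simpl. ring. }
    rewrite P0, !Rminus_0_r in Et. change (Rabs (Psi y) <= C * y ^ S k * Rpower x (- (b + INR k))).
    rewrite Et, Rabs_mult, Rabs_Ropp, (Rabs_pos_eq y) by lra.
    assert (P := Rpower_pos x (- (b + INR k))). assert (Q : 0 <= t ^ k) by (apply pow_le; lra).
    assert (Q2 : t ^ k <= y ^ k) by (apply pow_incr; lra).
    apply Rle_trans with ((C * y ^ k * Rpower x (- (b + INR k))) * y); [|right; simpl; ring].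
    apply Rmult_le_compat_r; [lra|]. eapply Rle_trans; [apply E; lra|].
    apply Rmult_le_compat_r; [lra|]. apply Rmult_le_compat_l; lra.
Qed.

(** Up to sign and factorial [c i] is the i-th derivative of [f], but only its order is recorded.
    The exact value of [c 0] is kept because it becomes the linear term of log F and has to be
    factored out exactly. *)
Lemma Sym_taylor (k : nat) (b : R) (f : R -> R) : Sym k b f ->
  exists (c : nat -> R -> R) (C : R), 0 < C /\
    (forall i, (i < k)%nat -> bigO (b + INR i) (c i)) /\
    ((1 <= k)%nat -> forall x, c 0%nat x = f x) /\
    ev (fun x => forall y, 0 <= y <= x / 2 ->
      Rabs (f (x - y) - rsum (fun i => c i x * y ^ i) 0 k) <= C * y ^ k * Rpower x (- (b + INR k))).
Proof.
  revert b f. induction k as [|k IH]; intros b f H.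
  - destruct H as [[C [HC H]] _].
    exists (fun _ _ => 0), (C * Rpower 2 (Rabs (- b))). split; [|split; [|split]].
    + apply Rmult_lt_0_compat; [exact HC|apply Rpower_pos].
    + intros; lia.
    + intros; lia.
    + apply (ev_imp _ _ (ev_and _ _ (ev_half _ H) (ev_ge 1))). intros x [E Hx] y Hy.
      simpl. rewrite Rminus_0_r, Rplus_0_r, Rmult_1_r, Rmult_assoc.
      eapply Rle_trans; [apply E; lra|]. apply Rmult_le_compat_l; [lra|].
      apply Rpower_comparable; lra.
  - destruct H as [H0 [f' [H1 H2]]]. destruct (IH _ _ H2) as [c [C [HC [Hc [_ E]]]]].
    exists (fun i x => match i with O => f x | S i => - (c i x / INR (S i)) end), C.
    split; [exact HC|]. split; [|split].
    + intros [|i] Hi; [simpl; now rewrite Rplus_0_r|].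
      apply (bigO_ext _ (fun x => (- / INR (S i)) * c i x)).
      { exists 0. intros x _. unfold Rdiv. ring. }
      apply bigO_scal. replace (b + INR (S i)) with (b + 1 + INR i) by (rewrite S_INR; ring).
      apply Hc. lia.
    + intros _ x. reflexivity.
    + apply (ev_imp _ _ (taylor_step f f' c (b + 1) C k HC H1 E)). intros x Hx y Hy.
      specialize (Hx y Hy). rewrite S_INR. replace (b + (INR k + 1)) with (b + 1 + INR k) by ring.
      rewrite rsum_first.
      replace (f (x - y) - (f x * y ^ 0 + rsum (fun i => match i with O => f x | S i0 => - (c i0 x / INR (S i0)) end * y ^ i) 1 k))
        with (f (x - y) - f x + rsum (fun i => c i x / INR (S i) * y ^ S i) 0 k); [exact Hx|].
      rewrite (rsum_shift _ 0 1 k).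
      rewrite (rsum_ext (fun i => match (1 + i)%nat with O => f x | S i0 => - (c i0 x / INR (S i0)) end * y ^ (1 + i))
        (fun i => -1 * (c i x / INR (S i) * y ^ S i))).
      * rewrite rsum_scal. change (y ^ 0) with 1. ring.
      * intros i _. change (- (c i x / INR (S i)) * y ^ S i = -1 * (c i x / INR (S i) * y ^ S i)). ring.
Qed.

(** * The Bessel-type solution F and its logarithmic derivative *)

Section Bessel.
Variable A : R.
Hypothesis HA : 0 < A.

(** The series is I_2(2 sqrt(A x)) / (A x) with I_2 the modified Bessel function. It is the solution
    of x F'' + 3 F' = A F that is regular at 0, and its coefficients are positive. *)
Definition bess_coef (m : nat) : R := A ^ m / (INR (fact m) * INR (fact (m + 2))).
Definition bess : R -> R := PSeries bess_coef.
Definition bess1 : R -> R := PSeries (PS_derive bess_coef).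
Definition bess2 : R -> R := PSeries (PS_derive (PS_derive bess_coef)).

Lemma bess_coef_pos (m : nat) : 0 < bess_coef m.
Proof.
  unfold bess_coef. apply Rdiv_lt_0_compat; [now apply pow_lt|].
  apply Rmult_lt_0_compat; apply INR_fact_lt_0.
Qed.

Lemma bess_coef_succ (m : nat) :
  bess_coef (S m) * (INR (S m) * INR (m + 3)) = A * bess_coef m.
Proof.
  unfold bess_coef. change (S m + 2)%nat with (S (m + 2)).
  change (fact (S m)) with (S m * fact m)%nat. change (fact (S (m + 2))) with (S (m + 2) * fact (m + 2))%nat.
  rewrite !mult_INR. replace (m + 3)%nat with (S (m + 2)) by lia.
  assert (P1 := INR_fact_lt_0 m). assert (P2 := INR_fact_lt_0 (m + 2)).
  assert (P3 : 0 < INR (S m)) by (apply lt_0_INR; lia).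
  assert (P4 : 0 < INR (S (m + 2))) by (apply lt_0_INR; lia).
  simpl pow. field. lra.
Qed.

Lemma bess_radius : CV_radius bess_coef = p_infty.
Proof.
  apply CV_radius_infinite_DAlembert.
  - intros n. apply Rgt_not_eq, bess_coef_pos.
  - apply is_lim_seq_le_le_loc with (u := fun _ => 0) (w := fun n => A * / INR n).
    + exists 1%nat. intros n Hn. assert (P := bess_coef_pos n). assert (Q := bess_coef_pos (S n)).
      assert (E := bess_coef_succ n). assert (N1 : 1 <= INR n) by (apply (le_INR 1); lia).
      rewrite S_INR, plus_INR in E. simpl INR in E.
      rewrite Rabs_pos_eq by (left; now apply Rdiv_lt_0_compat). split; [left; now apply Rdiv_lt_0_compat|].
      apply Rmult_le_reg_r with (bess_coef n * INR n); [apply Rmult_lt_0_compat; lra|].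
      replace (bess_coef (S n) / bess_coef n * (bess_coef n * INR n)) with (bess_coef (S n) * INR n) by (field; lra).
      replace (A * / INR n * (bess_coef n * INR n)) with (A * bess_coef n) by (field; lra).
      rewrite <- E. apply Rmult_le_compat_l; [lra|]. nra.
    + apply is_lim_seq_const.
    + replace (Finite 0) with (Rbar_mult A 0) by (simpl; f_equal; ring).
      apply is_lim_seq_scal_l. apply (is_lim_seq_inv INR p_infty); [apply is_lim_seq_INR|discriminate].
Qed.

Lemma bess_derive (x : R) : is_derive bess x (bess1 x).
Proof. apply is_derive_PSeries. now rewrite bess_radius. Qed.

Lemma bess1_derive (x : R) : is_derive bess1 x (bess2 x).
Proof. apply is_derive_PSeries. now rewrite CV_radius_derive, bess_radius. Qed.

Lemma PSeries_pos (a : nat -> R) (x : R) : CV_radius a = p_infty ->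
  (forall n, 0 < a n) -> 0 <= x -> 0 < PSeries a x.
Proof.
  intros Hr Ha Hx.
  assert (N : forall c, CV_radius c = p_infty -> (forall n, 0 < c n) -> 0 <= PSeries c x).
  { intros c Hc Hp. rewrite <- (PSeries_const_0 x). unfold PSeries.
    apply Series_le.
    - intros n. rewrite Rmult_0_l. split; [lra|]. apply Rmult_le_pos; [left; apply Hp|now apply pow_le].
    - apply ex_pseries_R, CV_radius_inside. now rewrite Hc. }
  rewrite PSeries_decr_1 by (apply CV_radius_inside; now rewrite Hr).
  assert (H := N (PS_decr_1 a) ltac:(now rewrite CV_radius_decr_1) (fun n => Ha (S n))).
  specialize (Ha 0%nat). assert (0 <= x * PSeries (PS_decr_1 a) x) by now apply Rmult_le_pos. lra.
Qed.

Lemma bess_pos (x : R) : 0 <= x -> 0 < bess x.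
Proof. apply PSeries_pos; [apply bess_radius|apply bess_coef_pos]. Qed.

Lemma bess1_pos (x : R) : 0 <= x -> 0 < bess1 x.
Proof.
  apply PSeries_pos; [rewrite CV_radius_derive; apply bess_radius|].
  intros n. unfold PS_derive. apply Rmult_lt_0_compat; [apply lt_0_INR; lia|apply bess_coef_pos].
Qed.

Lemma bess_ode (x : R) : x * bess2 x + 3 * bess1 x = A * bess x.
Proof.
  unfold bess, bess1, bess2.
  assert (R1 : CV_radius (PS_derive bess_coef) = p_infty) by (rewrite CV_radius_derive; apply bess_radius).
  assert (R2 : CV_radius (PS_derive (PS_derive bess_coef)) = p_infty) by now rewrite CV_radius_derive.
  rewrite <- PSeries_incr_1, <- !PSeries_scal, <- PSeries_plus.
  - apply PSeries_ext. intros n.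
    change (PS_scal A bess_coef n) with (A * bess_coef n). rewrite <- bess_coef_succ.
    destruct n as [|n].
    + change (0 + 3 * (1 * bess_coef 1) = bess_coef 1 * (1 * (1 + 1 + 1))). ring.
    + change (INR (S n) * (INR (S (S n)) * bess_coef (S (S n))) + 3 * (INR (S (S n)) * bess_coef (S (S n))) =
        bess_coef (S (S n)) * (INR (S (S n)) * INR (S n + 3))).
      rewrite plus_INR, !S_INR. simpl INR. ring.
  - apply CV_radius_inside. rewrite CV_radius_incr_1, R2. exact I.
  - apply ex_pseries_scal; [apply Rmult_comm|]. apply CV_radius_inside. now rewrite R1.
Qed.

Definition logder (x : R) : R := bess1 x / bess x.

Lemma logder_pos (x : R) : 0 <= x -> 0 < logder x.
Proof. intros Hx. apply Rdiv_lt_0_compat; [now apply bess1_pos|now apply bess_pos]. Qed.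

Lemma logder_riccati (x : R) : 0 < x ->
  is_derive logder x (A / x - 3 * logder x / x - logder x * logder x).
Proof.
  intros Hx. assert (P := bess_pos x ltac:(lra)).
  assert (D := is_derive_div bess1 bess x _ _ (bess1_derive x) (bess_derive x) ltac:(lra)).
  match type of D with is_derive _ _ ?v => replace (A / x - 3 * logder x / x - logder x * logder x) with v; [exact D|] end.
  unfold logder. assert (E := bess_ode x).
  replace (bess2 x) with ((A * bess x - 3 * bess1 x) / x) by (rewrite <- E; field; lra).
  field. lra.
Qed.

Lemma logder_Sym_remainder (k : nat) :
  Sym k 1 (fun x => logder x - sqrt A * Rpower x (- (1 / 2))).
Proof.
  apply (riccati_Sym A logder HA).
  - intros x Hx. apply logder_pos. lra.
  - exact logder_riccati.
Qed.

Lemma logder_Sym (k : nat) : Sym k (1 / 2) logder.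
Proof.
  apply (Sym_ext _ _ (fun x => (logder x - sqrt A * Rpower x (- (1 / 2))) + sqrt A * Rpower x (- (1 / 2)))).
  - exists 0. intros; ring.
  - apply Sym_plus.
    + apply (Sym_weaken _ 1); [lra|apply logder_Sym_remainder].
    + apply Sym_scal. rewrite <- (Ropp_involutive (1 / 2)) at 1. apply Sym_power.
Qed.

Lemma logder_bounds :
  ev (fun x => sqrt A / 2 * Rpower x (- (1 / 2)) <= logder x <= 2 * sqrt A * Rpower x (- (1 / 2))).
Proof.
  assert (HsA : 0 < sqrt A) by now apply sqrt_lt_R0.
  destruct (Sym_bigO 0 _ _ (logder_Sym_remainder 0)) as [C [HC H]].
  assert (S := Rpower_small (1 / 2) (sqrt A / (2 * C)) ltac:(lra) ltac:(apply Rdiv_lt_0_compat; lra)).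
  apply (ev_imp _ _ (ev_and _ _ H (ev_and _ _ S (ev_ge 1)))). intros x [E [Q Hx]].
  replace (- (1)) with (- (1 / 2) + - (1 / 2)) in E by field. rewrite Rpower_plus in E.
  assert (P := Rpower_pos x (- (1 / 2))). set (r := Rpower x (- (1 / 2))) in *.
  assert (C * r <= sqrt A / 2).
  { apply Rle_trans with (C * (sqrt A / (2 * C))); [apply Rmult_le_compat_l; lra|right; field; lra]. }
  assert (C * (r * r) <= sqrt A / 2 * r) by nra.
  apply Rabs_le_between in E. nra.
Qed.

Lemma ln_bess_derive (x : R) : 0 <= x -> is_derive (fun t => ln (bess t)) x (logder x).
Proof.
  intros Hx. replace (logder x) with (scal (bess1 x) (/ bess x)) by (unfold logder, Rdiv; reflexivity).
  apply (is_derive_comp ln bess); [|apply bess_derive].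
  apply is_derive_ln. now apply bess_pos.
Qed.

Lemma bess_incr (x y : R) : 0 <= x <= y -> bess x <= bess y.
Proof.
  intros Hxy. destruct (ex_MVT bess bess1 x y) as [c [Hc E]]; [lra|intros; apply bess_derive|].
  assert (P := bess1_pos c ltac:(lra)). nra.
Qed.

(** Between x / 2 and x the logarithmic derivative stays within constant multiples of x^(-1/2), so
    log F changes by about y x^(-1/2) over a distance y. *)
Lemma bess_ratio :
  ev (fun x => forall y, 0 <= y <= x / 2 ->
    bess x * exp (- (4 * sqrt A) * y * Rpower x (- (1 / 2))) <= bess (x - y) <=
    bess x * exp (- (sqrt A / 2) * y * Rpower x (- (1 / 2)))).
Proof.
  assert (HsA : 0 < sqrt A) by now apply sqrt_lt_R0.
  apply (ev_imp _ _ (ev_and _ _ (ev_half _ logder_bounds) (ev_ge 1))). intros x [B Hx] y Hy.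
  destruct (ex_MVT (fun t => ln (bess t)) logder (x - y) x) as [c [Hc E]];
    [lra|intros; apply ln_bess_derive; lra|].
  replace (x - (x - y)) with y in E by ring.
  destruct (B c ltac:(lra)) as [B1 B2].
  assert (R1 : Rpower x (- (1 / 2)) <= Rpower c (- (1 / 2))) by (apply Rpower_le_neg; lra).
  assert (R2 : Rpower c (- (1 / 2)) <= 2 * Rpower x (- (1 / 2))).
  { eapply Rle_trans; [apply (Rpower_comparable x c); lra|].
    apply Rmult_le_compat_r; [left; apply Rpower_pos|].
    apply Rle_trans with (Rpower 2 1); [|rewrite Rpower_1; lra].
    apply Rle_Rpower; [lra|]. rewrite Rabs_Ropp, Rabs_pos_eq; lra. }
  set (r := Rpower x (- (1 / 2))) in *. assert (Hr : 0 < r) by apply Rpower_pos.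
  assert (L1 : sqrt A / 2 * r <= logder c) by nra.
  assert (L2 : logder c <= 4 * sqrt A * r) by nra.
  assert (Pxy := bess_pos (x - y) ltac:(lra)). assert (Px := bess_pos x ltac:(lra)).
  assert (F : bess (x - y) = bess x * exp (- (logder c * y))).
  { rewrite <- (exp_ln (bess x)) by exact Px. rewrite <- exp_plus.
    replace (ln (bess x) + - (logder c * y)) with (ln (bess (x - y))) by lra.
    now rewrite exp_ln. }
  rewrite F. split; apply Rmult_le_compat_l; try lra.
  - destruct (Req_dec (- (4 * sqrt A) * y * r) (- (logder c * y))) as [->|Hne]; [lra|].
    left. apply exp_increasing. assert (logder c * y <= 4 * sqrt A * r * y) by (apply Rmult_le_compat_r; lra). lra.
  - destruct (Req_dec (- (logder c * y)) (- (sqrt A / 2) * y * r)) as [->|Hne]; [lra|].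
    left. apply exp_increasing. assert (sqrt A / 2 * r * y <= logder c * y) by (apply Rmult_le_compat_r; lra). lra.
Qed.
End Bessel.

(** * The summation functional *)

(** With x = X^8 the decay rate x^(-1/2) of F becomes X^(-4) and the cut x^(5/8) becomes X^5, so
    that all later exponents are natural numbers. *)
Lemma ev_pow8 (P : R -> Prop) : ev P -> ev (fun X => P (X ^ 8)).
Proof.
  intros [x0 H]. exists (Rmax x0 1). intros X HX. apply H.
  assert (H1 := Rmax_l x0 1). assert (H2 := Rmax_r x0 1).
  apply Rle_trans with (X ^ 1); [simpl; lra|]. apply Rle_pow; [lra|lia].
Qed.

Lemma ev_inv_small (C e : R) (M : nat) : 0 < e -> ev (fun X => C / X ^ S M <= e).
Proof.
  intros He. exists (Rmax (Rabs C / e) 1). intros X HX.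
  assert (H1 := Rmax_l (Rabs C / e) 1). assert (H2 := Rmax_r (Rabs C / e) 1).
  assert (P : X <= X ^ S M).
  { apply Rle_trans with (X ^ 1); [simpl; lra|]. apply Rle_pow; [lra|lia]. }
  assert (P0 : 0 < X ^ S M) by lra.
  apply Rmult_le_reg_r with (X ^ S M); [exact P0|].
  unfold Rdiv. rewrite Rmult_assoc, Rinv_l, Rmult_1_r by lra.
  apply Rle_trans with (Rabs C); [apply Rle_abs|].
  apply Rle_trans with (e * (Rabs C / e)); [right; field; lra|].
  apply Rmult_le_compat_l; lra.
Qed.

Lemma Rpower_pow8 (X a : R) (n : nat) : 0 < X -> a = - (INR n / 8) -> Rpower (X ^ 8) a = / X ^ n.
Proof.
  intros HX ->. rewrite <- (Rpower_pow 8 X HX), Rpower_mult.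
  replace (INR 8 * - (INR n / 8)) with (- INR n) by (simpl; field).
  now rewrite Rpower_Ropp, Rpower_pow.
Qed.

Lemma div_pow_mono (X : R) (m n : nat) : 1 <= X -> (m <= n)%nat -> / X ^ n <= / X ^ m.
Proof.
  intros HX H. apply Rinv_le_contravar; [apply pow_lt; lra|]. now apply Rle_pow.
Qed.

Lemma rate_pos (k : nat) : 0 < rate k.
Proof.
  unfold rate. assert (P := pos_INR k). assert (Q := PI_RGT_0).
  apply Rdiv_lt_0_compat; [|lra]. apply Rmult_lt_0_compat; [now apply pow_lt|lra].
Qed.

Definition cont (f : R -> R) : Prop := forall y, continuous f y.

Lemma cont_plus (f g : R -> R) : cont f -> cont g -> cont (fun y => f y + g y).
Proof. intros F G y. exact (continuous_plus f g y (F y) (G y)). Qed.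

Lemma cont_mult (f g : R -> R) : cont f -> cont g -> cont (fun y => f y * g y).
Proof. intros F G y. exact (continuous_mult f g y (F y) (G y)). Qed.

Lemma cont_const (c : R) : cont (fun _ => c).
Proof. intros y. apply continuous_const. Qed.

Lemma cont_derive (f f' : R -> R) : (forall y, is_derive f y (f' y)) -> cont f.
Proof. intros H y. apply (ex_derive_continuous f). exists (f' y). apply H. Qed.

Lemma cont_exp (u : R) : cont (fun y => exp (- (u * y))).
Proof.
  apply (cont_derive _ (fun y => - u * exp (- (u * y)))). intros y.
  auto_derive; [exact I|ring].
Qed.

Lemma cont_pow (i : nat) : cont (fun y => y ^ i).
Proof.
  apply (cont_derive _ (fun y => INR i * y ^ pred i)). intros y. auto_derive; [exact I|ring].
Qed.

Lemma cont_ext (f g : R -> R) : (forall y, f y = g y) -> cont f -> cont g.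
Proof. intros E F y. apply (continuous_ext f); auto. Qed.

Section Functional.
Variable k : nat.

(** The deviation of the weighted sum from its main part. For f(y) = e^(- u y) and infinite J the
    main part is A / u^2 - 1 / u - B, exactly the expansion of [weight_sum], so [Lam] nearly
    annihilates exponentials. *)
Definition Lam (J : nat) (f : R -> R) : R :=
  rsum (fun j => weight k j * f (INR j)) 1 J
  - RInt (fun y => (rate k * y - 1) * f y) 0 (INR J) + offset k * f 0.

Lemma Lam_ex_RInt (f : R -> R) (a b : R) : cont f ->
  ex_RInt (fun y => (rate k * y - 1) * f y) a b.
Proof.
  intros F. apply (ex_RInt_continuous (V := R_CompleteNormedModule)). intros y _.
  apply (cont_mult (fun y => rate k * y - 1) f); [|exact F].
  apply (cont_derive _ (fun _ => rate k)). intros z. auto_derive; [exact I|ring].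
Qed.

Lemma Lam_plus (J : nat) (f g : R -> R) : cont f -> cont g ->
  Lam J (fun y => f y + g y) = Lam J f + Lam J g.
Proof.
  intros F G. unfold Lam.
  rewrite (RInt_ext (fun y => (rate k * y - 1) * (f y + g y))
    (fun y => plus ((rate k * y - 1) * f y) ((rate k * y - 1) * g y))).
  - rewrite (RInt_plus (V := R_CompleteNormedModule)) by now apply Lam_ex_RInt. unfold plus; simpl.
    rewrite (rsum_ext _ (fun j => weight k j * f (INR j) + weight k j * g (INR j))) by (intros; ring).
    rewrite rsum_plus. ring.
  - intros y _. unfold plus; simpl. ring.
Qed.

Lemma Lam_scal (J : nat) (c : R) (f : R -> R) : cont f ->
  Lam J (fun y => c * f y) = c * Lam J f.
Proof.
  intros F. unfold Lam.
  rewrite (RInt_ext (fun y => (rate k * y - 1) * (c * f y))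
    (fun y => scal c ((rate k * y - 1) * f y))).
  - rewrite (RInt_scal (V := R_CompleteNormedModule)) by now apply Lam_ex_RInt. unfold scal; simpl. unfold mult; simpl.
    rewrite (rsum_ext _ (fun j => c * (weight k j * f (INR j)))) by (intros; ring).
    rewrite rsum_scal. ring.
  - intros y _. unfold scal; simpl. unfold mult; simpl. ring.
Qed.

Lemma Lam_ext (J : nat) (f g : R -> R) : (forall y, f y = g y) -> Lam J f = Lam J g.
Proof.
  intros E. unfold Lam. rewrite E. f_equal. f_equal.
  - apply rsum_ext. intros; now rewrite E.
  - apply RInt_ext. intros y _. now rewrite E.
Qed.

(** Longer than the decay length X^4 of F by a factor X, so that the discarded part is exponentially
    small in X; shorter than X^6, where the quadratic term of log F(x - y) stops being small. *)
Definition window (J : nat) (X : R) : Prop := X ^ 5 / 2 <= INR J <= X ^ 5.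

Definition Lam_norm : R := 4 + rate k + 1 + Rabs (offset k).

(** Up to X^5 weights of size at most 4 X^10 produce the factor X^15. As the loss is polynomial, it
    is compensated by asking for smaller remainders. *)
Lemma Lam_bound (X : R) (J : nat) (f : R -> R) (m : R) :
  1 <= X -> window J X -> cont f -> 0 <= m ->
  (forall y, 0 <= y <= INR J -> Rabs (f y) <= m) ->
  Rabs (Lam J f) <= Lam_norm * X ^ 15 * m.
Proof.
  intros HX [HJ0 HJ] F Hm H. assert (J0 := pos_INR J). assert (A0 := rate_pos k).
  assert (X5 : 1 <= X ^ 5) by (apply pow_R1_Rle; lra).
  assert (E15 : X ^ 15 = X ^ 5 * X ^ 5 * X ^ 5) by ring.
  assert (S1 : Rabs (rsum (fun j => weight k j * f (INR j)) 1 J) <= 4 * X ^ 15 * m).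
  { eapply Rle_trans; [apply rsum_abs|].
    apply Rle_trans with (rsum (fun _ => 4 * (X ^ 5 * X ^ 5) * m) 1 J).
    - apply rsum_le. intros j Hj. rewrite Rabs_mult.
      assert (Hj' : INR j <= X ^ 5) by (apply Rle_trans with (INR J); [apply le_INR; lia|exact HJ]).
      assert (W1 := weight_lower k j). assert (W2 := weight_upper k j). assert (P := pos_INR j).
      apply Rmult_le_compat; try apply Rabs_pos.
      + rewrite Rabs_pos_eq by lra. eapply Rle_trans; [exact W2|].
        apply Rmult_le_compat_l; [lra|]. apply Rmult_le_compat; lra.
      + apply H. split; [exact P|apply le_INR; lia].
    - rewrite rsum_const, E15.
      apply Rle_trans with (X ^ 5 * (4 * (X ^ 5 * X ^ 5) * m)); [|right; ring].
      apply Rmult_le_compat_r; [|exact HJ]. apply Rmult_le_pos; [|exact Hm]. nra. }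
  assert (S2 : Rabs (RInt (fun y => (rate k * y - 1) * f y) 0 (INR J)) <= (rate k + 1) * X ^ 15 * m).
  { apply Rle_trans with ((INR J - 0) * ((rate k * X ^ 5 + 1) * m)).
    - apply abs_RInt_le_const; [exact J0|now apply Lam_ex_RInt|].
      intros y Hy. rewrite Rabs_mult. apply Rmult_le_compat; try apply Rabs_pos; [|now apply H].
      assert (0 <= rate k * y <= rate k * X ^ 5) by (split; [apply Rmult_le_pos|apply Rmult_le_compat_l]; lra).
      apply Rabs_le. lra.
    - rewrite Rminus_0_r, E15.
      apply Rle_trans with (X ^ 5 * ((rate k * X ^ 5 + 1) * m)).
      + apply Rmult_le_compat_r; [|exact HJ]. apply Rmult_le_pos; [|exact Hm].
        assert (0 <= rate k * X ^ 5) by (apply Rmult_le_pos; lra). lra.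
      + rewrite <- Rmult_assoc. apply Rmult_le_compat_r; [exact Hm|].
        set (t := X ^ 5) in *. assert (T1 : t <= t * t) by nra. assert (T2 : t * t <= t * t * t) by nra.
        replace (t * (rate k * t + 1)) with (rate k * (t * t) + t) by ring.
        assert (rate k * (t * t) <= rate k * (t * t * t)) by (apply Rmult_le_compat_l; lra). lra. }
  assert (S3 : Rabs (offset k * f 0) <= Rabs (offset k) * X ^ 15 * m).
  { rewrite Rabs_mult, Rmult_assoc. apply Rmult_le_compat_l; [apply Rabs_pos|].
    eapply Rle_trans; [apply H; lra|]. assert (1 <= X ^ 15) by (apply pow_R1_Rle; lra). nra. }
  unfold Lam, Lam_norm.
  apply Rabs_le_between in S1, S2, S3. apply Rabs_le. lra.
Qed.

Definition range (a b u X : R) : Prop := a / X ^ 4 <= u <= b / X ^ 4.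

(** Of the bound (j u)^(q+4) e^(- j u) <= (q+4)!, the powers of j serve three purposes: two cancel
    the growth of the weight, q are replaced by J^q, and two remain to make the sum over j
    converge. *)
Lemma weight_sum_tail (u : R) (J q : nat) : 0 < u -> (1 <= J)%nat ->
  Rabs (weight_sum k u - rsum (fun n => weight k n * exp (- (INR n * u))) 1 J) <=
  12 * INR (fact (q + 4)) / (u ^ (q + 4) * INR J ^ q).
Proof.
  intros Hu HJ. set (f := fun n => weight k n * exp (- (INR n * u))).
  assert (HJ0 : 0 < INR J) by (apply lt_0_INR; lia).
  assert (Uq : 0 < u ^ (q + 4)) by now apply pow_lt.
  assert (Jq : 0 < INR J ^ q) by now apply pow_lt.
  assert (F := INR_fact_lt_0 (q + 4)).
  set (c := 4 * INR (fact (q + 4)) / (u ^ (q + 4) * INR J ^ q)).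
  assert (Hc : 0 < c) by (apply Rdiv_lt_0_compat; [|apply Rmult_lt_0_compat]; lra).
  assert (Hf : forall j, (J < j)%nat -> 0 <= f j <= c * / (INR j)²).
  { intros j Hj. unfold f. assert (Pj : 0 < INR j) by (apply lt_0_INR; lia).
    assert (W1 := weight_lower k j). assert (W2 := weight_upper k j).
    assert (Ex := exp_pos (- (INR j * u))). split; [apply Rmult_le_pos; lra|].
    apply Rle_trans with (4 * (INR j * INR j) * exp (- (INR j * u))); [apply Rmult_le_compat_r; lra|].
    assert (B := pow_exp_bound (INR j * u) (q + 4) ltac:(left; now apply Rmult_lt_0_compat)).
    rewrite Rpow_mult_distr, (pow_add (INR j)) in B.
    assert (Jj : INR J ^ q <= INR j ^ q) by (apply pow_incr; split; [lra|apply le_INR; lia]).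
    assert (P2 : 0 < (INR j)²) by (apply Rsqr_pos_lt; lra).
    apply Rmult_le_reg_r with ((INR j)² * (u ^ (q + 4) * INR J ^ q)).
    { apply Rmult_lt_0_compat; [exact P2|now apply Rmult_lt_0_compat]. }
    unfold c. replace (4 * INR (fact (q + 4)) / (u ^ (q + 4) * INR J ^ q) * / (INR j)² * ((INR j)² * (u ^ (q + 4) * INR J ^ q)))
      with (4 * INR (fact (q + 4))) by (field; repeat split; lra).
    apply Rle_trans with (4 * (INR j ^ q * INR j ^ 4 * u ^ (q + 4) * exp (- (INR j * u)))); [|lra].
    replace (4 * (INR j * INR j) * exp (- (INR j * u)) * ((INR j)² * (u ^ (q + 4) * INR J ^ q))) with
      (4 * (INR J ^ q * (INR j ^ 4 * u ^ (q + 4) * exp (- (INR j * u))))) by (unfold Rsqr; ring).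
    apply Rmult_le_compat_l; [lra|]. rewrite !Rmult_assoc. apply Rmult_le_compat_r; [|exact Jj].
    apply Rmult_le_pos; [apply pow_le; lra|]. apply Rmult_le_pos; lra. }
  assert (Z : forall N, zeta2_partial N <= 3).
  { intros N. apply Rle_trans with (PI ^ 2 / 6).
    - apply (is_lim_seq_incr_compare _ _ zeta2_lim). intros n. unfold zeta2_partial. cbn [rsum].
      assert (0 < / (INR (1 + n))²); [|lra]. apply Rinv_0_lt_compat, Rsqr_pos_lt, not_0_INR. lia.
    - assert (P := PI_4). assert (P0 := PI_RGT_0). simpl. nra. }
  assert (T : forall N, 0 <= rsum f (1 + J) N <= 3 * c).
  { intros N. split.
    - apply rsum_pos. intros i Hi. apply Hf. lia.
    - apply Rle_trans with (rsum (fun j => c * / (INR j)²) (1 + J) N).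
      + apply rsum_le. intros i Hi. apply Hf. lia.
      + rewrite rsum_scal, (Rmult_comm 3). apply Rmult_le_compat_l; [lra|].
        apply Rle_trans with (zeta2_partial (J + N)); [|apply Z].
        unfold zeta2_partial. rewrite rsum_split.
        assert (0 <= rsum (fun m => / (INR m)²) 1 J); [|lra].
        apply rsum_pos. intros i Hi. left. apply Rinv_0_lt_compat, Rsqr_pos_lt, not_0_INR. lia. }
  assert (L := weight_sum_lim k u Hu). apply (is_lim_seq_incr_n _ J) in L.
  replace (12 * INR (fact (q + 4)) / (u ^ (q + 4) * INR J ^ q)) with (3 * c) by (unfold c; field; lra).
  assert (E : forall N, rsum f 1 (N + J) = rsum f 1 J + rsum f (1 + J) N).
  { intros N. rewrite Nat.add_comm. apply rsum_split. }
  fold f in L. apply Rabs_le. split.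
  - assert (H : Rbar_le (rsum f 1 J) (weight_sum k u)).
    { apply (is_lim_seq_le (fun _ => rsum f 1 J) (fun N => rsum f 1 (N + J))); [|apply is_lim_seq_const|exact L].
      intros N. rewrite E. specialize (T N). lra. }
    simpl in H. lra.
  - assert (H : Rbar_le (weight_sum k u) (rsum f 1 J + 3 * c)).
    { apply (is_lim_seq_le (fun N => rsum f 1 (N + J)) (fun _ => rsum f 1 J + 3 * c)); [|exact L|apply is_lim_seq_const].
      intros N. rewrite E. specialize (T N). lra. }
    simpl in H. lra.
Qed.

Lemma RInt_linear_exp (A u z : R) : u <> 0 ->
  RInt (fun y => (A * y - 1) * exp (- (u * y))) 0 z =
  (A / u ^ 2 - 1 / u) - exp (- (u * z)) * ((A * z - 1) / u + A / u ^ 2).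
Proof.
  intros Hu. set (V := fun y => - (exp (- (u * y)) * ((A * y - 1) / u + A / u ^ 2))).
  replace (A / u ^ 2 - 1 / u - exp (- (u * z)) * ((A * z - 1) / u + A / u ^ 2)) with (minus (V z) (V 0)).
  - apply is_RInt_unique. apply (is_RInt_derive (V := R_CompleteNormedModule)).
    + intros y _. unfold V. auto_derive; [exact I|]. field. exact Hu.
    + intros y _. apply (cont_mult (fun y => A * y - 1) (fun y => exp (- (u * y)))); [|apply cont_exp].
      apply (cont_derive _ (fun _ => A)). intros t. auto_derive; [exact I|ring].
  - unfold V, minus, plus, opp; simpl. rewrite Rmult_0_r, Ropp_0, exp_0. field. exact Hu.
Qed.

(** There are three errors: the tail of the series beyond J, the remainder of
    [weight_sum_asymptotic] at u of order X^(-4), and the boundary term of the integral at J, which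
    carries e^(- u J) with u J at least a X / 2. *)
Lemma Lam_exp (a b : R) (M : nat) : 0 < a -> a < b ->
  exists C, 0 <= C /\ ev (fun X => forall J u, window J X -> range a b u X ->
    Rabs (Lam J (fun y => exp (- (u * y)))) <= C / X ^ M).
Proof.
  intros Ha Hab. assert (A0 := rate_pos k).
  destruct (weight_sum_asymptotic k M) as [C1 [u0 [HC1 [Hu0 H1]]]].
  (* The choice of [q] makes u^(q+4) J^q of order X^(5q - 4(q+4)) = X^M. The extra 9 in [p] pays for
     the factor J / u of order X^9 in the boundary term. *)
  set (q := (M + 16)%nat). set (p := (M + 9)%nat).
  set (C2 := 12 * INR (fact (q + 4)) / (a ^ (q + 4) * (/ 2) ^ q)).
  set (C3 := INR (fact p) / (a / 2) ^ p * ((rate k + 1) / a + rate k / a ^ 2)).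
  assert (F1 := INR_fact_lt_0 (q + 4)). assert (F2 := INR_fact_lt_0 p).
  assert (D1 : 0 < a ^ (q + 4) * (/ 2) ^ q) by (apply Rmult_lt_0_compat; apply pow_lt; lra).
  assert (D2 : 0 < (a / 2) ^ p) by (apply pow_lt; lra).
  assert (D3 : 0 < (rate k + 1) / a + rate k / a ^ 2).
  { assert (0 < (rate k + 1) / a) by (apply Rdiv_lt_0_compat; lra).
    assert (0 < rate k / a ^ 2) by (apply Rdiv_lt_0_compat; [lra|apply pow_lt; lra]). lra. }
  assert (P2 : 0 < C2) by (apply Rdiv_lt_0_compat; lra).
  assert (P3 : 0 < C3) by (apply Rmult_lt_0_compat; [apply Rdiv_lt_0_compat|]; lra).
  assert (Pb : 0 <= C1 * b ^ M) by (apply Rmult_le_pos; [lra|apply pow_le; lra]).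
  exists (C2 + C1 * b ^ M + C3). split; [lra|].
  apply (ev_imp _ _ (ev_and _ _ (ev_inv_small b u0 3 Hu0) (ev_ge 2))).
  intros X [Hbu HX] J u [HJ1 HJ2] [Hu1 Hu2].
  assert (X4 : 0 < X ^ 4) by (apply pow_lt; lra).
  assert (X5 : 32 <= X ^ 5) by (replace 32 with (2 ^ 5) by ring; apply pow_incr; lra).
  assert (XM : 0 < X ^ M) by (apply pow_lt; lra).
  assert (Ua : 0 < a / X ^ 4) by now apply Rdiv_lt_0_compat.
  assert (Hu : 0 < u) by lra.
  assert (HJ : (1 <= J)%nat) by (apply INR_le; simpl; lra).
  unfold Lam. rewrite (rsum_ext (fun j => weight k j * exp (- (u * INR j))) (fun n => weight k n * exp (- (INR n * u))))
    by (intros; rewrite (Rmult_comm u); reflexivity).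
  rewrite RInt_linear_exp, Rmult_0_r, Ropp_0, exp_0, Rmult_1_r by lra.
  assert (T1 := weight_sum_tail u J q Hu HJ).
  assert (T2 := H1 u ltac:(lra)).
  set (S := rsum (fun n => weight k n * exp (- (INR n * u))) 1 J) in *.
  set (T := exp (- (u * INR J)) * ((rate k * INR J - 1) / u + rate k / u ^ 2)).
  replace (S - (rate k / u ^ 2 - 1 / u - T) + offset k) with
    (- (weight_sum k u - S) + (weight_sum k u - (rate k / u ^ 2 - 1 / u - offset k)) + T) by ring.
  assert (B1 : 12 * INR (fact (q + 4)) / (u ^ (q + 4) * INR J ^ q) <= C2 / X ^ M).
  { unfold C2. unfold Rdiv. rewrite (Rmult_assoc (12 * _) _ (/ X ^ M)), <- Rinv_mult.
    apply Rmult_le_compat_l; [lra|]. apply Rinv_le_contravar; [now apply Rmult_lt_0_compat|].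
    assert (E1 : a ^ (q + 4) * (/ 2) ^ q * X ^ M = (a / X ^ 4) ^ (q + 4) * (X ^ 5 / 2) ^ q).
    { unfold Rdiv. rewrite !Rpow_mult_distr, !pow_inv, <- !pow_mult.
      replace (5 * q)%nat with (4 * (q + 4) + M)%nat by (unfold q; lia). rewrite (pow_add X (4 * (q + 4)) M). field.
      repeat split; try lra; apply pow_nonzero; lra. }
    rewrite E1. apply Rmult_le_compat; try (apply pow_le; lra); apply pow_incr; lra. }
  assert (B2 : C1 * u ^ M <= C1 * b ^ M / X ^ M).
  { unfold Rdiv. rewrite Rmult_assoc. apply Rmult_le_compat_l; [exact HC1|].
    apply Rle_trans with ((b / X ^ 4) ^ M); [apply pow_incr; lra|].
    unfold Rdiv. rewrite Rpow_mult_distr. apply Rmult_le_compat_l; [apply pow_le; lra|].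
    rewrite pow_inv, <- pow_mult. apply div_pow_mono; [lra|lia]. }
  assert (B3 : Rabs T <= C3 / X ^ M).
  { assert (Hge : a * X / 2 <= u * INR J).
    { apply Rle_trans with (a / X ^ 4 * (X ^ 5 / 2)); [right; field; lra|]. apply Rmult_le_compat; lra. }
    assert (HaX : 0 < a * X / 2) by (apply Rdiv_lt_0_compat; [apply Rmult_lt_0_compat|]; lra).
    assert (Q1 : exp (- (u * INR J)) <= INR (fact p) / (a / 2) ^ p / X ^ p).
    { assert (Bd := pow_exp_bound (u * INR J) p ltac:(lra)).
      assert (Hp : (a / 2) ^ p * X ^ p <= (u * INR J) ^ p).
      { rewrite <- Rpow_mult_distr. apply pow_incr. lra. }
      assert (XP : 0 < X ^ p) by (apply pow_lt; lra).
      apply Rmult_le_reg_r with ((a / 2) ^ p * X ^ p); [now apply Rmult_lt_0_compat|].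
      replace (INR (fact p) / (a / 2) ^ p / X ^ p * ((a / 2) ^ p * X ^ p)) with (INR (fact p)) by (field; lra).
      eapply Rle_trans; [|exact Bd]. rewrite Rmult_comm. apply Rmult_le_compat_r; [left; apply exp_pos|exact Hp]. }
    assert (Iu : / u <= X ^ 4 / a).
    { replace (X ^ 4 / a) with (/ (a / X ^ 4)) by (field; lra). now apply Rinv_le_contravar. }
    assert (Iu0 : 0 < / u) by now apply Rinv_0_lt_compat.
    assert (Q2 : Rabs ((rate k * INR J - 1) / u + rate k / u ^ 2) <= ((rate k + 1) / a + rate k / a ^ 2) * X ^ 9).
    { assert (X9 : X ^ 8 <= X ^ 9) by (apply Rle_pow; [lra|lia]).
      eapply Rle_trans; [apply Rabs_triang|]. rewrite Rmult_plus_distr_r. apply Rplus_le_compat.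
      - unfold Rdiv. rewrite Rabs_mult, (Rabs_pos_eq (/ u)) by lra.
        replace ((rate k + 1) * / a * X ^ 9) with (((rate k + 1) * X ^ 5) * (X ^ 4 / a)) by (field; lra).
        apply Rmult_le_compat; [apply Rabs_pos|lra| |exact Iu].
        assert (0 <= rate k * INR J <= rate k * X ^ 5) by (split; [apply Rmult_le_pos|apply Rmult_le_compat_l]; lra).
        apply Rabs_le. lra.
      - replace (rate k / u ^ 2) with (rate k * (/ u * / u)) by (field; lra).
        rewrite Rabs_pos_eq by (apply Rmult_le_pos; [lra|apply Rmult_le_pos; lra]).
        unfold Rdiv. rewrite Rmult_assoc. apply Rmult_le_compat_l; [lra|].
        apply Rle_trans with ((X ^ 4 / a) * (X ^ 4 / a)); [apply Rmult_le_compat; lra|].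
        replace (X ^ 4 / a * (X ^ 4 / a)) with (/ a ^ 2 * X ^ 8) by (field; lra).
        apply Rmult_le_compat_l; [left; apply Rinv_0_lt_compat, pow_lt; lra|exact X9]. }
    unfold T. rewrite Rabs_mult, (Rabs_pos_eq (exp _)) by (left; apply exp_pos).
    apply Rle_trans with (INR (fact p) / (a / 2) ^ p / X ^ p * (((rate k + 1) / a + rate k / a ^ 2) * X ^ 9)).
    + apply Rmult_le_compat; [left; apply exp_pos|apply Rabs_pos|exact Q1|exact Q2].
    + unfold C3. unfold p at 3. rewrite (pow_add X). right. field. repeat split; try lra. }
  replace ((C2 + C1 * b ^ M + C3) / X ^ M) with (C2 / X ^ M + C1 * b ^ M / X ^ M + C3 / X ^ M) by (field; lra).
  apply Rabs_le_between in T1, T2, B3. apply Rabs_le. lra.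
Qed.
End Functional.

Lemma exp_second_order (t : R) : 0 <= t -> Rabs (exp (- t) - 1 + t) <= t ^ 2.
Proof.
  intros Ht.
  destruct (ex_MVT (fun t => exp (- t) - 1 + t) (fun t => 1 - exp (- t)) 0 t) as [c [Hc E]]; [lra| |].
  - intros x _. auto_derive; [exact I|ring].
  - cbv beta in E. rewrite Ropp_0, exp_0, Rminus_0_r in E.
    replace (exp (- t) - 1 + t - (1 - 1 + 0)) with (exp (- t) - 1 + t) in E by ring.
    assert (E1 := exp_ineq1_le (- c)).
    assert (E2 : exp (- c) <= 1) by (rewrite <- exp_0; apply exp_le; lra).
    rewrite E, Rabs_mult, !Rabs_pos_eq by lra. simpl. nra.
Qed.

Lemma exp_taylor (n : nat) (t : R) : Rabs t <= 1 ->
  Rabs (exp t - rsum (fun i => / INR (fact i) * t ^ i) 0 n) <= 3 * Rabs t ^ n.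
Proof.
  revert t. induction n as [|n IH]; intros t Ht.
  - simpl. rewrite Rminus_0_r, Rmult_1_r, Rabs_pos_eq by (left; apply exp_pos).
    apply Rle_trans with (exp 1); [|apply exp_le_3]. apply exp_le. apply Rabs_le_between in Ht. lra.
  - set (g := fun n t => exp t - rsum (fun i => / INR (fact i) * t ^ i) 0 n).
    assert (D : forall z, is_derive (g (S n)) z (g n z)).
    { intros z. unfold g. apply is_derive_Rminus; [apply is_derive_Reals, derivable_pt_lim_exp|].
      replace (rsum (fun i => / INR (fact i) * z ^ i) 0 n) with
        (rsum (fun i => / INR (fact i) * (INR i * z ^ pred i)) 0 (S n)).
      - apply (is_derive_rsum (fun i t => / INR (fact i) * t ^ i) (fun i t => / INR (fact i) * (INR i * t ^ pred i))).
        intros i _. auto_derive; [exact I|ring].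
      - rewrite rsum_first, (rsum_shift _ 0 1 n). simpl (INR 0). rewrite Rmult_0_l, Rmult_0_r, Rplus_0_l.
        apply rsum_ext. intros i _. change (1 + i)%nat with (S i). change (pred (S i)) with i.
        change (fact (S i)) with (S i * fact i)%nat. rewrite mult_INR.
        assert (P1 := INR_fact_lt_0 i). assert (P2 : 0 < INR (S i)) by (apply lt_0_INR; lia).
        field. lra. }
    destruct (MVT_cor4 (g (S n)) (g n) 0 (Rabs t) (fun c _ => D c) t) as [c [Ec Hc]];
      [rewrite Rminus_0_r; lra|].
    rewrite !Rminus_0_r in Hc.
    assert (G0 : g (S n) 0 = 0).
    { unfold g. rewrite rsum_first, exp_0, rsum_zero; [simpl; field|].
      intros i Hi. rewrite pow_ne_zero by lia. ring. }
    rewrite G0, !Rminus_0_r in Ec. change (Rabs (g (S n) t) <= 3 * Rabs t ^ S n). rewrite Ec, Rabs_mult.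
    assert (B : Rabs (g n c) <= 3 * Rabs c ^ n) by (apply IH; lra).
    assert (P : Rabs c ^ n <= Rabs t ^ n) by (apply pow_incr; split; [apply Rabs_pos|exact Hc]).
    simpl. assert (T := Rabs_pos t).
    apply Rle_trans with (3 * Rabs t ^ n * Rabs t); [apply Rmult_le_compat_r; lra|right; ring].
Qed.

Lemma exp_lipschitz (a b : R) : a <= 1 -> b <= 1 -> Rabs (exp a - exp b) <= 3 * Rabs (a - b).
Proof.
  assert (L : forall a b, a <= b -> b <= 1 -> Rabs (exp a - exp b) <= 3 * Rabs (a - b)).
  { clear a b. intros a b Hab Hb. rewrite Rabs_minus_sym, (Rabs_minus_sym a).
    destruct (ex_MVT exp exp a b Hab) as [c [Hc E]].
    { intros x _. apply is_derive_Reals, derivable_pt_lim_exp. }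
    rewrite E, Rabs_mult. apply Rmult_le_compat_r; [apply Rabs_pos|].
    rewrite Rabs_pos_eq by (left; apply exp_pos).
    apply Rle_trans with (exp 1); [|apply exp_le_3]. apply exp_le. lra. }
  intros Ha Hb. destruct (Rle_dec a b); [now apply L|].
  rewrite Rabs_minus_sym, (Rabs_minus_sym a). apply L; lra.
Qed.

Ltac cont_tac := repeat first
  [ apply cont_const | apply cont_exp | apply cont_pow | assumption | apply cont_plus | apply cont_mult ].

Section Functional.
Variable k : nat.

Lemma Lam_norm_pos : 0 < Lam_norm k.
Proof.
  unfold Lam_norm. assert (A := rate_pos k). assert (B := Rabs_pos (offset k)). lra.
Qed.

Lemma cont_pow_exp (i : nat) (u : R) : cont (fun y => y ^ i * exp (- (u * y))).
Proof. apply cont_mult; [apply cont_pow|apply cont_exp]. Qed.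

(* Differencing in [u] gains one power of [y]. *)
Lemma Lam_pow_exp (i : nat) : forall (a b : R) (M : nat), 0 < a -> a < b ->
  exists C, 0 <= C /\ ev (fun X => forall J u, window J X -> range a b u X ->
    Rabs (Lam k J (fun y => y ^ i * exp (- (u * y)))) <= C / X ^ M).
Proof.
  induction i as [|i IH]; intros a b M Ha Hab.
  - destruct (Lam_exp k a b M Ha Hab) as [C [HC H]]. exists C. split; [exact HC|].
    apply (ev_imp _ _ H). intros X HX J u HJ Hu. rewrite <- (Lam_ext k J (fun y => exp (- (u * y)))).
    + now apply HX.
    + intros y. simpl. ring.
  (* The increment of u is d = X^(- D). The second order remainder costs X^15 from [Lam_bound],
     X^(5i) from y^i and X^10 from y^2, so that after division by d it is of order X^(25 + 5i) d =
     X^(- M). *)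
  - set (D := (M + 25 + 5 * i)%nat).
    destruct (IH a (b + 1) (M + D)%nat Ha ltac:(lra)) as [C [HC H]].
    assert (N0 := Lam_norm_pos). exists (2 * C + Lam_norm k). split; [lra|].
    apply (ev_imp _ _ (ev_and _ _ H (ev_ge 1))). intros X [HX X1] J u HJ [Hu1 Hu2].
    set (d := / X ^ D). assert (XD : 0 < X ^ D) by (apply pow_lt; lra).
    assert (Hd : 0 < d) by now apply Rinv_0_lt_compat.
    assert (X4 : 0 < X ^ 4) by (apply pow_lt; lra).
    assert (Hd4 : d <= / X ^ 4) by (apply div_pow_mono; [lra|unfold D; lia]).
    assert (XM : 0 < X ^ M) by (apply pow_lt; lra).
    assert (Eb : (b + 1) / X ^ 4 = b / X ^ 4 + / X ^ 4) by (field; lra).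
    assert (Iu : 0 < / X ^ 4) by now apply Rinv_0_lt_compat.
    assert (Hu0 : 0 < u) by (assert (0 < a / X ^ 4) by (now apply Rdiv_lt_0_compat); lra).
    assert (L1 := HX J u HJ ltac:(split; lra)). assert (L2 := HX J (u + d) HJ ltac:(split; lra)).
    set (R2 := fun y => y ^ i * (exp (- ((u + d) * y)) - exp (- (u * y)) + d * y * exp (- (u * y)))).
    assert (E : Lam k J (fun y => y ^ S i * exp (- (u * y))) =
      / d * (Lam k J (fun y => y ^ i * exp (- (u * y))) + -1 * Lam k J (fun y => y ^ i * exp (- ((u + d) * y))) + Lam k J R2)).
    { assert (CR : cont R2).
      { unfold R2. apply cont_mult; [apply cont_pow|].
        apply (cont_ext (fun y => (exp (- ((u + d) * y)) + -1 * exp (- (u * y))) + d * (y ^ 1 * exp (- (u * y))))).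
        - intros y. simpl. ring.
        - cont_tac. }
      rewrite <- Lam_scal by apply cont_pow_exp.
      rewrite <- Lam_plus by cont_tac.
      rewrite <- Lam_plus by cont_tac.
      rewrite <- Lam_scal.
      - apply Lam_ext. intros y. unfold R2. simpl. field. lra.
      - cont_tac. }
    assert (B : Rabs (Lam k J R2) <= Lam_norm k * X ^ 15 * (X ^ (5 * i) * (X ^ 10 * d ^ 2))).
    { apply Lam_bound; [lra|exact HJ| | |].
      - unfold R2. apply cont_mult; [apply cont_pow|].
        apply (cont_ext (fun y => (exp (- ((u + d) * y)) + -1 * exp (- (u * y))) + d * (y ^ 1 * exp (- (u * y))))).
        + intros y. simpl. ring.
        + cont_tac.
      - apply Rmult_le_pos; [apply pow_le; lra|]. apply Rmult_le_pos; apply pow_le; lra.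
      - intros y Hy. destruct HJ as [_ HJ]. unfold R2. rewrite Rabs_mult.
        apply Rmult_le_compat; try apply Rabs_pos.
        + rewrite Rabs_pos_eq by (apply pow_le; lra). rewrite pow_mult. apply pow_incr. lra.
        + replace (exp (- ((u + d) * y)) - exp (- (u * y)) + d * y * exp (- (u * y))) with
            (exp (- (u * y)) * (exp (- (d * y)) - 1 + d * y)).
          2:{ replace (- ((u + d) * y)) with (- (u * y) + - (d * y)) by ring. rewrite exp_plus. ring. }
          assert (Hdy : 0 <= d * y) by (apply Rmult_le_pos; lra).
          assert (Huy : exp (- (u * y)) <= 1).
          { rewrite <- exp_0. apply exp_le. assert (0 <= u * y) by (apply Rmult_le_pos; lra). lra. }
          rewrite Rabs_mult, (Rabs_pos_eq (exp _)) by (left; apply exp_pos).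
          assert (S2 := exp_second_order (d * y) Hdy).
          apply Rle_trans with (1 * (d * y) ^ 2).
          * apply Rmult_le_compat; [left; apply exp_pos|apply Rabs_pos|exact Huy|exact S2].
          * rewrite Rmult_1_l, Rpow_mult_distr, Rmult_comm. apply Rmult_le_compat_r; [apply pow_le; lra|].
            replace (X ^ 10) with ((X ^ 5) ^ 2) by ring. apply pow_incr. lra. }
    rewrite E, Rabs_mult, (Rabs_pos_eq (/ d)) by (left; now apply Rinv_0_lt_compat).
    apply Rmult_le_reg_l with d; [exact Hd|]. rewrite <- Rmult_assoc, Rinv_r, Rmult_1_l by lra.
    eapply Rle_trans; [apply Rabs_triang|].
    assert (T : Rabs (Lam k J (fun y => y ^ i * exp (- (u * y))) + -1 * Lam k J (fun y => y ^ i * exp (- ((u + d) * y)))) <= 2 * (C / X ^ (M + D))).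
    { eapply Rle_trans; [apply Rabs_triang|]. rewrite Rabs_mult, (Rabs_left (-1)) by lra. lra. }
    assert (Q1 : 2 * (C / X ^ (M + D)) = d * (2 * C / X ^ M)) by (unfold d; rewrite pow_add; field; lra).
    assert (Q2 : Lam_norm k * X ^ 15 * (X ^ (5 * i) * (X ^ 10 * d ^ 2)) = d * (Lam_norm k / X ^ M)).
    { assert (ED : X ^ D = X ^ M * (X ^ 25 * X ^ (5 * i))) by (unfold D; rewrite !pow_add; ring).
      unfold d. rewrite ED. assert (0 < X ^ 25) by (apply pow_lt; lra). assert (0 < X ^ (5 * i)) by (apply pow_lt; lra).
      replace (X ^ 25) with (X ^ 15 * X ^ 10) in * by (rewrite <- pow_add; reflexivity).
      assert (0 < X ^ 15) by (apply pow_lt; lra). assert (0 < X ^ 10) by (apply pow_lt; lra).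
      field. repeat split; lra. }
    rewrite Q1 in T. rewrite Q2 in B.
    replace (d * ((2 * C + Lam_norm k) / X ^ M)) with (d * (2 * C / X ^ M) + d * (Lam_norm k / X ^ M)) by (field; lra).
    lra.
Qed.

Definition poly_bounded (c : R -> R) : Prop :=
  exists C p, 0 <= C /\ ev (fun X => Rabs (c X) <= C * X ^ p).

(* Polynomials in [y] whose coefficients grow at most polynomially in [X]. *)
Inductive PF : (R -> R -> R) -> Prop :=
  | PF_mono (c : R -> R) (i : nat) : poly_bounded c -> PF (fun X y => c X * y ^ i)
  | PF_plus (f g : R -> R -> R) : PF f -> PF g -> PF (fun X y => f X y + g X y)
  | PF_ext (f g : R -> R -> R) : PF f -> (forall X y, f X y = g X y) -> PF g.

Lemma poly_bounded_const (c : R) : poly_bounded (fun _ => c).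
Proof. exists (Rabs c), 0%nat. split; [apply Rabs_pos|]. exists 0. intros; simpl; lra. Qed.

Lemma poly_bounded_mult (c d : R -> R) :
  poly_bounded c -> poly_bounded d -> poly_bounded (fun X => c X * d X).
Proof.
  intros [C [p [HC H]]] [D [q [HD H']]]. exists (C * D), (p + q)%nat.
  split; [now apply Rmult_le_pos|].
  apply (ev_imp _ _ (ev_and _ _ H H')). intros X [A B]. rewrite Rabs_mult, pow_add.
  replace (C * D * (X ^ p * X ^ q)) with (C * X ^ p * (D * X ^ q)) by ring.
  apply Rmult_le_compat; auto using Rabs_pos.
Qed.

Lemma PF_mult (f g : R -> R -> R) : PF f -> PF g -> PF (fun X y => f X y * g X y).
Proof.
  intros Hf Hg. induction Hf as [c i Hc|f1 f2 _ IH1 _ IH2|f1 f2 _ IH E].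
  - induction Hg as [d j Hd|g1 g2 _ IH1 _ IH2|g1 g2 _ IH E].
    + apply (PF_ext (fun X y => (c X * d X) * y ^ (i + j))).
      * apply PF_mono. now apply poly_bounded_mult.
      * intros X y. rewrite pow_add. ring.
    + eapply PF_ext; [apply PF_plus; [exact IH1|exact IH2]|]. intros; cbv beta; ring.
    + eapply PF_ext; [exact IH|]. intros; cbv beta; now rewrite E.
  - eapply PF_ext; [apply PF_plus; [exact IH1|exact IH2]|]. intros; cbv beta; ring.
  - eapply PF_ext; [exact IH|]. intros; cbv beta; now rewrite E.
Qed.

Lemma PF_const (c : R) : PF (fun _ _ => c).
Proof.
  eapply PF_ext; [apply (PF_mono (fun _ => c) 0), poly_bounded_const|]. intros; cbv beta; simpl; ring.
Qed.

Lemma PF_pow (f : R -> R -> R) (n : nat) : PF f -> PF (fun X y => f X y ^ n).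
Proof.
  intros H. induction n as [|n IH]; simpl; [apply PF_const|]. now apply PF_mult.
Qed.

Lemma PF_rsum (f : nat -> R -> R -> R) (a n : nat) : (forall i, (a <= i < a + n)%nat -> PF (f i)) ->
  PF (fun X y => rsum (fun i => f i X y) a n).
Proof.
  induction n as [|n IH]; intros H; simpl; [apply PF_const|].
  apply PF_plus; [apply IH; intros; apply H; lia|apply H; lia].
Qed.

Lemma PF_cont (P : R -> R -> R) (X : R) : PF P -> cont (P X).
Proof.
  intros H. induction H as [c i _|f g _ IH1 _ IH2|f g _ IH E].
  - apply cont_mult; [apply cont_const|apply cont_pow].
  - now apply cont_plus.
  - now apply (cont_ext (f X)).
Qed.

Lemma Lam_PF (P : R -> R -> R) (a b : R) : 0 < a -> a < b -> PF P -> forall M : nat,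
  exists C, 0 <= C /\ ev (fun X => forall J u, window J X -> range a b u X ->
    Rabs (Lam k J (fun y => exp (- (u * y)) * P X y)) <= C / X ^ M).
Proof.
  intros Ha Hab H. induction H as [c i [D [p [HD Hc]]]|f g Hf IH1 Hg IH2|f g _ IH E]; intros M.
  - destruct (Lam_pow_exp i a b (M + p) Ha Hab) as [C [HC HL]].
    exists (C * D). split; [now apply Rmult_le_pos|].
    apply (ev_imp _ _ (ev_and _ _ (ev_and _ _ Hc HL) (ev_ge 1))). intros X [[B1 B2] X1] J u HJ Hu.
    rewrite (Lam_ext k J _ (fun y => c X * (y ^ i * exp (- (u * y))))) by (intros; ring).
    rewrite Lam_scal by apply cont_pow_exp. rewrite Rabs_mult. specialize (B2 J u HJ Hu).
    assert (0 < X ^ p) by (apply pow_lt; lra). assert (0 < X ^ M) by (apply pow_lt; lra).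
    apply Rle_trans with ((D * X ^ p) * (C / X ^ (M + p))).
    + apply Rmult_le_compat; auto using Rabs_pos.
    + right. rewrite pow_add. field. lra.
  - destruct (IH1 M) as [C [HC H1]]. destruct (IH2 M) as [D [HD H2]]. exists (C + D). split; [lra|].
    apply (ev_imp _ _ (ev_and _ _ (ev_and _ _ H1 H2) (ev_ge 1))). intros X [[B1 B2] X1] J u HJ Hu.
    rewrite (Lam_ext k J _ (fun y => exp (- (u * y)) * f X y + exp (- (u * y)) * g X y)) by (intros; ring).
    rewrite Lam_plus by (apply cont_mult; [apply cont_exp|now apply PF_cont]).
    specialize (B1 J u HJ Hu). specialize (B2 J u HJ Hu). eapply Rle_trans; [apply Rabs_triang|].
    replace ((C + D) / X ^ M) with (C / X ^ M + D / X ^ M) by (field; apply pow_nonzero; lra). lra.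
  - destruct (IH M) as [C [HC H1]]. exists C. split; [exact HC|].
    apply (ev_imp _ _ H1). intros X B J u HJ Hu. rewrite <- (Lam_ext k J (fun y => exp (- (u * y)) * f X y)).
    + now apply B.
    + intros y. now rewrite E.
Qed.
End Functional.

(** * Local expansion of the comparison function *)

Section BesselLocal.
Variable A : R.
Hypothesis HA : 0 < A.

(** The logarithm of F(x - y) / F(x) is a Taylor polynomial in y. Multiplication by exp(u y) removes
    its linear term, the only one that is large on the window; the rest is O(X^(-2)), so M terms of
    its exponential series suffice. *)
Lemma bess_local_poly (M : nat) : exists P, PF P /\ exists C, 0 <= C /\
  ev (fun X => forall y, 0 <= y <= X ^ 5 ->
    Rabs (bess A (X ^ 8 - y) / bess A (X ^ 8) * exp (logder A (X ^ 8) * y) - P X y) <= C / X ^ M).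
Proof.
  (* The Taylor remainder y^(kk+1) x^(-1/2-kk) is of order X^(5(kk+1) - 4 - 8 kk) = X^(- 3M - 2) on
     the window. *)
  set (kk := S M).
  destruct (Sym_taylor kk (1 / 2) (logder A) (logder_Sym A HA kk)) as [c [C [HC [Hc [Hc0 HT]]]]].
  assert (HT2 := taylor_step (fun t => ln (bess A t)) (logder A) c (1 / 2) C kk HC
    ltac:(exists 0; intros; now apply ln_bess_derive) HT).
  assert (Hcb : forall i, (i < kk)%nat -> exists D, 0 < D /\ ev (fun X => Rabs (c i (X ^ 8)) <= D / X ^ (4 + 8 * i))).
  { intros i Hi. destruct (Hc i Hi) as [D [HD HB]]. exists D. split; [exact HD|].
    apply (ev_imp _ _ (ev_and _ _ (ev_pow8 _ HB) (ev_ge 1))). intros X [B X1].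
    rewrite (Rpower_pow8 X _ (4 + 8 * i)) in B; [exact B|lra|].
    rewrite plus_INR, mult_INR. simpl INR. field. }
  (* The sum starts at i = 1: the term i = 0 is the linear one, compensated by exp(u y). *)
  set (theta := fun X y => rsum (fun i => (- / INR (S i) * c i (X ^ 8)) * y ^ S i) 1 M).
  assert (Hth : PF theta).
  { unfold theta. apply (PF_rsum (fun i X y => (- / INR (S i) * c i (X ^ 8)) * y ^ S i)).
    intros i Hi. apply (PF_mono (fun X => - / INR (S i) * c i (X ^ 8)) (S i)).
    apply poly_bounded_mult; [apply poly_bounded_const|].
    destruct (Hcb i ltac:(unfold kk; lia)) as [D [HD HB]]. exists D, 0%nat. split; [lra|].
    apply (ev_imp _ _ (ev_and _ _ HB (ev_ge 1))). intros X [B X1]. simpl (X ^ 0).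
    eapply Rle_trans; [exact B|]. apply Rmult_le_compat_l; [lra|]. rewrite <- Rinv_1.
    apply Rinv_le_contravar; [lra|]. apply pow_R1_Rle. lra. }
  assert (Bth : exists D, 0 <= D /\ ev (fun X => forall y, 0 <= y <= X ^ 5 -> Rabs (theta X y) <= D / X ^ 2)).
  { assert (G : forall n, (n <= M)%nat -> exists D, 0 <= D /\ ev (fun X => forall y, 0 <= y <= X ^ 5 ->
      Rabs (rsum (fun i => (- / INR (S i) * c i (X ^ 8)) * y ^ S i) 1 n) <= D / X ^ 2)).
    { induction n as [|n IH]; intros Hn.
      - exists 0. split; [lra|]. exists 1. intros X X1 y _. simpl rsum. rewrite Rabs_R0.
        unfold Rdiv. rewrite Rmult_0_l. lra.
      - destruct (IH ltac:(lia)) as [D [HD HB]]. destruct (Hcb (S n) ltac:(unfold kk; lia)) as [D' [HD' HB']].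
        exists (D + D'). split; [lra|].
        apply (ev_imp _ _ (ev_and _ _ (ev_and _ _ HB HB') (ev_ge 1))). intros X [[B1 B2] X1] y Hy.
        cbn [rsum]. change (1 + n)%nat with (S n). eapply Rle_trans; [apply Rabs_triang|].
        assert (X2 : 0 < X ^ 2) by (apply pow_lt; lra).
        replace ((D + D') / X ^ 2) with (D / X ^ 2 + D' / X ^ 2) by (field; lra).
        apply Rplus_le_compat; [now apply B1|].
        rewrite !Rabs_mult, Rabs_Ropp.
        assert (N1 : 1 <= INR (S (S n))) by (apply (le_INR 1); lia).
        assert (N2 : 0 < / INR (S (S n)) <= 1).
        { split; [apply Rinv_0_lt_compat; lra|]. rewrite <- Rinv_1. apply Rinv_le_contravar; lra. }
        rewrite (Rabs_pos_eq (/ _)), (Rabs_pos_eq (y ^ _)) by (try apply pow_le; lra).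
        apply Rle_trans with (1 * (D' / X ^ (4 + 8 * S n)) * X ^ (5 * S (S n))).
        + apply Rmult_le_compat; try lra.
          * apply Rmult_le_pos; [lra|apply Rabs_pos].
          * apply pow_le; lra.
          * apply Rmult_le_compat; try lra. apply Rabs_pos.
          * rewrite pow_mult. apply pow_incr. lra.
        + rewrite Rmult_1_l. unfold Rdiv. rewrite Rmult_assoc. apply Rmult_le_compat_l; [lra|].
          replace (4 + 8 * S n)%nat with (5 * S (S n) + (2 + 3 * n))%nat by lia.
          rewrite pow_add. assert (0 < X ^ (5 * S (S n))) by (apply pow_lt; lra).
          assert (0 < X ^ (2 + 3 * n)) by (apply pow_lt; lra).
          replace (/ (X ^ (5 * S (S n)) * X ^ (2 + 3 * n)) * X ^ (5 * S (S n))) with (/ X ^ (2 + 3 * n)) by (field; lra).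
          apply div_pow_mono; [lra|lia]. }
    exact (G M (le_n M)). }
  destruct Bth as [D [HD HB]].
  exists (fun X y => rsum (fun i => / INR (fact i) * theta X y ^ i) 0 M). split.
  { apply (PF_rsum (fun i X y => / INR (fact i) * theta X y ^ i)). intros i _.
    apply PF_mult; [apply PF_const|]. now apply PF_pow. }
  exists (3 * C + 3 * D ^ M). split.
  { assert (0 <= D ^ M) by now apply pow_le. lra. }
  apply (ev_imp _ _ (ev_and _ _ (ev_and _ _ (ev_pow8 _ HT2) HB)
    (ev_and _ _ (ev_ge 2) (ev_and _ _ (ev_inv_small D (1 / 2) 1 ltac:(lra)) (ev_inv_small C (1 / 2) 0 ltac:(lra)))))).
  intros X [[T B] [X2 [S1 S2]]] y Hy.
  assert (X3 : 8 <= X ^ 3) by (replace 8 with (2 ^ 3) by ring; apply pow_incr; lra).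
  assert (X5 : 0 < X ^ 5) by (apply pow_lt; lra).
  assert (X8 : X ^ 8 = X ^ 5 * X ^ 3) by ring.
  assert (Hy8 : 0 <= y <= X ^ 8 / 2) by (split; [lra|]; rewrite X8; nra).
  specialize (T y Hy8). specialize (B y Hy).
  set (x := X ^ 8) in *.
  set (rho := ln (bess A (x - y)) - ln (bess A x) + rsum (fun i => c i x / INR (S i) * y ^ S i) 0 kk) in *.
  assert (Px : 0 < bess A x) by (apply bess_pos; [exact HA|lra]).
  assert (Pxy : 0 < bess A (x - y)) by (apply bess_pos; [exact HA|lra]).
  assert (E : bess A (x - y) / bess A x * exp (logder A x * y) = exp (theta X y + rho)).
  { rewrite <- (exp_ln (bess A (x - y))), <- (exp_ln (bess A x)) by assumption.
    unfold Rdiv. rewrite <- exp_Ropp, <- !exp_plus. f_equal.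
    unfold rho, kk. rewrite rsum_first, Hc0 by (unfold kk; lia).
    assert (Et : theta X y = -1 * rsum (fun i => c i x / INR (S i) * y ^ S i) 1 M).
    { unfold theta. fold x. rewrite <- rsum_scal. apply rsum_ext. intros i _. unfold Rdiv. ring. }
    rewrite Et. simpl (INR 1). simpl (y ^ 1). field. }
  rewrite E.
  assert (X1 : 0 < X ^ 1) by (simpl; lra). assert (XM : 0 < X ^ M) by (apply pow_lt; lra).
  assert (Br : Rabs rho <= C / X ^ (M + 1)).
  { eapply Rle_trans; [exact T|].
    unfold x. rewrite (Rpower_pow8 X _ (4 + 8 * kk)); [|lra|rewrite plus_INR, mult_INR; simpl INR; field].
    unfold Rdiv. rewrite Rmult_assoc. apply Rmult_le_compat_l; [lra|].
    apply Rle_trans with (X ^ (5 * S kk) * / X ^ (4 + 8 * kk)).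
    - apply Rmult_le_compat_r; [left; apply Rinv_0_lt_compat, pow_lt; lra|].
      rewrite pow_mult. apply pow_incr. lra.
    - replace (4 + 8 * kk)%nat with (5 * S kk + (M + 1 + (2 * M + 1)))%nat by (unfold kk; lia).
      rewrite pow_add. assert (0 < X ^ (5 * S kk)) by (apply pow_lt; lra).
      assert (0 < X ^ (M + 1 + (2 * M + 1))) by (apply pow_lt; lra).
      replace (X ^ (5 * S kk) * / (X ^ (5 * S kk) * X ^ (M + 1 + (2 * M + 1)))) with (/ X ^ (M + 1 + (2 * M + 1))) by (field; lra).
      apply div_pow_mono; [lra|lia]. }
  assert (Br1 : Rabs rho <= 1 / 2).
  { eapply Rle_trans; [exact Br|]. eapply Rle_trans; [|exact S2].
    apply Rmult_le_compat_l; [lra|]. apply div_pow_mono; [lra|lia]. }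
  assert (Br2 : Rabs rho <= C / X ^ M).
  { eapply Rle_trans; [exact Br|].
    apply Rmult_le_compat_l; [lra|]. apply div_pow_mono; [lra|lia]. }
  assert (Bt : Rabs (theta X y) <= 1 / 2) by lra.
  assert (Bt' := Bt). assert (Br1' := Br1). apply Rabs_le_between in Bt'. apply Rabs_le_between in Br1'.
  assert (L1 := exp_lipschitz (theta X y + rho) (theta X y) ltac:(lra) ltac:(lra)).
  replace (theta X y + rho - theta X y) with rho in L1 by ring.
  assert (L2 := exp_taylor M (theta X y) ltac:(lra)).
  replace (exp (theta X y + rho) - rsum (fun i => / INR (fact i) * theta X y ^ i) 0 M) with
    ((exp (theta X y + rho) - exp (theta X y)) + (exp (theta X y) - rsum (fun i => / INR (fact i) * theta X y ^ i) 0 M)) by ring.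
  eapply Rle_trans; [apply Rabs_triang|].
  assert (L3 : Rabs (theta X y) ^ M <= D ^ M / X ^ M).
  { apply Rle_trans with ((D / X ^ 2) ^ M); [apply pow_incr; split; [apply Rabs_pos|exact B]|].
    unfold Rdiv. rewrite Rpow_mult_distr, pow_inv, <- pow_mult. apply Rmult_le_compat_l; [now apply pow_le|].
    apply div_pow_mono; [lra|lia]. }
  replace ((3 * C + 3 * D ^ M) / X ^ M) with (3 * (C / X ^ M) + 3 * (D ^ M / X ^ M)) by (field; lra).
  lra.
Qed.
End BesselLocal.

Lemma bess_reflect_cont (A x : R) : 0 < A -> cont (fun y => bess A (x - y)).
Proof.
  intros HA. apply (cont_derive _ (fun y => - bess1 A (x - y))). intros y.
  replace (- bess1 A (x - y)) with (scal (-1) (bess1 A (x - y))) by (unfold scal; simpl; unfold mult; simpl; ring).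
  apply (is_derive_comp (bess A) (fun t => x - t)); [now apply bess_derive|]. auto_derive; [exact I|ring].
Qed.

(** F(x - y) / F(x) is e^(- u y) times a polynomial plus a remainder. [Lam_PF] handles the first
    part; the remainder is made O(X^(- M - 15)) to survive the factor X^15 of [Lam_bound]. *)
Lemma Lam_bess (k M : nat) : exists C, 0 <= C /\ ev (fun X => forall J, window J X ->
  Rabs (Lam k J (fun y => bess (rate k) (X ^ 8 - y))) <= C / X ^ M * bess (rate k) (X ^ 8)).
Proof.
  set (A := rate k). assert (HA : 0 < A) by apply rate_pos.
  assert (HsA : 0 < sqrt A) by now apply sqrt_lt_R0.
  destruct (bess_local_poly A HA (M + 15)) as [P [HP [C [HC H1]]]].
  destruct (Lam_PF k P (sqrt A / 2) (2 * sqrt A) ltac:(lra) ltac:(lra) HP M) as [D [HD H2]].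
  assert (N0 := Lam_norm_pos k).
  exists (D + Lam_norm k * C). split; [assert (0 <= Lam_norm k * C) by (apply Rmult_le_pos; lra); lra|].
  apply (ev_imp _ _ (ev_and _ _ (ev_and _ _ H1 H2) (ev_and _ _ (ev_pow8 _ (logder_bounds A HA)) (ev_ge 1)))).
  intros X [[B1 B2] [Bu X1]] J HJ.
  rewrite (Rpower_pow8 X _ 4) in Bu by (simpl INR; lra).
  set (x := X ^ 8) in *. set (u := logder A x) in *.
  assert (X0 : 0 <= x) by (apply pow_le; lra).
  assert (Px := bess_pos A HA x X0).
  set (Rm := fun y => bess A (x - y) / bess A x + -1 * (exp (- (u * y)) * P X y)).
  assert (C1 : cont (fun y => exp (- (u * y)) * P X y)) by (apply cont_mult; [apply cont_exp|now apply PF_cont]).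
  assert (C2 : cont Rm).
  { unfold Rm. apply cont_plus; [|apply cont_mult; [apply cont_const|exact C1]].
    apply (cont_ext (fun y => / bess A x * bess A (x - y))); [intros; unfold Rdiv; ring|].
    apply cont_mult; [apply cont_const|now apply bess_reflect_cont]. }
  rewrite (Lam_ext k J _ (fun y => bess A x * (exp (- (u * y)) * P X y + Rm y)))
    by (intros; unfold Rm; field; lra).
  rewrite Lam_scal by now apply cont_plus. rewrite Lam_plus by assumption.
  rewrite Rabs_mult, (Rabs_pos_eq (bess A x)), Rmult_comm by lra.
  apply Rmult_le_compat_r; [lra|]. eapply Rle_trans; [apply Rabs_triang|].
  assert (XM : 0 < X ^ M) by (apply pow_lt; lra). assert (X15 : 0 < X ^ 15) by (apply pow_lt; lra).
  replace ((D + Lam_norm k * C) / X ^ M) with (D / X ^ M + Lam_norm k * X ^ 15 * (C / X ^ (M + 15)))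
    by (rewrite pow_add; field; lra).
  apply Rplus_le_compat.
  - apply B2; [exact HJ|]. unfold range, Rdiv. unfold Rdiv in Bu. exact Bu.
  - apply Lam_bound; try assumption.
    + apply Rdiv_le_0_compat; [exact HC|apply pow_lt; lra].
    + intros y Hy. destruct HJ as [_ HJ]. specialize (B1 y ltac:(lra)).
      unfold Rm. replace (bess A (x - y) / bess A x + -1 * (exp (- (u * y)) * P X y)) with
        (exp (- (u * y)) * (bess A (x - y) / bess A x * exp (u * y) - P X y)).
      2:{ assert (Ee : exp (- (u * y)) * exp (u * y) = 1) by (rewrite <- exp_plus, Rplus_opp_l; apply exp_0).
          replace (exp (- (u * y)) * (bess A (x - y) / bess A x * exp (u * y) - P X y)) with
            (bess A (x - y) / bess A x * (exp (- (u * y)) * exp (u * y)) - exp (- (u * y)) * P X y) by ring.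
          rewrite Ee. ring. }
      rewrite Rabs_mult, (Rabs_pos_eq (exp _)) by (left; apply exp_pos).
      assert (Huy : exp (- (u * y)) <= 1).
      { rewrite <- exp_0. apply exp_le. assert (0 < u) by (apply logder_pos; assumption).
        assert (0 <= u * y) by (apply Rmult_le_pos; lra). lra. }
      apply Rle_trans with (1 * (C / X ^ (M + 15))); [|lra].
      apply Rmult_le_compat; [left; apply exp_pos|apply Rabs_pos|exact Huy|exact B1].
Qed.

(* The antiderivative comes from [A F = (t F)'' + F'], where [t = x - y]. *)
Lemma RInt_linear_bess (A x z : R) : 0 < A ->
  RInt (fun y => (A * y - 1) * bess A (x - y)) 0 z =
  x * bess A x - (z * (2 * bess A (x - z) + (x - z) * bess1 A (x - z)) + (x - z) * bess A (x - z)).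
Proof.
  intros HA.
  set (W := fun y => - (y * (2 * bess A (x - y) + (x - y) * bess1 A (x - y)) + (x - y) * bess A (x - y))).
  replace (x * bess A x - (z * (2 * bess A (x - z) + (x - z) * bess1 A (x - z)) + (x - z) * bess A (x - z)))
    with (minus (W z) (W 0)).
  - apply is_RInt_unique. apply (is_RInt_derive (V := R_CompleteNormedModule)).
    + intros y _.
      assert (Dt : forall t : R, is_derive (fun t => x - t) t (-1)) by (intros t; auto_derive; [exact I|ring]).
      assert (D0 : is_derive (fun y => bess A (x - y)) y (- bess1 A (x - y))).
      { replace (- bess1 A (x - y)) with (scal (-1) (bess1 A (x - y))) by (unfold scal; simpl; unfold mult; simpl; ring).
        apply (is_derive_comp (bess A) (fun t => x - t)); [now apply bess_derive|apply Dt]. }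
      assert (D1 : is_derive (fun y => bess1 A (x - y)) y (- bess2 A (x - y))).
      { replace (- bess2 A (x - y)) with (scal (-1) (bess2 A (x - y))) by (unfold scal; simpl; unfold mult; simpl; ring).
        apply (is_derive_comp (bess1 A) (fun t => x - t)); [now apply bess1_derive|apply Dt]. }
      assert (Di : is_derive (fun t : R => t) y 1) by (auto_derive; [exact I|ring]).
      assert (D := is_derive_Ropp _ _ _ (is_derive_Rplus _ _ _ _ _
        (is_derive_Rmult _ _ _ _ _ Di (is_derive_Rplus _ _ _ _ _ (is_derive_Rscal 2 _ _ _ D0)
           (is_derive_Rmult _ _ _ _ _ (Dt y) D1)))
        (is_derive_Rmult _ _ _ _ _ (Dt y) D0))).
      cbv beta in D. unfold W.
      match type of D with is_derive _ _ ?v => replace ((A * y - 1) * bess A (x - y)) with v; [exact D|] end.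
      assert (O := bess_ode A HA (x - y)).
      replace ((A * y - 1) * bess A (x - y)) with (y * (A * bess A (x - y)) - bess A (x - y)) by ring.
      rewrite <- O. ring.
    + intros y _. apply (cont_mult (fun y => A * y - 1) (fun y => bess A (x - y))); [|now apply bess_reflect_cont].
      apply (cont_derive _ (fun _ => A)). intros t. auto_derive; [exact I|ring].
  - unfold W, minus, plus, opp; simpl. rewrite !Rminus_0_r. ring.
Qed.

Lemma exp_neg_X (c : R) (M : nat) : 0 < c ->
  exists C, 0 <= C /\ forall X, 0 < X -> exp (- (c * X)) <= C / X ^ M.
Proof.
  intros Hc. assert (F := INR_fact_lt_0 M). assert (cM : 0 < c ^ M) by now apply pow_lt.
  exists (INR (fact M) / c ^ M). split; [apply Rdiv_le_0_compat; lra|]. intros X HX.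
  assert (XM : 0 < X ^ M) by now apply pow_lt.
  assert (B := pow_exp_bound (c * X) M ltac:(left; now apply Rmult_lt_0_compat)).
  rewrite Rpow_mult_distr in B. apply Rmult_le_reg_r with (c ^ M * X ^ M); [now apply Rmult_lt_0_compat|].
  replace (INR (fact M) / c ^ M / X ^ M * (c ^ M * X ^ M)) with (INR (fact M)) by (field; lra). lra.
Qed.

(** A shift of order X^5 against a decay rate of order X^(-4) gives a factor exp(- c X). *)
Lemma bess_shift_small (A : R) (M : nat) : 0 < A ->
  exists C, 0 <= C /\ ev (fun X => forall y, X ^ 5 / 2 <= y <= X ^ 8 / 2 ->
    bess A (X ^ 8 - y) <= C / X ^ M * bess A (X ^ 8)).
Proof.
  intros HA. assert (HsA : 0 < sqrt A) by now apply sqrt_lt_R0.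
  destruct (exp_neg_X (sqrt A / 4) M ltac:(lra)) as [C [HC HE]]. exists C. split; [exact HC|].
  apply (ev_imp _ _ (ev_and _ _ (ev_pow8 _ (bess_ratio A HA)) (ev_ge 1))). intros X [B X1] y Hy.
  assert (X5 : 0 < X ^ 5) by (apply pow_lt; lra). assert (X4 : 0 < X ^ 4) by (apply pow_lt; lra).
  destruct (B y ltac:(lra)) as [_ B2]. rewrite (Rpower_pow8 X _ 4) in B2 by (simpl INR; lra).
  assert (Px : 0 < bess A (X ^ 8)) by (apply bess_pos; [exact HA|apply pow_le; lra]).
  eapply Rle_trans; [exact B2|]. rewrite Rmult_comm. apply Rmult_le_compat_r; [lra|].
  eapply Rle_trans; [|apply HE; lra]. apply exp_le.
  apply Rle_trans with (- (sqrt A / 2) * (X ^ 5 / 2) * / X ^ 4); [|right; field; lra].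
  apply Rmult_le_compat_r; [left; now apply Rinv_0_lt_compat|]. nra.
Qed.

(** The integral in [Lam] is evaluated exactly. Its boundary term at J is at most a multiple of x^2
    F(x - J), and the exponent M + 16 in [bess_shift_small] pays for x^2 = X^16. *)
Lemma bess_weight_sum (k M : nat) : exists C, 0 <= C /\ ev (fun X => forall J, window J X ->
  Rabs (rsum (fun j => weight k j * bess (rate k) (X ^ 8 - INR j)) 1 J
    - (X ^ 8 - offset k) * bess (rate k) (X ^ 8)) <= C / X ^ M * bess (rate k) (X ^ 8)).
Proof.
  set (A := rate k). assert (HA : 0 < A) by apply rate_pos.
  assert (HsA : 0 < sqrt A) by now apply sqrt_lt_R0.
  destruct (Lam_bess k M) as [C [HC H1]]. fold A in H1.
  destruct (bess_shift_small A (M + 16) HA) as [D [HD H2]].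
  set (c := 3 + 2 * sqrt A).
  exists (C + c * D). split; [assert (0 <= c * D) by (apply Rmult_le_pos; unfold c; lra); lra|].
  apply (ev_imp _ _ (ev_and _ _ (ev_and _ _ H1 H2) (ev_and _ _ (ev_pow8 _ (ev_half _ (logder_bounds A HA))) (ev_ge 2)))).
  intros X [[B1 B2] [Bu X2]] J HJ. specialize (B1 J HJ). unfold Lam in B1. fold A in B1.
  rewrite RInt_linear_bess, Rminus_0_r in B1 by exact HA.
  assert (X3 : 8 <= X ^ 3) by (replace 8 with (2 ^ 3) by ring; apply pow_incr; lra).
  assert (X5 : 32 <= X ^ 5) by (replace 32 with (2 ^ 5) by ring; apply pow_incr; lra).
  assert (X8 : X ^ 8 = X ^ 5 * X ^ 3) by ring.
  destruct HJ as [HJ1 HJ2].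
  assert (HJ8 : X ^ 5 / 2 <= INR J <= X ^ 8 / 2) by (split; [lra|]; rewrite X8; nra).
  specialize (B2 (INR J) HJ8). specialize (Bu (X ^ 8 - INR J) ltac:(lra)).
  set (x := X ^ 8) in *. set (t := x - INR J) in *.
  assert (Ht : x / 2 <= t <= x) by (unfold t; lra). assert (Hx : 32 <= x) by (rewrite X8; nra).
  assert (Pt : 0 < bess A t) by (apply bess_pos; [exact HA|lra]).
  assert (Px : 0 < bess A x) by (apply bess_pos; [exact HA|lra]).
  assert (U : 0 <= bess1 A t <= 2 * sqrt A * bess A t).
  { assert (U1 := bess1_pos A HA t ltac:(lra)). split; [lra|].
    replace (bess1 A t) with (logder A t * bess A t) by (unfold logder; field; lra).
    apply Rmult_le_compat_r; [lra|].
    apply Rle_trans with (2 * sqrt A * 1); [|lra].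
    eapply Rle_trans; [apply Bu|]. apply Rmult_le_compat_l; [lra|].
    apply Rle_trans with (Rpower t 0); [apply Rle_Rpower; lra|rewrite Rpower_O; lra]. }
  set (W := INR J * (2 * bess A t + t * bess1 A t) + t * bess A t) in *.
  assert (HW : 0 <= W <= c * (x * x) * bess A t).
  { assert (HJ0 := pos_INR J). unfold W.
    assert (T1 : 0 <= t * bess1 A t <= x * (2 * sqrt A * bess A t)).
    { split; [apply Rmult_le_pos; lra|]. apply Rmult_le_compat; lra. }
    assert (T2 : 0 <= INR J * (2 * bess A t + t * bess1 A t) <= x * (2 * bess A t + x * (2 * sqrt A * bess A t))).
    { split; [apply Rmult_le_pos; lra|]. apply Rmult_le_compat; lra. }
    assert (T3 : 0 <= t * bess A t <= x * bess A t).
    { split; [apply Rmult_le_pos; lra|]. apply Rmult_le_compat_r; lra. }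
    split; [lra|].
    assert (T4 : x * bess A t <= x * x * bess A t) by (apply Rmult_le_compat_r; [lra|nra]).
    unfold c. replace ((3 + 2 * sqrt A) * (x * x) * bess A t) with
      (3 * (x * x * bess A t) + x * (x * (2 * sqrt A * bess A t))) by ring. lra. }
  assert (XM : 0 < X ^ M) by (apply pow_lt; lra). assert (X16 : 0 < X ^ 16) by (apply pow_lt; lra).
  assert (HW2 : W <= c * D / X ^ M * bess A x).
  { eapply Rle_trans; [apply HW|].
    apply Rle_trans with (c * (x * x) * (D / X ^ (M + 16) * bess A x)).
    - apply Rmult_le_compat_l; [|exact B2]. apply Rmult_le_pos; [unfold c; lra|nra].
    - right. rewrite pow_add. replace (x * x) with (X ^ 16) by (unfold x; ring). field. lra. }
  match type of B1 with Rabs (?s - (?q - W) + ?o) <= _ =>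
    replace (s - (x - offset k) * bess A x) with ((s - (q - W) + o) + - W) by ring end.
  eapply Rle_trans; [apply Rabs_triang|]. rewrite Rabs_Ropp, (Rabs_pos_eq W) by lra.
  replace ((C + c * D) / X ^ M * bess A x) with (C / X ^ M * bess A x + c * D / X ^ M * bess A x) by (field; lra).
  lra.
Qed.

(** * Contraction of oscillations *)

Section Block.
Variables (P : nat -> nat -> R) (N H L : nat) (kap Lmb eps : R).
Hypothesis HH : (1 <= H)%nat.
Hypothesis HL : (2 * H <= L)%nat.
Hypothesis HN : (L <= N)%nat.
Hypothesis Hkap : 0 < kap.
Hypothesis HLmb : 0 <= Lmb.
Hypothesis Heps : 0 <= eps.

Let mean (n : nat) (v : nat -> R) : R := rsum (fun l => P n l * v l) (N - L) (n - (N - L)).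

Hypothesis HP : forall n l, (N <= n < N + H + L)%nat -> (N - L <= l < n)%nat -> 0 <= P n l.
Hypothesis HP1 : forall n, (N <= n < N + H + L)%nat -> mean n (fun _ => 1) = 1.
(** A uniform overlap with the values before N is assumed only for the first H means. The later
    means are linked to these H indices by [Hhazard]: a mean that still sees the past before N also
    sees [N, N + H), in a proportion controlled by [Lmb]. *)
Hypothesis Hminor : forall n l, (N <= n < N + H)%nat -> (N - 2 * H <= l < N - H)%nat -> kap / INR H <= P n l.
Hypothesis Hhazard : forall n, (N + H <= n < N + H + L)%nat ->
  rsum (P n) (N - L) L <= Lmb * rsum (P n) N H.

Lemma mean_mono (n : nat) (v w : nat -> R) : (N <= n < N + H + L)%nat ->
  (forall l, (N - L <= l < n)%nat -> v l <= w l) -> mean n v <= mean n w.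
Proof.
  intros Hn Hvw. apply rsum_le. intros l Hl. apply Rmult_le_compat_l.
  - apply HP; [exact Hn|lia].
  - apply Hvw. lia.
Qed.

Lemma mean_shift (n : nat) (c : R) (v : nat -> R) : (N <= n < N + H + L)%nat ->
  mean n (fun l => c + v l) = c + mean n v.
Proof.
  intros Hn. unfold mean.
  rewrite (rsum_ext _ (fun l => c * (P n l * 1) + P n l * v l)) by (intros; ring).
  rewrite rsum_plus, rsum_scal. fold (mean n (fun _ => 1)). rewrite HP1 by exact Hn. ring.
Qed.

Section Lower.
Variables (w : nat -> R) (m : R).
Hypothesis Hw : forall n, (N <= n < N + H + L)%nat -> Rabs (w n - mean n w) <= eps.
Hypothesis Hm : forall l, (N - L <= l < N)%nat -> m <= w l.

(** A mean of values above a level lies above it, so the lower bound m loses at most one [eps] for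
    each index from N on. *)
Lemma block_low (n : nat) : (n < N + H + L)%nat -> (N - L <= n)%nat ->
  m - INR (S n - N) * eps <= w n.
Proof.
  induction n as [n IH] using (well_founded_induction lt_wf). intros Hn1 Hn2.
  destruct (Nat.lt_ge_cases n N) as [Hlt|Hge].
  - specialize (Hm n ltac:(lia)). assert (0 <= INR (S n - N) * eps) by (apply Rmult_le_pos; [apply pos_INR|exact Heps]). lra.
  - assert (A := Hw n ltac:(lia)). apply Rabs_le_between in A.
    assert (B : mean n (fun _ => m - INR (n - N) * eps) <= mean n w).
    { apply mean_mono; [lia|]. intros l Hl. eapply Rle_trans; [|apply IH; lia].
      apply Rplus_le_compat_l, Ropp_le_contravar, Rmult_le_compat_r; [exact Heps|]. apply le_INR. lia. }
    assert (C : mean n (fun _ => m - INR (n - N) * eps) = m - INR (n - N) * eps).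
    { unfold mean. rewrite (rsum_ext _ (fun l => (m - INR (n - N) * eps) * (P n l * 1))) by (intros; ring).
      rewrite rsum_scal. fold (mean n (fun _ => 1)). rewrite HP1 by lia. ring. }
    replace (S n - N)%nat with (S (n - N)) by lia. rewrite S_INR. lra.
Qed.

Variable g : R.
Hypothesis Hg : 0 <= g.
Hypothesis Havg : INR H * (g / 2) <= rsum (fun l => w l - m) (N - 2 * H) H.

(** By [Havg] the values on [N - 2H, N - H) exceed m by g / 2 on average, and each of these indices
    has mass at least kap / H. All other indices are bounded below by [block_low]. *)
Lemma block_gain_first (n : nat) : (N <= n < N + H)%nat ->
  m + kap / 2 * g - INR (S n - N) * eps <= w n.
Proof.
  intros Hn. assert (A := Hw n ltac:(lia)). apply Rabs_le_between in A.
  set (d := INR (n - N) * eps).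
  assert (Hd : 0 <= d) by (apply Rmult_le_pos; [apply pos_INR|exact Heps]).
  set (v := fun l => if ((N - 2 * H <=? l) && (l <? N - H))%nat%bool then w l - m else 0).
  assert (B : mean n (fun l => (m - d) + v l) <= mean n w).
  { apply mean_mono; [lia|]. intros l Hl. unfold v.
    destruct (Nat.leb_spec (N - 2 * H) l), (Nat.ltb_spec l (N - H)); simpl; try lra.
    all: assert (Q := block_low l ltac:(lia) ltac:(lia));
      assert (INR (S l - N) * eps <= d) by (apply Rmult_le_compat_r; [exact Heps|apply le_INR; lia]); lra. }
  rewrite mean_shift in B by lia.
  assert (C : kap / 2 * g <= mean n v).
  { assert (HH0 : 0 < INR H) by (apply lt_0_INR; lia).
    apply Rle_trans with (kap / INR H * rsum (fun l => w l - m) (N - 2 * H) H).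
    - apply Rle_trans with (kap / INR H * (INR H * (g / 2))); [right; field; lra|].
      apply Rmult_le_compat_l; [left; now apply Rdiv_lt_0_compat|exact Havg].
    - unfold mean. replace (n - (N - L))%nat with ((L - 2 * H) + (H + (n - (N - H))))%nat by lia.
      rewrite !rsum_split.
      rewrite (rsum_zero _ (N - L)).
      2:{ intros l Hl. unfold v. destruct (Nat.leb_spec (N - 2 * H) l); [lia|]. simpl. ring. }
      rewrite (rsum_zero _ (N - L + (L - 2 * H) + H)).
      2:{ intros l Hl. unfold v. destruct (Nat.ltb_spec l (N - H)); [lia|]. rewrite Bool.andb_false_r. ring. }
      replace (N - L + (L - 2 * H))%nat with (N - 2 * H)%nat by lia.
      rewrite Rplus_0_l, Rplus_0_r, <- rsum_scal. apply rsum_le. intros l Hl.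
      unfold v. destruct (Nat.leb_spec (N - 2 * H) l), (Nat.ltb_spec l (N - H)); try lia. simpl.
      apply Rmult_le_compat_r; [specialize (Hm l ltac:(lia)); lra|]. apply Hminor; lia. }
  replace (S n - N)%nat with (S (n - N)) by lia. rewrite S_INR. unfold d in *. lra.
Qed.

(* A mean reaching below [N] puts a proportional mass on [N, N + H), where the gain
   has already been secured. *)
Lemma block_gain (n : nat) : (N + H <= n < N + H + L)%nat ->
  m + kap / (2 * (1 + Lmb)) * g - INR (S n - N) * eps <= w n.
Proof.
  (* The gain kap g / 2 on [N, N + H) is (1 + Lmb) eta. Its surplus Lmb eta over eta compensates for
     the mass below N, where nothing is gained and which is at most Lmb times the mass on [N, N +
     H). *)
  set (eta := kap / (2 * (1 + Lmb)) * g).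
  assert (He0 : 0 <= eta) by (apply Rmult_le_pos; [left; apply Rdiv_lt_0_compat; lra|exact Hg]).
  assert (He1 : kap / 2 * g = (1 + Lmb) * eta) by (unfold eta; field; lra).
  induction n as [n IH] using (well_founded_induction lt_wf). intros Hn.
  assert (A := Hw n ltac:(lia)). apply Rabs_le_between in A.
  set (d := INR (n - N) * eps).
  assert (Hmono : forall l, (l < n)%nat -> INR (S l - N) * eps <= d).
  { intros l Hl. apply Rmult_le_compat_r; [exact Heps|apply le_INR; lia]. }
  set (v := fun l => if (l <? N)%nat then 0 else if (l <? N + H)%nat then (1 + Lmb) * eta else eta).
  assert (B : mean n (fun l => (m - d) + v l) <= mean n w).
  { apply mean_mono; [lia|]. intros l Hl. specialize (Hmono l ltac:(lia)). unfold v.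
    destruct (Nat.ltb_spec l N).
    - assert (Q := block_low l ltac:(lia) ltac:(lia)). lra.
    - destruct (Nat.ltb_spec l (N + H)).
      + assert (Q := block_gain_first l ltac:(lia)). lra.
      + assert (Q := IH l ltac:(lia) ltac:(lia)). lra. }
  rewrite mean_shift in B by lia.
  assert (C : eta <= mean n v).
  { assert (S1 := HP1 n ltac:(lia)). unfold mean in S1 |- *.
    replace (n - (N - L))%nat with (L + (H + (n - N - H)))%nat in S1 |- * by lia.
    rewrite !rsum_split in S1. rewrite !rsum_split.
    replace (N - L + L)%nat with N in S1 |- * by lia.
    rewrite (rsum_zero (fun l => P n l * v l) (N - L)).
    2:{ intros l Hl. unfold v. destruct (Nat.ltb_spec l N); [ring|lia]. }
    rewrite (rsum_ext (fun l => P n l * v l) (fun l => ((1 + Lmb) * eta) * P n l) N).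
    2:{ intros l Hl. unfold v. destruct (Nat.ltb_spec l N), (Nat.ltb_spec l (N + H)); try lia. ring. }
    rewrite (rsum_ext (fun l => P n l * v l) (fun l => eta * P n l) (N + H)).
    2:{ intros l Hl. unfold v. destruct (Nat.ltb_spec l N), (Nat.ltb_spec l (N + H)); try lia. ring. }
    rewrite !rsum_scal.
    rewrite !(rsum_ext (fun l => P n l * 1) (P n)) in S1 by (intros; ring).
    assert (Z := Hhazard n Hn).
    set (p0 := rsum (P n) (N - L) L) in *. set (p1 := rsum (P n) N H) in *.
    set (p2 := rsum (P n) (N + H) (n - N - H)) in *.
    assert (eta * (Lmb * p1 - p0) >= 0) by (apply Rle_ge, Rmult_le_pos; lra).
    replace eta with (eta * (p0 + (p1 + p2))) at 1 by (rewrite S1; ring). lra. }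
  replace (S n - N)%nat with (S (n - N)) by lia. rewrite S_INR. unfold d in *. lra.
Qed.
End Lower.

(** The average over [N - 2H, N - H) is in the upper or in the lower half of [m, M]. Accordingly the
    lower bound is raised, or, by the same argument for - w, the upper bound is lowered; the
    opposite bound only drifts by the accumulated error. *)
Lemma block_contract (w : nat -> R) (m M : R) :
  (forall n, (N <= n < N + H + L)%nat -> Rabs (w n - mean n w) <= eps) ->
  (forall l, (N - L <= l < N)%nat -> m <= w l <= M) -> m <= M ->
  exists m' M', m' <= M' /\ (forall l, (N + H <= l < N + H + L)%nat -> m' <= w l <= M') /\
    M' - m' <= (1 - kap / (2 * (1 + Lmb))) * (M - m) + 2 * INR (H + L) * eps.
Proof.
  intros Hw Hm HmM.
  set (E := INR (H + L) * eps).
  assert (HE0 : 0 <= E) by (apply Rmult_le_pos; [apply pos_INR|exact Heps]).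
  assert (HE : forall l, (l < N + H + L)%nat -> INR (S l - N) * eps <= E).
  { intros l Hl. apply Rmult_le_compat_r; [exact Heps|apply le_INR; lia]. }
  set (w' := fun l => - w l).
  assert (Hw' : forall n, (N <= n < N + H + L)%nat -> Rabs (w' n - mean n w') <= eps).
  { intros n Hn. replace (w' n - mean n w') with (- (w n - mean n w)); [rewrite Rabs_Ropp; now apply Hw|].
    unfold w', mean. rewrite (rsum_ext (fun l => P n l * - w l) (fun l => -1 * (P n l * w l))) by (intros; ring).
    rewrite rsum_scal. ring. }
  assert (Hlow : forall l, (N + H <= l < N + H + L)%nat -> m - E <= w l).
  { intros l Hl. assert (Q := block_low w m Hw (fun l Hl => proj1 (Hm l Hl)) l ltac:(lia) ltac:(lia)).
    specialize (HE l ltac:(lia)). lra. }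
  assert (Hup : forall l, (N + H <= l < N + H + L)%nat -> w l <= M + E).
  { intros l Hl. assert (Q := block_low w' (- M) Hw' (fun l Hl => Ropp_le_contravar _ _ (proj2 (Hm l Hl))) l ltac:(lia) ltac:(lia)).
    specialize (HE l ltac:(lia)). unfold w' in Q. lra. }
  set (eta := kap / (2 * (1 + Lmb)) * (M - m)).
  assert (HH0 : 0 < INR H) by (apply lt_0_INR; lia).
  assert (Hne : (N + H <= N + H < N + H + L)%nat) by lia.
  destruct (Rle_or_lt (INR H * ((M - m) / 2)) (rsum (fun l => w l - m) (N - 2 * H) H)) as [Hs|Hs].
  - assert (G : forall l, (N + H <= l < N + H + L)%nat -> m + eta - E <= w l).
    { intros l Hl. assert (Q := block_gain w m Hw (fun l Hl => proj1 (Hm l Hl)) (M - m) ltac:(lra) Hs l Hl).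
      specialize (HE l ltac:(lia)). unfold eta. lra. }
    exists (m + eta - E), (M + E). split; [|split].
    + specialize (G _ Hne). specialize (Hup _ Hne). lra.
    + intros l Hl. split; auto.
    + unfold eta, E. lra.
  - assert (Hs' : INR H * ((M - m) / 2) <= rsum (fun l => w' l - - M) (N - 2 * H) H).
    { rewrite (rsum_ext (fun l => w' l - - M) (fun l => -1 * (w l - m) + (M - m))) by (intros; unfold w'; ring).
      rewrite rsum_plus, rsum_scal, rsum_const. lra. }
    assert (G : forall l, (N + H <= l < N + H + L)%nat -> w l <= M - eta + E).
    { intros l Hl. assert (Q := block_gain w' (- M) Hw' (fun l Hl => Ropp_le_contravar _ _ (proj2 (Hm l Hl))) (M - m) ltac:(lra) Hs' l Hl).
      specialize (HE l ltac:(lia)). unfold eta. unfold w' in Q. lra. }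
    exists (m - E), (M - eta + E). split; [|split].
    + specialize (G _ Hne). specialize (Hlow _ Hne). lra.
    + intros l Hl. split; auto.
    + unfold eta, E. lra.
Qed.
End Block.

(** * The averaging kernel *)

Lemma exp_le_1 (x : R) : x <= 0 -> exp x <= 1.
Proof. intros Hx. assert (H := exp_le x 0 Hx). now rewrite exp_0 in H. Qed.

Lemma exp_ge_1 (x : R) : 0 <= x -> 1 <= exp x.
Proof. intros Hx. assert (H := exp_le 0 x Hx). now rewrite exp_0 in H. Qed.

Section Kernel.
Variable k : nat.

(* [F(l + offset)], frozen below [l = k + 1] so that the argument stays positive. *)
Definition model (l : nat) : R := bess (rate k) (INR (Nat.max l (k + 1)) + offset k).

Lemma offset_bounds : - INR (k + 1) / 2 < offset k <= 0.
Proof. unfold offset. rewrite plus_INR. simpl INR. assert (P := pos_INR k). lra. Qed.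

Lemma model_arg (l : nat) : 0 < INR (Nat.max l (k + 1)) + offset k.
Proof.
  assert (B := offset_bounds). assert (H : INR (k + 1) <= INR (Nat.max l (k + 1))) by (apply le_INR; lia).
  assert (1 <= INR (k + 1)) by (apply (le_INR 1); lia). lra.
Qed.

Lemma model_pos (l : nat) : 0 < model l.
Proof. apply bess_pos; [apply rate_pos|]. left. apply model_arg. Qed.

Lemma model_incr (l n : nat) : (l <= n)%nat -> model l <= model n.
Proof.
  intros H. apply bess_incr; [apply rate_pos|]. split; [left; apply model_arg|].
  apply Rplus_le_compat_r, le_INR. lia.
Qed.

Lemma model_large (l : nat) : (k + 1 <= l)%nat -> model l = bess (rate k) (INR l + offset k).
Proof. intros H. unfold model. now rewrite Nat.max_l. Qed.

Lemma eventually_ge (m : nat) : eventually (fun n => (m <= n)%nat).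
Proof. exists m. auto. Qed.

Lemma eventually_INR_ge (c : R) : eventually (fun n => c <= INR n).
Proof.
  destruct (nfloor_ex (Rabs c)) as [m [_ Hm]]; [apply Rabs_pos|].
  exists (S m). intros n Hn. apply Rle_trans with (Rabs c); [apply Rle_abs|].
  apply Rle_trans with (INR (S m)); [rewrite S_INR; lra|now apply le_INR].
Qed.

Lemma ev_nat (P : R -> Prop) : ev P -> eventually (fun n => P (INR n + offset k)).
Proof.
  intros [x0 H]. apply (filter_imp (fun n => x0 - offset k <= INR n)); [|apply eventually_INR_ge].
  intros n Hn. apply H. lra.
Qed.

Lemma ev_root8 (P : R -> Prop) : ev P -> ev (fun x => P (Rpower x (1 / 8))).
Proof.
  intros [X0 H]. set (Y := Rmax X0 1). exists (Y ^ 8). intros x Hx. apply H.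
  assert (Y0 : X0 <= Y) by apply Rmax_l. assert (Y1 : 1 <= Y) by apply Rmax_r.
  apply Rle_trans with Y; [exact Y0|]. assert (P8 : 0 < Y ^ 8) by (apply pow_lt; lra).
  replace Y with (Rpower (Y ^ 8) (1 / 8)).
  - apply Rle_Rpower_l; lra.
  - rewrite <- (Rpower_pow 8) by lra. rewrite Rpower_mult. replace (INR 8 * (1 / 8)) with 1 by (simpl; field).
    apply Rpower_1. lra.
Qed.

(** Here x = n + offset, X = x^(1/8) and J is the integer part of X^5. Terms with j <= J are those
    of [bess_weight_sum], whose factor x - offset is n. Since [model] is increasing, the others,
    including those with frozen values, are bounded by F(x - J). *)
Lemma model_weight_sum (M : nat) : exists C, 0 <= C /\ eventually (fun n =>
  Rabs (rsum (fun l => weight k (n - l) * model l) 0 n - INR n * model n) <= C / INR n ^ M * (INR n * model n)).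
Proof.
  set (A := rate k). assert (HA : 0 < A) by apply rate_pos.
  destruct (bess_weight_sum k (8 * M)) as [C [HC H1]]. fold A in H1.
  (* The extra 16 amounts to two powers of x: the tail has at most n terms with weights up to 4 n^2,
     against one factor n on the right-hand side. *)
  destruct (bess_shift_small A (8 * M + 16) HA) as [D [HD H2]].
  exists (2 ^ M * C + 4 * 2 ^ (M + 2) * D).
  assert (P2M : 0 < 2 ^ M) by (apply pow_lt; lra). assert (P2M2 : 0 < 2 ^ (M + 2)) by (apply pow_lt; lra).
  split. { assert (0 <= 2 ^ M * C) by (apply Rmult_le_pos; lra).
    assert (0 <= 4 * 2 ^ (M + 2) * D) by (apply Rmult_le_pos; lra). lra. }
  assert (EV := ev_and _ _ (ev_and _ _ H1 H2) (ev_ge 2)).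
  apply ev_root8 in EV. apply ev_nat in EV.
  apply (filter_imp _ _) with (2 := filter_and _ _ EV (filter_and _ _ (eventually_ge (2 * k + 2)) (eventually_ge 300))).
  intros n [[[B1 B2] X2] [Hnk Hn300]].
  assert (OB := offset_bounds).
  assert (Hk : INR (2 * k + 2) <= INR n) by now apply le_INR.
  assert (Hn3 : 300 <= INR n) by (apply (le_INR 300) in Hn300; simpl in Hn300; lra).
  replace (INR (2 * k + 2)) with (2 * INR (k + 1)) in Hk by (rewrite !plus_INR, mult_INR; simpl; ring).
  set (x := INR n + offset k) in *.
  assert (Hx : INR n / 2 <= x <= INR n) by (unfold x; lra).
  set (X := Rpower x (1 / 8)) in *.
  assert (E8 : X ^ 8 = x).
  { unfold X. rewrite <- Rpower_pow by apply Rpower_pos. rewrite Rpower_mult.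
    replace (1 / 8 * INR 8) with 1 by (simpl; field). apply Rpower_1. lra. }
  assert (X3 : 8 <= X ^ 3) by (replace 8 with (2 ^ 3) by ring; apply pow_incr; lra).
  assert (X5 : 32 <= X ^ 5) by (replace 32 with (2 ^ 5) by ring; apply pow_incr; lra).
  assert (E85 : x = X ^ 5 * X ^ 3) by (rewrite <- E8; ring).
  destruct (nfloor_ex (X ^ 5)) as [J [HJ1 HJ2]]; [lra|].
  assert (HJ : window J X) by (unfold window; lra).
  assert (HJ8 : X ^ 5 / 2 <= INR J <= x / 2) by (split; [lra|]; rewrite E85; nra).
  specialize (B1 J HJ). rewrite E8 in *. specialize (B2 (INR J) HJ8).
  assert (HJn : (J + (k + 1) <= n)%nat).
  { apply INR_le. rewrite plus_INR. lra. }
  assert (Fn : model n = bess A x) by (apply model_large; lia).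
  assert (Px : 0 < bess A x) by (rewrite <- Fn; apply model_pos).
  assert (ER : rsum (fun l => weight k (n - l) * model l) 0 n = rsum (fun j => weight k j * model (n - j)) 1 n).
  { rewrite rsum_rev.
    transitivity (rsum (fun i => weight k (1 + i) * model (n - (1 + i))) 0 n);
      [|symmetry; exact (rsum_shift (fun j => weight k j * model (n - j)) 0 1 n)].
    apply rsum_ext. intros i Hi. f_equal; f_equal; lia. }
  rewrite ER.
  replace (rsum (fun j => weight k j * model (n - j)) 1 n) with
    (rsum (fun j => weight k j * model (n - j)) 1 (J + (n - J))) by (f_equal; lia).
  rewrite rsum_split.
  rewrite (rsum_ext (fun j => weight k j * model (n - j)) (fun j => weight k j * bess A (x - INR j)) 1 J).
  2:{ intros j Hj. f_equal. rewrite model_large by lia. rewrite minus_INR by lia. fold A. f_equal. unfold x. ring. }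
  set (S1 := rsum (fun j => weight k j * bess A (x - INR j)) 1 J) in *.
  set (S2 := rsum (fun j => weight k j * model (n - j)) (1 + J) (n - J)).
  replace (INR n * model n) with ((x - offset k) * bess A x) at 1 by (rewrite Fn; unfold x; ring).
  assert (HS2 : 0 <= S2 <= INR n * (4 * (INR n * INR n) * (D / X ^ (8 * M + 16) * bess A x))).
  { assert (W : forall j, (1 + J <= j < 1 + J + (n - J))%nat ->
      0 <= weight k j * model (n - j) <= 4 * (INR n * INR n) * (D / X ^ (8 * M + 16) * bess A x)).
    { intros j Hj. assert (W1 := weight_lower k j). assert (W2 := weight_upper k j).
      assert (Pj := pos_INR j). assert (Pm := model_pos (n - j)).
      assert (Hjn : INR j <= INR n) by (apply le_INR; lia).
      split; [apply Rmult_le_pos; lra|].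
      apply Rmult_le_compat; try lra.
      - eapply Rle_trans; [exact W2|]. apply Rmult_le_compat_l; [lra|]. apply Rmult_le_compat; lra.
      - eapply Rle_trans; [|exact B2]. apply Rle_trans with (model (n - J)); [apply model_incr; lia|].
        rewrite model_large by lia. rewrite minus_INR by lia. right. fold A. f_equal. unfold x. ring. }
    unfold S2. split; [apply rsum_pos; intros; now apply W|].
    apply Rle_trans with (rsum (fun _ => 4 * (INR n * INR n) * (D / X ^ (8 * M + 16) * bess A x)) (1 + J) (n - J)).
    - apply rsum_le. intros; now apply W.
    - rewrite rsum_const. apply Rmult_le_compat_r; [|apply le_INR; lia].
      assert (Q := W (1 + J)%nat ltac:(lia)). lra. }
  assert (nM : 0 < INR n ^ M) by (apply pow_lt; lra). assert (nM2 : 0 < INR n ^ (M + 2)) by (apply pow_lt; lra).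
  assert (EX : X ^ (8 * M) = x ^ M) by (rewrite pow_mult, E8; reflexivity).
  assert (EX2 : X ^ (8 * M + 16) = x ^ (M + 2)).
  { replace (8 * M + 16)%nat with (8 * (M + 2))%nat by lia. rewrite pow_mult, E8. reflexivity. }
  rewrite EX in B1. rewrite EX2 in HS2.
  assert (I1 : forall m, / x ^ m <= 2 ^ m / INR n ^ m).
  { intros m. replace (2 ^ m / INR n ^ m) with (/ (INR n / 2) ^ m).
    - apply Rinv_le_contravar; [apply pow_lt; lra|apply pow_incr; lra].
    - unfold Rdiv. rewrite Rpow_mult_distr, pow_inv. field. split; apply pow_nonzero; lra. }
  assert (B1' : C / x ^ M * bess A x <= 2 ^ M * C / INR n ^ M * (INR n * bess A x)).
  { apply Rmult_le_compat; try lra.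
    - apply Rmult_le_pos; [exact HC|]. left. apply Rinv_0_lt_compat, pow_lt. lra.
    - unfold Rdiv in *. replace (2 ^ M * C * / INR n ^ M) with (C * (2 ^ M * / INR n ^ M)) by ring.
      apply Rmult_le_compat_l; [exact HC|apply I1].
    - nra. }
  assert (B2' : INR n * (4 * (INR n * INR n) * (D / x ^ (M + 2) * bess A x)) <= 4 * 2 ^ (M + 2) * D / INR n ^ M * (INR n * bess A x)).
  { replace (4 * 2 ^ (M + 2) * D / INR n ^ M * (INR n * bess A x)) with
      (INR n * (4 * (INR n * INR n) * (D * (2 ^ (M + 2) / INR n ^ (M + 2)) * bess A x)))
      by (rewrite (pow_add (INR n) M 2); field; lra).
    apply Rmult_le_compat_l; [lra|]. apply Rmult_le_compat_l; [nra|]. apply Rmult_le_compat_r; [lra|].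
    unfold Rdiv at 1. apply Rmult_le_compat_l; [exact HD|apply I1]. }
  rewrite Fn.
  replace (S1 + S2 - (x - offset k) * bess A x) with ((S1 - (x - offset k) * bess A x) + S2) by ring.
  eapply Rle_trans; [apply Rabs_triang|]. rewrite (Rabs_pos_eq S2) by lra.
  replace ((2 ^ M * C + 4 * 2 ^ (M + 2) * D) / INR n ^ M * (INR n * bess A x)) with
    (2 ^ M * C / INR n ^ M * (INR n * bess A x) + 4 * 2 ^ (M + 2) * D / INR n ^ M * (INR n * bess A x)) by (field; lra).
  lra.
Qed.

Lemma Rpower_half_sq (x : R) : 0 < x -> Rpower x (- (1 / 2)) * Rpower x (- (1 / 2)) = / x.
Proof.
  intros Hx. rewrite <- Rpower_plus. replace (- (1 / 2) + - (1 / 2)) with (- (1)) by field.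
  rewrite Rpower_Ropp, Rpower_1; auto.
Qed.

(** Over a distance of order sqrt n the logarithm of F changes by a bounded amount. The constant 18
    = 2 * 3^2 fits distances up to 3 T^5 with T^10 <= 2n. *)
Lemma model_ratio : exists c, 0 < c <= 1 /\ eventually (fun n => forall i,
  INR i * INR i <= 18 * INR n -> c * model n <= model (n - i)).
Proof.
  set (A := rate k). assert (HA : 0 < A) by apply rate_pos.
  assert (HsA : 0 < sqrt A) by now apply sqrt_lt_R0.
  exists (exp (- (4 * sqrt A) * 6)). split.
  { split; [apply exp_pos|]. rewrite <- exp_0. apply exp_le. lra. }
  assert (EV := ev_nat _ (bess_ratio A HA)).
  apply (filter_imp _ _) with (2 := filter_and _ _ EV (filter_and _ _ (eventually_ge (4 * k + 4)) (eventually_INR_ge 300))).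
  intros n [R [Hnk Hn]] i Hi.
  assert (OB := offset_bounds).
  assert (Hk : INR (4 * k + 4) <= INR n) by now apply le_INR.
  replace (INR (4 * k + 4)) with (4 * INR (k + 1)) in Hk by (rewrite !plus_INR, mult_INR; simpl; ring).
  set (x := INR n + offset k) in *.
  assert (Hx : 3 / 4 * INR n <= x <= INR n) by (unfold x; lra).
  assert (Pi := pos_INR i).
  assert (Hi4 : INR i <= INR n / 4) by nra.
  destruct (R (INR i) ltac:(lra)) as [R1 _].
  assert (Hin : (i + (k + 1) <= n)%nat) by (apply INR_le; rewrite plus_INR; lra).
  rewrite !model_large by lia. rewrite minus_INR by lia. fold A x.
  replace (INR n - INR i + offset k) with (x - INR i) by (unfold x; ring).
  eapply Rle_trans; [|exact R1]. rewrite Rmult_comm. apply Rmult_le_compat_l.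
  { left. apply bess_pos; [exact HA|lra]. }
  apply exp_le.
  assert (Q := Rpower_half_sq x ltac:(lra)). assert (Pr := Rpower_pos x (- (1 / 2))).
  set (r := Rpower x (- (1 / 2))) in *.
  assert (Hir : INR i * r <= 6).
  { apply Rsqr_incr_0_var; [|lra]. unfold Rsqr.
    replace (INR i * r * (INR i * r)) with (INR i * INR i * (r * r)) by ring. rewrite Q.
    apply Rmult_le_reg_r with x; [lra|]. rewrite Rmult_assoc, Rinv_l by lra. lra. }
  nra.
Qed.

(** T^6 exceeds sqrt n, which is of order T^5, by a factor of order T, so that F drops by exp(- c
    T). The bound n <= 1024 T^10 gives n^(-1/2) >= 1 / (32 T^5). *)
Lemma model_tail (M : nat) : exists C T0, 0 <= C /\ forall T n i, (T0 <= T)%nat ->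
  INR T ^ 10 <= 2 * INR n -> INR n <= 1024 * INR T ^ 10 -> (T ^ 6 <= i <= n)%nat ->
  model (n - i) <= C / INR T ^ M * model n.
Proof.
  set (A := rate k). assert (HA : 0 < A) by apply rate_pos.
  assert (HsA : 0 < sqrt A) by now apply sqrt_lt_R0.
  destruct (exp_neg_X (sqrt A / 64) M ltac:(lra)) as [C [HC HE]].
  assert (EV := ev_nat _ (bess_ratio A HA)).
  destruct (filter_and _ _ EV (filter_and _ _ (eventually_ge (4 * k + 4)) (eventually_INR_ge 300))) as [n1 H].
  exists C, (n1 + 4)%nat. split; [exact HC|]. intros T n i HT H1 H2 Hi.
  assert (HT4 : 4 <= INR T) by (apply Rle_trans with (INR 4); [simpl; lra|apply le_INR; lia]).
  assert (T10 : INR T <= INR T ^ 10 / 2).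
  { assert (INR T ^ 2 <= INR T ^ 10) by (apply Rle_pow; [lra|lia]). replace (INR T ^ 2) with (INR T * INR T) in * by ring. nra. }
  assert (Hnn : (n1 <= n)%nat).
  { apply INR_le. apply Rle_trans with (INR T); [apply le_INR; lia|lra]. }
  destruct (H n Hnn) as [R [Hnk Hn]].
  assert (OB := offset_bounds).
  assert (Hk : INR (4 * k + 4) <= INR n) by now apply le_INR.
  replace (INR (4 * k + 4)) with (4 * INR (k + 1)) in Hk by (rewrite !plus_INR, mult_INR; simpl; ring).
  set (x := INR n + offset k) in *.
  assert (Hx : 3 / 4 * INR n <= x <= INR n) by (unfold x; lra).
  set (t := INR T) in *.
  assert (t4 : 256 <= t ^ 4) by (replace 256 with (4 ^ 4) by ring; apply pow_incr; lra).
  assert (t6 : 0 < t ^ 6) by (apply pow_lt; lra).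
  assert (t5 : 0 < t ^ 5) by (apply pow_lt; lra).
  assert (E10 : t ^ 10 = t ^ 4 * t ^ 6) by ring.
  assert (Ht6 : t ^ 6 <= INR n / 8) by nra.
  destruct (R (t ^ 6) ltac:(lra)) as [_ R2].
  assert (E6 : INR (T ^ 6) = t ^ 6) by apply pow_INR.
  assert (Hin : (T ^ 6 + (k + 1) <= n)%nat) by (apply INR_le; rewrite plus_INR, E6; lra).
  apply Rle_trans with (model (n - T ^ 6)); [apply model_incr; lia|].
  rewrite !model_large by lia. rewrite minus_INR by lia. fold A x. rewrite E6.
  replace (INR n - t ^ 6 + offset k) with (x - t ^ 6) by (unfold x; ring).
  assert (Px : 0 < bess A x) by (apply bess_pos; [exact HA|lra]).
  eapply Rle_trans; [exact R2|]. rewrite Rmult_comm. apply Rmult_le_compat_r; [lra|].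
  eapply Rle_trans; [|apply HE; lra]. apply exp_le.
  assert (Q := Rpower_half_sq x ltac:(lra)). assert (Pr := Rpower_pos x (- (1 / 2))).
  set (r := Rpower x (- (1 / 2))) in *.
  assert (Hr : / (32 * t ^ 5) <= r).
  { apply Rsqr_incr_0_var; [|lra]. unfold Rsqr. rewrite Q.
    replace (/ (32 * t ^ 5) * / (32 * t ^ 5)) with (/ (1024 * t ^ 10)) by (field; lra).
    apply Rinv_le_contravar; lra. }
  assert (t / 32 <= t ^ 6 * r).
  { apply Rle_trans with (t ^ 6 * / (32 * t ^ 5)); [right; field; lra|]. apply Rmult_le_compat_l; lra. }
  nra.
Qed.

(** A Tauberian bound: at u = 1 / J the series [weight_sum] is O(J^2), and each j <= J enters it
    with a factor at least 1 / e >= 1/3. The pointwise bound would only give J^3, too much for the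
    contraction rate. *)
Lemma weight_cumulative : exists C, 0 < C /\ eventually (fun J =>
  rsum (weight k) 1 J <= C * (INR J * INR J)).
Proof.
  destruct (weight_sum_asymptotic k 0) as [C [u0 [HC [Hu0 H]]]].
  assert (HA := rate_pos k). assert (OB := offset_bounds).
  exists (3 * (rate k + INR (k + 1) + C)).
  assert (Pk : 1 <= INR (k + 1)) by (apply (le_INR 1); lia). split; [lra|].
  apply (filter_imp _ _) with (2 := filter_and _ _ (eventually_ge 1) (eventually_INR_ge (/ u0))).
  intros J [HJ1 HJ]. assert (J1 : 1 <= INR J) by now apply (le_INR 1).
  set (u := / INR J). assert (Hu : 0 < u) by (apply Rinv_0_lt_compat; lra).
  assert (Huu : u <= u0).
  { unfold u. rewrite <- (Rinv_inv u0). apply Rinv_le_contravar; [now apply Rinv_0_lt_compat|exact HJ]. }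
  specialize (H u ltac:(lra)). simpl in H. rewrite Rmult_1_r in H. apply Rabs_le_between in H.
  assert (L : rsum (fun n => weight k n * exp (- (INR n * u))) 1 J <= weight_sum k u).
  { apply (is_lim_seq_incr_compare _ _ (weight_sum_lim k u Hu)). intros n. cbn [rsum].
    assert (W := weight_lower k (1 + n)). assert (P := pos_INR (1 + n)).
    assert (0 <= weight k (1 + n) * exp (- (INR (1 + n) * u))); [|lra].
    apply Rmult_le_pos; [lra|left; apply exp_pos]. }
  assert (L2 : rsum (weight k) 1 J <= 3 * rsum (fun n => weight k n * exp (- (INR n * u))) 1 J).
  { rewrite <- rsum_scal. apply rsum_le. intros j Hj.
    assert (W := weight_lower k j). assert (P := pos_INR j).
    assert (Hju : INR j * u <= 1).
    { unfold u. apply Rmult_le_reg_r with (INR J); [lra|]. rewrite Rmult_assoc, Rinv_l by lra.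
      rewrite Rmult_1_r, Rmult_1_l. apply le_INR. lia. }
    assert (E1 : / 3 <= exp (- (INR j * u))).
    { apply Rle_trans with (exp (- (1))); [|apply exp_le; lra]. rewrite exp_Ropp.
      apply Rinv_le_contravar; [apply exp_pos|apply exp_le_3]. }
    assert (weight k j * / 3 <= weight k j * exp (- (INR j * u))) by (apply Rmult_le_compat_l; lra). lra. }
  eapply Rle_trans; [exact L2|]. rewrite (Rmult_assoc 3). apply Rmult_le_compat_l; [lra|].
  eapply Rle_trans; [exact L|].
  replace (rate k / (u * u)) with (rate k * (INR J * INR J)) in H by (unfold u; field; lra).
  assert (0 < 1 / u) by (apply Rdiv_lt_0_compat; lra).
  assert (1 <= INR J * INR J) by nra.
  assert (INR (k + 1) + C <= (INR (k + 1) + C) * (INR J * INR J)) by nra.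
  lra.
Qed.

Definition ratio (n : nat) : R := broken_diamond k n / model n.

Lemma ratio_model (n : nat) : model n * ratio n = broken_diamond k n.
Proof. unfold ratio. field. apply Rgt_not_eq, model_pos. Qed.

Lemma ratio_pos (n : nat) : 0 < ratio n.
Proof. apply Rdiv_lt_0_compat; [apply broken_diamond_pos|apply model_pos]. Qed.

Lemma ratio_rec (n : nat) :
  INR n * model n * ratio n = rsum (fun l => (weight k (n - l) * model l) * ratio l) 0 n.
Proof.
  rewrite Rmult_assoc, ratio_model, broken_diamond_rec. apply rsum_ext. intros l _.
  now rewrite Rmult_assoc, ratio_model.
Qed.

Lemma kernel_nonneg (n l : nat) : 0 <= weight k (n - l) * model l.
Proof.
  assert (W := weight_lower k (n - l)). assert (P := pos_INR (n - l)). assert (Q := model_pos l).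
  apply Rmult_le_pos; lra.
Qed.

Lemma seq_bounds (v : nat -> R) (N : nat) : (forall n, 0 < v n) ->
  exists a b, 0 < a /\ a <= b /\ forall n, (n < N)%nat -> a <= v n <= b.
Proof.
  intros Hv. induction N as [|N [a [b [Ha [Hab H]]]]].
  - exists 1, 1. repeat split; try lra; intros; lia.
  - exists (Rmin a (v N)), (Rmax b (v N)). split; [apply Rmin_glb_lt; auto|]. split.
    + apply Rle_trans with a; [apply Rmin_l|]. apply Rle_trans with b; [exact Hab|apply Rmax_l].
    + intros n Hn. destruct (Nat.eq_dec n N) as [->|Hne].
      * split; [apply Rmin_r|apply Rmax_r].
      * specialize (H n ltac:(lia)). split.
        -- apply Rle_trans with a; [apply Rmin_l|apply H].
        -- apply Rle_trans with b; [apply H|apply Rmax_l].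
Qed.

(* The relative errors [C / n ^ 2] telescope against [4 C / (n + 1)]. *)
Lemma ratio_bounded : exists a b, 0 < a /\ forall n, a <= ratio n <= b.
Proof.
  destruct (model_weight_sum 2) as [C [HC H]].
  destruct (filter_and _ _ H (filter_and _ _ (eventually_ge 1) (eventually_INR_ge (2 * C + 1)))) as [N HN].
  destruct (seq_bounds ratio N ratio_pos) as [a0 [b0 [Ha0 [Hab Hb]]]].
  set (up := fun n => (b0 * exp (4 * C)) * exp (- (4 * C / (INR n + 1)))).
  set (lo := fun n => (a0 * exp (- (4 * C))) * exp (4 * C / (INR n + 1))).
  assert (Hfrac : forall n, 0 <= 4 * C / (INR n + 1) <= 4 * C).
  { intros n. assert (P := pos_INR n). split; [apply Rdiv_le_0_compat; lra|].
    apply Rmult_le_reg_r with (INR n + 1); [lra|]. unfold Rdiv. rewrite Rmult_assoc, Rinv_l by lra.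
    assert (0 <= C * INR n) by (apply Rmult_le_pos; lra). lra. }
  assert (Hmono : forall l n, (l < n)%nat -> 4 * C / INR n <= 4 * C / (INR l + 1)).
  { intros l n Hl. assert (P := pos_INR l). assert (INR l + 1 <= INR n) by (rewrite <- S_INR; now apply le_INR).
    apply Rmult_le_compat_l; [lra|]. apply Rinv_le_contravar; lra. }
  assert (K : forall n, lo n <= ratio n <= up n).
  { induction n as [n IH] using (well_founded_induction lt_wf).
    destruct (Nat.lt_ge_cases n N) as [Hlt|Hge].
    - specialize (Hb n Hlt). specialize (Hfrac n). unfold lo, up. split.
      + rewrite Rmult_assoc, <- exp_plus. apply Rle_trans with (a0 * 1); [|lra].
        apply Rmult_le_compat_l; [lra|]. apply exp_le_1. lra.
      + rewrite Rmult_assoc, <- exp_plus. apply Rle_trans with (b0 * 1); [lra|].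
        apply Rmult_le_compat_l; [lra|]. apply exp_ge_1. lra.
    - destruct (HN n Hge) as [S [Hn1 HnC]]. assert (N1 : 1 <= INR n) by now apply (le_INR 1).
      assert (Pm := model_pos n).
      set (nf := INR n * model n) in *. assert (Hnf : 0 < nf) by (apply Rmult_lt_0_compat; lra).
      set (s := rsum (fun l => weight k (n - l) * model l) 0 n) in *.
      set (d := C / INR n ^ 2) in *.
      assert (n2 : 0 < INR n ^ 2) by (apply pow_lt; lra).
      assert (Hd0 : 0 <= d) by (apply Rdiv_le_0_compat; lra).
      assert (Hd2 : d <= 1 / 2).
      { unfold d. apply Rmult_le_reg_r with (INR n ^ 2); [exact n2|].
        unfold Rdiv. rewrite Rmult_assoc, Rinv_l by lra. simpl. nra. }
      assert (Hdd : 2 * d <= 4 * C / INR n - 4 * C / (INR n + 1)).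
      { unfold d. replace (4 * C / INR n - 4 * C / (INR n + 1)) with (4 * C / (INR n * (INR n + 1))) by (field; lra).
        apply Rmult_le_reg_r with (INR n ^ 2 * (INR n + 1)); [apply Rmult_lt_0_compat; lra|].
        replace (2 * (C / INR n ^ 2) * (INR n ^ 2 * (INR n + 1))) with (2 * C * (INR n + 1)) by (field; lra).
        replace (4 * C / (INR n * (INR n + 1)) * (INR n ^ 2 * (INR n + 1))) with (4 * C * INR n) by (field; lra).
        nra. }
      apply Rabs_le_between in S.
      assert (R := ratio_rec n). fold nf in R.
      assert (Lo : s * ((a0 * exp (- (4 * C))) * exp (4 * C / INR n)) <= nf * ratio n).
      { rewrite R, Rmult_comm. unfold s. rewrite <- rsum_scal. apply rsum_le. intros l Hl.
        rewrite Rmult_comm. apply Rmult_le_compat_l; [apply kernel_nonneg|].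
        eapply Rle_trans; [|apply IH; lia]. unfold lo. apply Rmult_le_compat_l.
        - apply Rmult_le_pos; [lra|left; apply exp_pos].
        - apply exp_le, Hmono. lia. }
      assert (Up : nf * ratio n <= s * ((b0 * exp (4 * C)) * exp (- (4 * C / INR n)))).
      { rewrite R, (Rmult_comm s). unfold s. rewrite <- rsum_scal. apply rsum_le. intros l Hl.
        rewrite (Rmult_comm (b0 * _ * _)). apply Rmult_le_compat_l; [apply kernel_nonneg|].
        eapply Rle_trans; [apply IH; lia|]. unfold up. apply Rmult_le_compat_l.
        - apply Rmult_le_pos; [lra|left; apply exp_pos].
        - apply exp_le, Ropp_le_contravar, Hmono. lia. }
      assert (E1 : 1 + d <= exp (2 * d)) by (assert (Q := exp_ineq1_le (2 * d)); lra).
      assert (E2 : exp (- (2 * d)) <= 1 - d).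
      { assert (Q := exp_ineq1_le (2 * d)). rewrite exp_Ropp.
        apply Rmult_le_reg_r with (exp (2 * d)); [apply exp_pos|]. rewrite Rinv_l by (apply Rgt_not_eq, exp_pos).
        assert (1 <= (1 - d) * (1 + 2 * d)) by nra.
        assert ((1 - d) * (1 + 2 * d) <= (1 - d) * exp (2 * d)) by (apply Rmult_le_compat_l; lra). lra. }
      set (U := b0 * exp (4 * C)) in *. set (V := a0 * exp (- (4 * C))) in *.
      assert (HU : 0 < U) by (apply Rmult_lt_0_compat; [lra|apply exp_pos]).
      assert (HV : 0 < V) by (apply Rmult_lt_0_compat; [lra|apply exp_pos]).
      assert (X1 := exp_pos (4 * C / INR n)). assert (X2 := exp_pos (- (4 * C / INR n))).
      unfold lo, up. fold U V. split.
      + apply Rmult_le_reg_l with nf; [exact Hnf|]. eapply Rle_trans; [|exact Lo].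
        apply Rle_trans with ((nf * (1 - d)) * (V * exp (4 * C / INR n))).
        * replace (nf * (V * exp (4 * C / (INR n + 1)))) with (nf * V * exp (4 * C / (INR n + 1))) by ring.
          replace (nf * (1 - d) * (V * exp (4 * C / INR n))) with (nf * V * ((1 - d) * exp (4 * C / INR n))) by ring.
          apply Rmult_le_compat_l; [apply Rmult_le_pos; lra|].
          apply Rle_trans with (exp (- (2 * d)) * exp (4 * C / INR n)); [|apply Rmult_le_compat_r; lra].
          rewrite <- exp_plus. apply exp_le. lra.
        * apply Rmult_le_compat_r; [apply Rmult_le_pos; lra|]. lra.
      + apply Rmult_le_reg_l with nf; [exact Hnf|]. eapply Rle_trans; [exact Up|].
        apply Rle_trans with ((nf * (1 + d)) * (U * exp (- (4 * C / INR n)))).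
        * apply Rmult_le_compat_r; [apply Rmult_le_pos; lra|]. lra.
        * replace (nf * (U * exp (- (4 * C / (INR n + 1))))) with (nf * U * exp (- (4 * C / (INR n + 1)))) by ring.
          replace (nf * (1 + d) * (U * exp (- (4 * C / INR n)))) with (nf * U * ((1 + d) * exp (- (4 * C / INR n)))) by ring.
          apply Rmult_le_compat_l; [apply Rmult_le_pos; lra|].
          apply Rle_trans with (exp (2 * d) * exp (- (4 * C / INR n))); [apply Rmult_le_compat_r; lra|].
          rewrite <- exp_plus. apply exp_le. lra. }
  exists (a0 * exp (- (4 * C))), (b0 * exp (4 * C)). split; [apply Rmult_lt_0_compat; [lra|apply exp_pos]|].
  intros n. specialize (K n). specialize (Hfrac n). unfold lo, up in K. split.
  - eapply Rle_trans; [|apply K]. rewrite <- Rmult_1_r at 1. apply Rmult_le_compat_l.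
    + apply Rmult_le_pos; [lra|left; apply exp_pos].
    + apply exp_ge_1. lra.
  - eapply Rle_trans; [apply K|]. rewrite <- Rmult_1_r. apply Rmult_le_compat_l.
    + apply Rmult_le_pos; [lra|left; apply exp_pos].
    + apply exp_le_1. lra.
Qed.
End Kernel.

(** * Oscillation of the ratio on blocks *)

Section Increment.
Variable k : nat.

Let kernel (n l : nat) : R := weight k (n - l) * model k l.

(* [T] fixes the scale: times [n] of order [T ^ 10], steps of order [T ^ 5], windows of length [T ^ 6]. *)
Definition at_scale (T n : nat) : Prop := INR T ^ 10 <= 2 * INR n /\ INR n <= 1024 * INR T ^ 10.

(** Indices at distance at least T^6 are negligible by [model_tail], whose exponent M + 20 pays for
    weights of size n^2, of order T^20. The window therefore carries the whole kernel up to a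
    relative error T^(- M). *)
Lemma kernel_window (M : nat) : exists C T0, 0 <= C /\ forall T n a, (T0 <= T)%nat -> at_scale T n ->
  (a + T ^ 6 <= n)%nat ->
  0 <= rsum (kernel n) 0 a <= C / INR T ^ M * (INR n * model k n) /\
  Rabs (rsum (kernel n) a (n - a) - INR n * model k n) <= C / INR T ^ M * (INR n * model k n).
Proof.
  destruct (model_weight_sum k M) as [C1 [HC1 [N1 H1]]].
  destruct (model_tail k (M + 20)) as [C2 [T2 [HC2 H2]]].
  set (D := 4 * 1024 ^ 2 * C2).
  assert (HD : 0 <= D) by (unfold D; lra).
  exists (D + 2 ^ M * C1), (T2 + N1 + 2)%nat.
  assert (P2 : 0 < 2 ^ M) by (apply pow_lt; lra).
  assert (HCC : 0 <= 2 ^ M * C1) by (apply Rmult_le_pos; lra). split; [lra|].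
  intros T n a HT [S1 S2] Ha.
  assert (HTR : 2 <= INR T) by (apply (le_INR 2); lia). set (t := INR T) in *.
  assert (t9 : 2 <= t ^ 9).
  { apply Rle_trans with (2 ^ 9); [simpl; lra|apply pow_incr; lra]. }
  assert (Hnt : t <= INR n) by (assert (t ^ 10 = t * t ^ 9) by ring; nra).
  assert (HnN : (N1 <= n)%nat) by (apply INR_le; apply Rle_trans with t; [apply le_INR; lia|lra]).
  specialize (H1 n HnN). fold (kernel n) in H1.
  assert (Pm := model_pos k n). assert (N0 : 0 < INR n) by lra.
  set (nf := INR n * model k n) in *. assert (Hnf : 0 < nf) by now apply Rmult_lt_0_compat.
  assert (tM : 0 < t ^ M) by (apply pow_lt; lra). assert (t20 : 0 < t ^ 20) by (apply pow_lt; lra).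
  assert (A1 : 0 <= rsum (kernel n) 0 a <= D / t ^ M * nf).
  { assert (W : forall l, (l < a)%nat -> 0 <= kernel n l <= 4 * (INR n * INR n) * (C2 / t ^ (M + 20) * model k n)).
    { intros l Hl. split; [apply kernel_nonneg|]. unfold kernel.
      assert (W1 := weight_lower k (n - l)). assert (W2 := weight_upper k (n - l)).
      assert (Pl := pos_INR (n - l)). assert (Q := model_pos k l).
      assert (Hl' : INR (n - l) <= INR n) by (apply le_INR; lia).
      apply Rmult_le_compat; try lra.
      - eapply Rle_trans; [exact W2|]. apply Rmult_le_compat_l; [lra|]. apply Rmult_le_compat; lra.
      - replace l with (n - (n - l))%nat by lia. apply (H2 T n (n - l)%nat); [lia|exact S1|exact S2|lia]. }
    split; [apply rsum_pos; intros l Hl; apply W; lia|].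
    apply Rle_trans with (rsum (fun _ => 4 * (INR n * INR n) * (C2 / t ^ (M + 20) * model k n)) 0 a).
    - apply rsum_le. intros l Hl. apply W; lia.
    - rewrite rsum_const. apply Rle_trans with (INR n * (4 * (INR n * INR n) * (C2 / t ^ (M + 20) * model k n))).
      + apply Rmult_le_compat_r; [|apply le_INR; lia].
        assert (0 <= C2 / t ^ (M + 20)) by (apply Rdiv_le_0_compat; [lra|apply pow_lt; lra]).
        apply Rmult_le_pos; [nra|apply Rmult_le_pos; lra].
      + assert (E : INR n * INR n <= 1024 ^ 2 * t ^ 20).
        { replace (1024 ^ 2 * t ^ 20) with ((1024 * t ^ 10) * (1024 * t ^ 10)) by ring.
          apply Rmult_le_compat; lra. }
        apply Rle_trans with (4 * (C2 / t ^ (M + 20)) * nf * (INR n * INR n)); [right; unfold nf; ring|].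
        apply Rle_trans with (4 * (C2 / t ^ (M + 20)) * nf * (1024 ^ 2 * t ^ 20)).
        * apply Rmult_le_compat_l; [|exact E].
          assert (0 <= C2 / t ^ (M + 20)) by (apply Rdiv_le_0_compat; [lra|apply pow_lt; lra]).
          apply Rmult_le_pos; lra.
        * right. unfold D. rewrite pow_add. field. lra. }
  assert (A2 : C1 / INR n ^ M * nf <= 2 ^ M * C1 / t ^ M * nf).
  { apply Rmult_le_compat_r; [lra|]. unfold Rdiv. rewrite (Rmult_comm (2 ^ M)), Rmult_assoc.
    apply Rmult_le_compat_l; [exact HC1|].
    apply Rle_trans with (/ t ^ M).
    - apply Rinv_le_contravar; [exact tM|]. apply pow_incr. lra.
    - rewrite <- (Rmult_1_l (/ t ^ M)) at 1. apply Rmult_le_compat_r; [left; now apply Rinv_0_lt_compat|].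
      apply pow_R1_Rle. lra. }
  assert (E : (D + 2 ^ M * C1) / t ^ M * nf = D / t ^ M * nf + 2 ^ M * C1 / t ^ M * nf) by (field; lra).
  assert (0 <= 2 ^ M * C1 / t ^ M * nf).
  { apply Rmult_le_pos; [|lra]. apply Rdiv_le_0_compat; lra. }
  rewrite E. split; [lra|].
  replace (rsum (kernel n) a (n - a)) with (rsum (kernel n) 0 n - rsum (kernel n) 0 a).
  - change (rsum (fun l => weight k (n - l) * model k l) 0 n) with (rsum (kernel n) 0 n) in H1.
    apply Rabs_le_between in H1. apply Rabs_le. lra.
  - assert (RS : rsum (kernel n) 0 n = rsum (kernel n) 0 a + rsum (kernel n) a (n - a)).
    { rewrite <- (rsum_split (kernel n) 0 a). f_equal. lia. }
    rewrite RS. ring.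
Qed.

(** [block_contract] with H = T^5 and L = T^6. The length H is of order sqrt n, where [model] varies
    by a bounded factor, so the overlap constant does not depend on T; the longer L costs a factor
    [Lmb] of order (L / H)^2 = T^2. *)
Lemma ratio_block (M : nat) : exists c C T0, 0 < c <= 1 /\ 0 <= C /\ forall T N m Mx, (T0 <= T)%nat ->
  at_scale T N -> at_scale T (N + T ^ 5 + T ^ 6) -> m <= Mx ->
  (forall l, (N - T ^ 6 <= l < N)%nat -> m <= ratio k l <= Mx) ->
  exists m' M', m' <= M' /\
    (forall l, (N + T ^ 5 <= l < N + T ^ 5 + T ^ 6)%nat -> m' <= ratio k l <= M') /\
    M' - m' <= (1 - c / INR T ^ 2) * (Mx - m) + C / INR T ^ M.
Proof.
  destruct (ratio_bounded k) as [ra [rb [Hra Hrb]]].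
  (* The extra 6 pays for the errors accumulated over H + L <= 2 T^6 indices. *)
  destruct (kernel_window (M + 6)) as [C [T1 [HC HK]]].
  destruct (model_ratio k) as [cr [Hcr [N2 HR]]].
  destruct (weight_cumulative k) as [Cw [HCw [J0 HW]]].
  assert (Hrb0 : 0 < rb) by (specialize (Hrb 0%nat); lra).
  destruct (ev_and _ _ (ev_inv_small C (1 / 2) (M + 5) ltac:(lra)) (ev_ge 4)) as [t0 Ht0].
  destruct (nfloor_ex (Rabs t0)) as [T2 [_ HT2]]; [apply Rabs_pos|].
  (* 2048 = 2 * 1024 from Z n <= 2 n model(n) and n <= 1024 H^2. 18 = 2 * 3^2 compares the weights
     up to distance 3L, at most Cw (3 T^6)^2 in all, with the triangular sum T^10 / 2 on [N, N +
     H). *)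
  set (kap := cr / 2048). set (Lc := 18 * Cw).
  assert (Hkap : 0 < kap) by (unfold kap; lra).
  set (c := kap / (2 * (1 + Lc))).
  exists c, (8 * C * rb + 8 * C * rb), (T1 + N2 + J0 + T2 + 4)%nat.
  assert (HCr : 0 <= C * rb) by (apply Rmult_le_pos; lra).
  split; [|split; [lra|]].
  { unfold c. split; [apply Rdiv_lt_0_compat; unfold Lc; lra|].
    apply Rmult_le_reg_r with (2 * (1 + Lc)); [unfold Lc; lra|].
    unfold Rdiv at 1. rewrite Rmult_assoc, Rinv_l by (unfold Lc; lra). unfold kap, Lc. lra. }
  intros T N m Mx HT HS1 HS2 HmM Hm.
  assert (HTt : Rabs t0 <= INR T).
  { apply Rle_trans with (INR (S T2)); [rewrite S_INR; lra|apply le_INR; lia]. }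
  assert (Qt := Rle_abs t0). destruct (Ht0 (INR T) ltac:(lra)) as [Hsmall Ht4].
  set (t := INR T) in *.
  set (H := (T ^ 5)%nat). set (L := (T ^ 6)%nat).
  assert (EH : INR H = t ^ 5) by apply pow_INR. assert (EL : INR L = t ^ 6) by apply pow_INR.
  assert (t5 : 4 <= t ^ 5) by (apply Rle_trans with (4 ^ 5); [simpl; lra|apply pow_incr; lra]).
  assert (E65 : t ^ 6 = t * t ^ 5) by ring. assert (E10 : t ^ 10 = t ^ 5 * t ^ 5) by ring.
  assert (HT4 : (4 <= T)%nat) by lia.
  assert (HH1 : (4 <= H)%nat) by (apply INR_le; rewrite EH; simpl; lra).
  assert (HL2 : (4 * H <= L)%nat).
  { unfold L. rewrite (Nat.pow_succ_r' T 5). now apply Nat.mul_le_mono_r. }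
  assert (Scale : forall n, (N <= n <= N + H + L)%nat -> at_scale T n).
  { intros n Hn. destruct HS1 as [A1 A2], HS2 as [B1 B2].
    assert (INR N <= INR n) by (apply le_INR; lia).
    assert (INR n <= INR (N + H + L)) by (apply le_INR; lia). fold H L in B2. split; lra. }
  assert (HNL : (4 * L <= N)%nat).
  { apply INR_le. rewrite mult_INR, EL. simpl INR. destruct HS1 as [A1 _]. fold t in A1.
    assert (32 <= t ^ 4) by (apply Rle_trans with (4 ^ 4); [simpl; lra|apply pow_incr; lra]).
    replace (t ^ 10) with (t ^ 4 * t ^ 6) in A1 by ring.
    assert (0 < t ^ 6) by (apply pow_lt; lra). nra. }
  assert (HTL : (T <= L)%nat).
  { unfold L. rewrite (Nat.pow_succ_r' T 5). fold H.
    rewrite <- (Nat.mul_1_r T) at 1. apply Nat.mul_le_mono_l. lia. }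
  assert (Hbig : forall n, (N <= n)%nat -> (T <= n)%nat) by (intros; lia).
  set (d := C / t ^ (M + 6)).
  assert (Hd0 : 0 <= d) by (apply Rdiv_le_0_compat; [exact HC|apply pow_lt; lra]).
  assert (Hd : d <= 1 / 2) by (unfold d; replace (M + 6)%nat with (S (M + 5)) by lia; exact Hsmall).
  set (Z := fun n => rsum (kernel n) (N - L) (n - (N - L))).
  assert (HZ : forall n, (N <= n <= N + H + L)%nat ->
    0 <= rsum (kernel n) 0 (N - L) <= d * (INR n * model k n) /\
    Rabs (Z n - INR n * model k n) <= d * (INR n * model k n)).
  { intros n Hn. apply (HK T n (N - L)%nat); [lia|now apply Scale|fold L; lia]. }
  assert (Hnf : forall n, (N <= n)%nat -> 0 < INR n * model k n).
  { intros n Hn. apply Rmult_lt_0_compat; [apply lt_0_INR; lia|apply model_pos]. }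
  assert (HZ2 : forall n, (N <= n <= N + H + L)%nat -> INR n * model k n / 2 <= Z n <= 2 * (INR n * model k n)).
  { intros n Hn. destruct (HZ n Hn) as [_ Q]. apply Rabs_le_between in Q. specialize (Hnf n ltac:(lia)). nra. }
  set (P := fun n l => kernel n l / Z n).
  assert (Kn : forall n l, 0 <= kernel n l) by (intros; apply kernel_nonneg).
  assert (Zp : forall n, (N <= n <= N + H + L)%nat -> 0 < Z n).
  { intros n Hn. specialize (HZ2 n Hn). specialize (Hnf n ltac:(lia)). lra. }
  assert (Pscal : forall n a len v, rsum (fun l => P n l * v l) a len = / Z n * rsum (fun l => kernel n l * v l) a len).
  { intros n a len v. rewrite <- rsum_scal. apply rsum_ext. intros l _. unfold P, Rdiv. ring. }
  destruct (block_contract P N H L kap (Lc * t ^ 2) (4 * d * rb)) with (w := ratio k) (m := m) (M := Mx)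
    as [m' [M' [Hmm [Hw' Hc]]]].
  - lia.
  - lia.
  - lia.
  - exact Hkap.
  - apply Rmult_le_pos; [unfold Lc; lra|apply pow_le; lra].
  - apply Rmult_le_pos; lra.
  - intros n l Hn Hl. apply Rdiv_le_0_compat; [apply Kn|apply Zp; lia].
  - intros n Hn. rewrite Pscal. rewrite (rsum_ext _ (kernel n)) by (intros; ring). fold (Z n).
    apply Rinv_l, Rgt_not_eq, Zp. lia.
  - intros n l Hn Hl. assert (Sn := Scale n ltac:(lia)). destruct Sn as [_ Sn]. fold t in Sn.
    assert (HZn := HZ2 n ltac:(lia)). assert (Zn := Zp n ltac:(lia)).
    assert (Rn := HR n ltac:(specialize (Hbig n ltac:(lia)); lia) (n - l)%nat).
    assert (Hnl : (H < n - l <= 3 * H)%nat) by lia.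
    assert (Hnl1 : INR H <= INR (n - l)) by (apply le_INR; lia).
    assert (Hnl2 : INR (n - l) <= 3 * INR H).
    { replace 3 with (INR 3) by (simpl; ring). rewrite <- mult_INR. apply le_INR. lia. }
    assert (Rn' : cr * model k n <= model k l).
    { replace l with (n - (n - l))%nat by lia. apply Rn.
      destruct (Scale n ltac:(lia)) as [A1 _]. fold t in A1. rewrite EH in Hnl2.
      assert (P0 := pos_INR (n - l)). assert (INR (n - l) * INR (n - l) <= (3 * t ^ 5) * (3 * t ^ 5)) by (apply Rmult_le_compat; lra).
      nra. }
    assert (Wn := weight_lower k (n - l)). assert (Pm := model_pos k n).
    assert (Kl : INR H * (cr * model k n) <= kernel n l).
    { unfold kernel. apply Rmult_le_compat; try lra. apply Rmult_le_pos; lra. }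
    unfold P. apply Rmult_le_reg_r with (Z n); [exact Zn|].
    unfold Rdiv at 2. rewrite Rmult_assoc, Rinv_l, Rmult_1_r by lra.
    eapply Rle_trans; [|exact Kl].
    apply Rle_trans with (kap / INR H * (2 * (INR n * model k n))).
    + apply Rmult_le_compat_l; [left; apply Rdiv_lt_0_compat; lra|apply HZn].
    + apply Rle_trans with (kap / INR H * (2 * (1024 * (INR H * INR H) * model k n))).
      * apply Rmult_le_compat_l; [left; apply Rdiv_lt_0_compat; lra|].
        apply Rmult_le_compat_l; [lra|]. apply Rmult_le_compat_r; [lra|]. rewrite EH, <- E10. lra.
      * right. unfold kap. field. lra.
  - intros n Hn. rewrite (rsum_ext (P n) (fun l => P n l * 1) (N - L)) by (intros; ring).
    rewrite (rsum_ext (P n) (fun l => P n l * 1) N) by (intros; ring).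
    rewrite !Pscal. rewrite !(rsum_ext (fun l => kernel n l * 1) (kernel n)) by (intros; ring).
    assert (Zn := Zp n ltac:(lia)). assert (IZ : 0 < / Z n) by now apply Rinv_0_lt_compat.
    replace (Lc * t ^ 2 * (/ Z n * rsum (kernel n) N H)) with (/ Z n * (Lc * t ^ 2 * rsum (kernel n) N H)) by ring.
    apply Rmult_le_compat_l; [lra|]. assert (PN := model_pos k N).
    (* As [model] is increasing, [model k N] bounds it from above before N and from below after N.
       Taking it out of both masses leaves a comparison of sums of weights. *)
    assert (U1 : rsum (kernel n) (N - L) L <= model k N * (Cw * ((3 * t ^ 6) * (3 * t ^ 6)))).
    { apply Rle_trans with (rsum (fun l => model k N * weight k (n - l)) (N - L) L).
      - apply rsum_le. intros l Hl. unfold kernel. rewrite Rmult_comm. apply Rmult_le_compat_r.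
        + assert (W1 := weight_lower k (n - l)). assert (P0 := pos_INR (n - l)). lra.
        + apply model_incr. lia.
      - rewrite rsum_scal. apply Rmult_le_compat_l; [lra|].
        set (q := (n - N)%nat).
        assert (Hq : (q + L <= 3 * L)%nat) by (unfold q; lia).
        apply Rle_trans with (rsum (weight k) 1 (q + L)).
        + rewrite rsum_split.
          replace (rsum (fun l => weight k (n - l)) (N - L) L) with (rsum (weight k) (1 + q) L).
          * assert (0 <= rsum (weight k) 1 q); [|lra]. apply rsum_pos. intros i _.
            assert (W1 := weight_lower k i). assert (P0 := pos_INR i). lra.
          * rewrite <- (Nat.add_0_r (1 + q)), <- (Nat.add_0_r (N - L)), !rsum_shift, (rsum_rev _ L).
            apply rsum_ext. intros i Hi. f_equal. unfold q. lia.
        + eapply Rle_trans; [apply HW; lia|].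
          apply Rmult_le_compat_l; [lra|].
          assert (INR (q + L) <= 3 * t ^ 6).
          { rewrite <- EL. replace 3 with (INR 3) by (simpl; ring). rewrite <- mult_INR. now apply le_INR. }
          assert (P0 := pos_INR (q + L)). apply Rmult_le_compat; lra. }
    (* Here the linear lower bound of the weights is used, and n is replaced by the smaller N + H,
       so that the bound does not depend on n. *)
    assert (U2 : model k N * (t ^ 5 * t ^ 5 / 2) <= rsum (kernel n) N H).
    { apply Rle_trans with (rsum (fun l => model k N * INR (N + H - l)) N H).
      - rewrite rsum_scal. apply Rmult_le_compat_l; [lra|].
        assert (G : forall h, rsum (fun l => INR (N + h - l)) N h = INR h * (INR h + 1) / 2).
        { induction h as [|h IHh]; [simpl; field|].
          rewrite rsum_first. replace (rsum (fun l => INR (N + S h - l)) (S N) h) with (rsum (fun l => INR (N + h - l)) N h).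
          - rewrite IHh. replace (N + S h - N)%nat with (S h) by lia. rewrite S_INR. field.
          - change (S N) with (1 + N)%nat. rewrite rsum_shift. apply rsum_ext. intros i Hi. f_equal. lia. }
        rewrite G, EH. lra.
      - apply rsum_le. intros l Hl. unfold kernel. rewrite Rmult_comm.
        apply Rmult_le_compat; [apply pos_INR|lra| |apply model_incr; lia].
        eapply Rle_trans; [|apply weight_lower]. apply le_INR. lia. }
    eapply Rle_trans; [exact U1|].
    apply Rle_trans with (Lc * t ^ 2 * (model k N * (t ^ 5 * t ^ 5 / 2))).
    + right. unfold Lc. field.
    + apply Rmult_le_compat_l; [apply Rmult_le_pos; [unfold Lc; lra|apply pow_le; lra]|exact U2].
  - intros n Hn. rewrite Pscal.
    destruct (HZ n ltac:(lia)) as [Q1 Q2]. assert (Zn := Zp n ltac:(lia)). assert (HZn := HZ2 n ltac:(lia)).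
    assert (nf0 := Hnf n ltac:(lia)). assert (R := ratio_rec k n). fold (kernel n) in R.
    change (fun l => weight k (n - l) * model k l * ratio k l) with (fun l => kernel n l * ratio k l) in R.
    set (nf := INR n * model k n) in *.
    assert (RS : forall g, rsum g 0 n = rsum g 0 (N - L) + rsum g (N - L) (n - (N - L))).
    { intros g. rewrite <- (rsum_split g 0 (N - L)). f_equal. lia. }
    rewrite RS in R.
    set (R1 := rsum (fun l => kernel n l * ratio k l) 0 (N - L)) in *.
    set (R2 := rsum (fun l => kernel n l * ratio k l) (N - L) (n - (N - L))) in *.
    assert (HR1 : 0 <= R1 <= rb * (d * nf)).
    { unfold R1. split.
      - apply rsum_pos. intros l _. apply Rmult_le_pos; [apply Kn|]. specialize (Hrb l). lra.
      - apply Rle_trans with (rb * rsum (kernel n) 0 (N - L)).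
        + rewrite <- rsum_scal. apply rsum_le. intros l _. rewrite Rmult_comm. apply Rmult_le_compat_r; [apply Kn|apply Hrb].
        + apply Rmult_le_compat_l; lra. }
    assert (HR2 : 0 <= R2 <= rb * Z n).
    { unfold R2, Z. split.
      - apply rsum_pos. intros l _. apply Rmult_le_pos; [apply Kn|]. specialize (Hrb l). lra.
      - rewrite <- rsum_scal. apply rsum_le. intros l _. rewrite Rmult_comm. apply Rmult_le_compat_r; [apply Kn|apply Hrb]. }
    assert (Er : ratio k n = (R1 + R2) / nf) by (rewrite <- R; field; lra).
    (* The defect has two sources: the part of the recurrence before N - L, and the normalisation by
       [Z n] instead of n model(n). *)
    assert (X : ratio k n - / Z n * R2 = R1 / nf + (Z n - nf) / nf * (R2 / Z n)) by (rewrite Er; field; lra).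
    rewrite X. eapply Rle_trans; [apply Rabs_triang|].
    assert (Y1 : Rabs (R1 / nf) <= d * rb).
    { rewrite Rabs_pos_eq by (apply Rdiv_le_0_compat; lra).
      apply Rmult_le_reg_r with nf; [lra|]. unfold Rdiv. rewrite Rmult_assoc, Rinv_l by lra. lra. }
    assert (Y2 : Rabs ((Z n - nf) / nf) <= d).
    { unfold Rdiv. rewrite Rabs_mult, (Rabs_pos_eq (/ nf)) by (left; now apply Rinv_0_lt_compat).
      apply Rmult_le_reg_r with nf; [lra|]. rewrite Rmult_assoc, Rinv_l by lra. lra. }
    assert (Y3 : 0 <= R2 / Z n <= rb).
    { split; [apply Rdiv_le_0_compat; lra|]. apply Rmult_le_reg_r with (Z n); [lra|].
      unfold Rdiv. rewrite Rmult_assoc, Rinv_l by lra. lra. }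
    rewrite Rabs_mult, (Rabs_pos_eq (R2 / Z n)) by lra.
    assert (Rabs ((Z n - nf) / nf) * (R2 / Z n) <= d * rb) by (apply Rmult_le_compat; try apply Rabs_pos; lra).
    assert (0 <= d * rb) by (apply Rmult_le_pos; lra). lra.
  - exact Hm.
  - exact HmM.
  - exists m', M'. split; [exact Hmm|]. split; [exact Hw'|].
    eapply Rle_trans; [exact Hc|]. apply Rplus_le_compat.
    + apply Rmult_le_compat_r; [lra|].
      assert (c / t ^ 2 <= kap / (2 * (1 + Lc * t ^ 2))); [|lra].
      unfold c. assert (t2 : 1 <= t ^ 2) by (apply pow_R1_Rle; lra).
      assert (HLc : 0 < Lc) by (unfold Lc; lra). assert (HLt : 0 < Lc * t ^ 2) by (apply Rmult_lt_0_compat; lra).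
      apply Rle_trans with (kap * / (2 * (1 + Lc) * t ^ 2)); [right; field; lra|].
      apply Rmult_le_compat_l; [lra|]. apply Rinv_le_contravar; [lra|]. lra.
    + rewrite plus_INR, EH, EL. unfold d.
      assert (t6 : t ^ 5 <= t ^ 6) by (apply Rle_pow; [lra|lia]).
      assert (tM : 0 < t ^ M) by (apply pow_lt; lra). assert (t6p : 0 < t ^ 6) by lra.
      replace ((8 * C * rb + 8 * C * rb) / t ^ M) with ((2 * (t ^ 6 + t ^ 6)) * (4 * (C / t ^ (M + 6)) * rb))
        by (rewrite pow_add; field; lra).
      apply Rmult_le_compat_r; [|lra].
      assert (0 <= C / t ^ (M + 6)) by (apply Rdiv_le_0_compat; [exact HC|apply pow_lt; lra]).
      apply Rmult_le_pos; lra.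
Qed.
End Increment.

(** * Logarithmic differences *)

Lemma tenth_root (n : nat) : (1 <= n)%nat -> exists T, (1 <= T /\ T ^ 10 <= n < (T + 1) ^ 10)%nat.
Proof.
  induction n as [|n IH]; intros Hn; [lia|].
  destruct n as [|n].
  - exists 1%nat. split; [lia|]. split; [simpl; lia|]. apply Nat.pow_gt_1; lia.
  - destruct IH as [T [H1 [H2 H3]]]; [lia|].
    destruct (Nat.lt_ge_cases (S (S n)) ((T + 1) ^ 10)) as [H|H].
    + exists T. lia.
    + exists (T + 1)%nat. split; [lia|]. split; [exact H|].
      assert ((T + 1) ^ 10 < (T + 1 + 1) ^ 10)%nat by (apply Nat.pow_lt_mono_l; lia). lia.
Qed.

Section Increment.
Variable k : nat.

(** T^3 successive blocks cover at most n / 2 indices, so the scale T stays valid throughout, and (1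
    - c / T^2)^(T^3) <= exp(- c T). The exponent M + 3 pays for the T^3 block errors. *)
Lemma ratio_oscillation (M : nat) : exists C T0, 0 <= C /\ forall T n, (T0 <= T)%nat ->
  (T ^ 10 <= n < (T + 1) ^ 10)%nat -> Rabs (ratio k n - ratio k (n - 1)) <= C / INR T ^ M.
Proof.
  destruct (ratio_bounded k) as [ra [rb [Hra Hrb]]].
  destruct (ratio_block k (M + 3)) as [c [C [T1 [Hc [HC HB]]]]].
  destruct (exp_neg_X c M (proj1 Hc)) as [C2 [HC2 HE]].
  assert (Hrb0 : 0 < rb) by (specialize (Hrb 0%nat); lra).
  assert (HCC : 0 <= C2 * rb) by (apply Rmult_le_pos; lra).
  exists (C2 * rb + C), (T1 + 4)%nat. split; [lra|]. intros T n HT [Hn1 Hn2].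
  assert (Ht : 4 <= INR T) by (apply Rle_trans with (INR 4); [simpl; lra|apply le_INR; lia]).
  set (t := INR T) in *. set (st := (T ^ 5 + T ^ 6)%nat).
  assert (R1 : t ^ 10 <= INR n) by (unfold t; rewrite <- pow_INR; now apply le_INR).
  assert (R2 : INR (n + 1) <= 1024 * t ^ 10).
  { apply Rle_trans with (INR ((T + 1) ^ 10)); [apply le_INR; lia|]. rewrite pow_INR, plus_INR. simpl (INR 1).
    fold t. apply Rle_trans with ((2 * t) ^ 10); [apply pow_incr; lra|]. right. ring. }
  assert (Est : INR st = t ^ 5 + t ^ 6) by (unfold st; rewrite plus_INR, !pow_INR; reflexivity).
  assert (Hst : (T ^ 3 * st <= n)%nat /\ 2 * INR (T ^ 3 * st) <= INR n).
  { assert (2 * INR (T ^ 3 * st) <= INR n).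
    { rewrite mult_INR, Est, pow_INR. fold t. eapply Rle_trans; [|exact R1].
      replace (t ^ 10) with (t ^ 8 * t ^ 2) by ring. replace (2 * (t ^ 3 * (t ^ 5 + t ^ 6))) with (t ^ 8 * (2 * (1 + t))) by ring.
      apply Rmult_le_compat_l; [apply pow_le; lra|]. simpl. nra. }
    split; [|assumption]. apply INR_le. assert (P := pos_INR (T ^ 3 * st)). lra. }
  destruct Hst as [Hst1 Hst2].
  assert (H5 : (1 <= T ^ 5)%nat) by (apply (Nat.pow_le_mono_l 1 T 5); lia).
  assert (H6 : (4 <= T ^ 6)%nat).
  { apply Nat.le_trans with (T ^ 1)%nat; [simpl; lia|]. apply Nat.pow_le_mono_r; lia. }
  set (N := fun i => (n + 1 - (T ^ 3 - i) * st)%nat).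
  assert (HNi : forall i, (i < T ^ 3)%nat -> (N (S i) = N i + T ^ 5 + T ^ 6)%nat).
  { intros i Hi. unfold N. replace (T ^ 3 - i)%nat with (S (T ^ 3 - S i)) by lia. rewrite Nat.mul_succ_l.
    assert (S (T ^ 3 - S i) * st <= T ^ 3 * st)%nat by (apply Nat.mul_le_mono_r; lia). rewrite Nat.mul_succ_l in H.
    unfold st in *. lia. }
  assert (HNs : forall i, at_scale T (N i)).
  { intros i. split; fold t.
    - assert (INR n - INR (T ^ 3 * st) <= INR (N i)); [|lra].
      rewrite <- minus_INR by exact Hst1. apply le_INR. unfold N.
      assert ((T ^ 3 - i) * st <= T ^ 3 * st)%nat by (apply Nat.mul_le_mono_r; lia). lia.
    - eapply Rle_trans; [|exact R2]. apply le_INR. unfold N. lia. }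
  assert (tM : 0 < t ^ (M + 3)) by (apply pow_lt; lra).
  assert (t2 : 1 <= t ^ 2) by (apply pow_R1_Rle; lra).
  assert (Hx : 0 <= c / t ^ 2 <= 1).
  { split; [apply Rdiv_le_0_compat; lra|]. apply Rmult_le_reg_r with (t ^ 2); [lra|].
    unfold Rdiv. rewrite Rmult_assoc, Rinv_l by lra. lra. }
  assert (It : forall i, (i <= T ^ 3)%nat -> exists m Mx, m <= Mx /\
    (forall l, (N i - T ^ 6 <= l < N i)%nat -> m <= ratio k l <= Mx) /\
    Mx - m <= (1 - c / t ^ 2) ^ i * rb + INR i * (C / t ^ (M + 3))).
  { induction i as [|i IH]; intros Hi.
    - exists ra, rb. split; [specialize (Hrb 0%nat); lra|]. split; [intros; apply Hrb|]. simpl. lra.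
    - destruct (IH ltac:(lia)) as [m [Mx [H1 [H2 H3]]]].
      destruct (HB T (N i) m Mx) as [m' [M' [H1' [H2' H3']]]]; try assumption; [lia|apply HNs| |].
      + rewrite <- HNi by lia. apply HNs.
      + exists m', M'. split; [exact H1'|]. split.
        * intros l Hl. apply H2'. rewrite HNi in Hl by lia. lia.
        * eapply Rle_trans; [exact H3'|]. fold t. rewrite S_INR.
          assert ((1 - c / t ^ 2) * (Mx - m) <= (1 - c / t ^ 2) * ((1 - c / t ^ 2) ^ i * rb + INR i * (C / t ^ (M + 3))))
            by (apply Rmult_le_compat_l; lra).
          assert (0 <= INR i * (C / t ^ (M + 3))).
          { apply Rmult_le_pos; [apply pos_INR|]. apply Rdiv_le_0_compat; lra. }
          assert ((1 - c / t ^ 2) * (INR i * (C / t ^ (M + 3))) <= 1 * (INR i * (C / t ^ (M + 3)))) by (apply Rmult_le_compat_r; lra).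
          change ((1 - c / t ^ 2) ^ S i) with ((1 - c / t ^ 2) * (1 - c / t ^ 2) ^ i). lra. }
  destruct (It (T ^ 3)%nat (le_n _)) as [m [Mx [H1 [H2 H3]]]].
  assert (EN : N (T ^ 3)%nat = (n + 1)%nat) by (unfold N; rewrite Nat.sub_diag; lia).
  rewrite EN in H2. assert (B1 := H2 n ltac:(lia)). assert (B2 := H2 (n - 1)%nat ltac:(lia)).
  assert (E1 : (1 - c / t ^ 2) ^ (T ^ 3) <= C2 / t ^ M).
  { eapply Rle_trans; [|apply HE; lra].
    apply Rle_trans with (exp (- (c / t ^ 2)) ^ (T ^ 3)).
    - apply pow_incr. split; [lra|]. assert (Q := exp_ineq1_le (- (c / t ^ 2))). lra.
    - rewrite <- exp_neg_INR_mult. right. f_equal. f_equal. rewrite pow_INR. fold t. field. lra. }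
  assert (tM' : 0 < t ^ M) by (apply pow_lt; lra).
  assert (E2 : INR (T ^ 3) * (C / t ^ (M + 3)) = C / t ^ M).
  { rewrite pow_INR, pow_add. fold t. field. split; lra. }
  rewrite E2 in H3.
  assert (E3 : (1 - c / t ^ 2) ^ (T ^ 3) * rb <= C2 / t ^ M * rb) by (apply Rmult_le_compat_r; lra).
  replace ((C2 * rb + C) / t ^ M) with (C2 / t ^ M * rb + C / t ^ M) by (field; lra).
  apply Rabs_le. lra.
Qed.
End Increment.

Definition nO (M : nat) (a : nat -> R) : Prop :=
  exists C, 0 <= C /\ eventually (fun n => Rabs (a n) <= C / INR n ^ M).

(** With T the integer part of n^(1/10), n is at most 1024 T^10, so a bound by T^(- 10 M) is one by
    n^(- M). *)
Lemma ratio_increment (k M : nat) : nO M (Defs.Delta (ratio k)).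
Proof.
  destruct (ratio_oscillation k (10 * M)) as [C [T0 [HC H]]].
  exists (C * 1024 ^ M). split; [apply Rmult_le_pos; [lra|apply pow_le; lra]|].
  exists ((T0 + 1) ^ 10)%nat. intros n Hn.
  assert (H1 : (1 <= (T0 + 1) ^ 10)%nat) by (apply (Nat.pow_le_mono_l 1 (T0 + 1) 10); lia).
  destruct (tenth_root n ltac:(lia)) as [T [HT1 [HT2 HT3]]].
  assert (HT0 : (T0 <= T)%nat).
  { destruct (Nat.le_gt_cases T0 T) as [|Hlt]; [assumption|].
    assert ((T + 1) ^ 10 <= (T0 + 1) ^ 10)%nat by (apply Nat.pow_le_mono_l; lia). lia. }
  specialize (H T n HT0 (conj HT2 HT3)).
  unfold Defs.Delta. eapply Rle_trans; [exact H|]. unfold Rdiv. rewrite Rmult_assoc.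
  apply Rmult_le_compat_l; [exact HC|].
  assert (Ht : 1 <= INR T) by now apply (le_INR 1). set (t := INR T) in *.
  assert (Hnt : INR n <= 1024 * t ^ 10).
  { apply Rle_trans with (INR ((T + 1) ^ 10)); [apply le_INR; lia|]. rewrite pow_INR, plus_INR. simpl (INR 1).
    fold t. apply Rle_trans with ((2 * t) ^ 10); [apply pow_incr; lra|]. right. ring. }
  assert (Hn1 : 0 < INR n) by (apply lt_0_INR; lia).
  assert (P1 : 0 < INR n ^ M) by (apply pow_lt; lra). assert (P2 : 0 < t ^ (10 * M)) by (apply pow_lt; lra).
  apply Rmult_le_reg_r with (INR n ^ M * t ^ (10 * M)); [now apply Rmult_lt_0_compat|].
  replace (/ t ^ (10 * M) * (INR n ^ M * t ^ (10 * M))) with (INR n ^ M) by (field; lra).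
  replace (1024 ^ M * / INR n ^ M * (INR n ^ M * t ^ (10 * M))) with ((1024 * t ^ 10) ^ M).
  - apply pow_incr. lra.
  - rewrite Rpow_mult_distr, <- pow_mult. field. lra.
Qed.

Lemma nO_Delta (M : nat) (a : nat -> R) : nO M a -> nO M (Defs.Delta a).
Proof.
  intros [C [HC [N H]]]. exists (C + C * 2 ^ M).
  assert (P2 : 0 < 2 ^ M) by (apply pow_lt; lra).
  split; [assert (0 <= C * 2 ^ M) by (apply Rmult_le_pos; lra); lra|].
  exists (N + 2)%nat. intros n Hn. unfold Defs.Delta. eapply Rle_trans; [apply Rabs_triang|]. rewrite Rabs_Ropp.
  assert (H1 := H n ltac:(lia)). assert (H2 := H (n - 1)%nat ltac:(lia)).
  assert (Hn2 : 2 <= INR n) by (apply (le_INR 2); lia).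
  rewrite minus_INR in H2 by lia. simpl (INR 1) in H2.
  assert (P : 0 < INR n ^ M) by (apply pow_lt; lra).
  assert (Q : / (INR n - 1) ^ M <= 2 ^ M / INR n ^ M).
  { replace (2 ^ M / INR n ^ M) with (/ (INR n / 2) ^ M).
    - apply Rinv_le_contravar; [apply pow_lt; lra|apply pow_incr; lra].
    - unfold Rdiv. rewrite Rpow_mult_distr, pow_inv. field. split; apply pow_nonzero; lra. }
  assert (Q' : C / (INR n - 1) ^ M <= C * (2 ^ M / INR n ^ M)) by (apply Rmult_le_compat_l; assumption).
  replace ((C + C * 2 ^ M) / INR n ^ M) with (C / INR n ^ M + C * (2 ^ M / INR n ^ M)) by (field; lra).
  lra.
Qed.

Lemma ln_increment (a b c : R) : 0 < c -> c <= a -> c <= b -> Rabs (ln a - ln b) <= Rabs (a - b) / c.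
Proof.
  intros Hc Ha Hb.
  assert (L : forall x y, c <= x -> c <= y -> ln x - ln y <= Rabs (x - y) / c).
  { intros x y Hx Hy. assert (E := exp_ineq1_le (ln (x / y))).
    assert (0 < x / y) by (apply Rdiv_lt_0_compat; lra).
    rewrite exp_ln in E by assumption. rewrite ln_div in E by lra.
    apply Rle_trans with ((x - y) / y); [replace ((x - y) / y) with (x / y - 1) by (field; lra); lra|].
    apply Rle_trans with (Rabs (x - y) / y).
    - apply Rmult_le_compat_r; [left; apply Rinv_0_lt_compat; lra|apply Rle_abs].
    - apply Rmult_le_compat_l; [apply Rabs_pos|]. apply Rinv_le_contravar; lra. }
  assert (L1 := L a b Ha Hb). assert (L2 := L b a Hb Ha). rewrite (Rabs_minus_sym b a) in L2.
  apply Rabs_le. lra.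
Qed.

(** Only the first difference is small by itself, through [ratio_increment]; the following ones
    merely preserve the order, which is enough since [M] may be chosen as large as r demands. *)
Lemma nO_ln_ratio (k M r : nat) : (1 <= r)%nat -> nO M (Delta_iter r (fun n => ln (ratio k n))).
Proof.
  intros Hr. destruct r as [|r]; [lia|]. unfold Delta_iter. rewrite Nat.iter_succ_r. clear Hr.
  induction r as [|r IH]; [|simpl; now apply nO_Delta].
  simpl. destruct (ratio_bounded k) as [a [b [Ha Hab]]].
  destruct (ratio_increment k M) as [C [HC H]]. exists (C / a). split; [apply Rdiv_le_0_compat; lra|].
  apply (filter_imp _ _) with (2 := filter_and _ _ H (eventually_ge 1)). intros n [B Hn1]. unfold Defs.Delta in *.
  eapply Rle_trans; [apply (ln_increment _ _ a Ha); apply Hab|].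
  replace (C / a / INR n ^ M) with (C / INR n ^ M / a).
  - apply Rmult_le_compat_r; [left; now apply Rinv_0_lt_compat|exact B].
  - assert (0 < INR n ^ M) by (apply pow_lt, lt_0_INR; lia). field. lra.
Qed.

Lemma Delta_iter_plus (r : nat) (f g : nat -> R) (n : nat) :
  Delta_iter r (fun m => f m + g m) n = Delta_iter r f n + Delta_iter r g n.
Proof.
  unfold Delta_iter. revert n. induction r as [|r IH]; intros n; [reflexivity|].
  simpl. unfold Defs.Delta at 1 3 5. rewrite !IH. ring.
Qed.

Lemma Delta_iter_ext (r : nat) (f g : nat -> R) (n : nat) :
  (forall m, f m = g m) -> Delta_iter r f n = Delta_iter r g n.
Proof.
  intros E. unfold Delta_iter. revert n. induction r as [|r IH]; intros n; [apply E|].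
  simpl. unfold Defs.Delta at 1 3. now rewrite !IH.
Qed.

Lemma Delta_iter_diff1 (f : R -> R) (a : nat -> R) (c : R) (m r n : nat) :
  (forall l, (m <= l)%nat -> a l = f (INR l + c)) -> (m + r <= n)%nat ->
  Delta_iter r a n = Nat.iter r diff1 f (INR n + c).
Proof.
  intros Ha. unfold Delta_iter. revert n. induction r as [|r IH]; intros n Hn; [apply Ha; lia|].
  simpl. unfold Defs.Delta at 1, diff1 at 1. rewrite !IH by lia. f_equal. f_equal.
  rewrite minus_INR by lia. simpl. ring.
Qed.

Lemma diff1_iter_lincomb (r : nat) (c : R) (f g : R -> R) (x : R) :
  Nat.iter r diff1 (fun t => c * f t + g t) x = c * Nat.iter r diff1 f x + Nat.iter r diff1 g x.
Proof.
  revert x. induction r as [|r IH]; intros x; [reflexivity|].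
  simpl. unfold diff1 at 1 3 5. rewrite !IH. ring.
Qed.

(** For functions whose derivative is a symbol while they themselves are not of the corresponding
    order: log F - 2 sqrt(A x) behaves like - (5/4) log x, and only its derivative is O(1 / x). *)
Lemma Sym_diff1_derive (k : nat) (b : R) (f f' : R -> R) :
  ev (fun x => is_derive f x (f' x)) -> Sym k b f' -> Sym k b (diff1 f).
Proof.
  intros Hd H. destruct k as [|k].
  - split; [|exact I]. apply (bigO_diff1 b f f' Hd). apply H.
  - apply (Sym_derive k b _ (diff1 f')).
    + apply (bigO_diff1 b f f' Hd). apply H.
    + now apply is_derive_diff1.
    + now apply Sym_diff1.
Qed.

(** The first difference of the error goes through its derivative, a symbol of order 1 by the
    Riccati equation; each of the other r - 1 differences gains one order. *)
Lemma bess_log_diff (A : R) (r : nat) : 0 < A -> (1 <= r)%nat ->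
  bigO (INR r) (fun x => Nat.iter r diff1 (fun t => ln (bess A t)) x -
    2 * sqrt A * half_falling r * Rpower x (1 / 2 - INR r)).
Proof.
  intros HA Hr.
  set (err := fun x => ln (bess A x) - 2 * sqrt A * Rpower x (1 / 2)).
  assert (Hd : ev (fun x => is_derive err x (logder A x - sqrt A * Rpower x (- (1 / 2))))).
  { exists 1. intros x Hx. apply is_derive_Rminus; [apply ln_bess_derive; [exact HA|lra]|].
    replace (sqrt A * Rpower x (- (1 / 2))) with (2 * sqrt A * (1 / 2 * Rpower x (1 / 2 - 1))).
    - apply is_derive_Rscal, is_derive_Rpower. lra.
    - replace (1 / 2 - 1) with (- (1 / 2)) by field. field. }
  assert (H1 : bigO (INR r) (Nat.iter r diff1 err)).
  { destruct r as [|r]; [lia|]. rewrite Nat.iter_succ_r, S_INR, Rplus_comm.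
    apply (Sym_bigO 0). apply diff_Sym. rewrite Nat.add_0_r.
    apply (Sym_diff1_derive _ _ _ _ Hd). apply logder_Sym_remainder. exact HA. }
  assert (H2 := Sym_bigO 0 _ _ (diff_sqrt_Sym r 0)).
  apply (bigO_weaken _ (INR r)) in H2; [|lra].
  refine (bigO_ext _ _ _ _ (bigO_plus _ _ _ (bigO_scal _ (2 * sqrt A) _ H2) H1)).
  exists 0. intros x _.
  assert (E : forall y, Nat.iter r diff1 (fun t => ln (bess A t)) y =
    Nat.iter r diff1 (fun t => 2 * sqrt A * Rpower t (1 / 2) + err t) y).
  { clear H1 H2. induction r as [|r IH]; intros y.
    - simpl. unfold err. ring.
    - destruct r as [|r]; [simpl; unfold diff1, err; ring|].
      change (diff1 (Nat.iter (S r) diff1 (fun t => ln (bess A t))) y =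
        diff1 (Nat.iter (S r) diff1 (fun t => 2 * sqrt A * Rpower t (1 / 2) + err t)) y).
      unfold diff1 at 1 3. rewrite !IH by lia. reflexivity. }
  rewrite E, diff1_iter_lincomb. ring.
Qed.

Lemma double_factorial_step (r : nat) : (1 <= r)%nat ->
  double_factorial (2 * Z.of_nat (S r) - 3) = ((2 * Z.of_nat r - 1) * double_factorial (2 * Z.of_nat r - 3))%Z.
Proof.
  intros Hr. unfold double_factorial.
  replace ((2 * Z.of_nat (S r) - 3 + 1) / 2)%Z with (Z.of_nat r).
  2:{ replace (2 * Z.of_nat (S r) - 3 + 1)%Z with (Z.of_nat r * 2)%Z by lia. now rewrite Z.div_mul. }
  replace ((2 * Z.of_nat r - 3 + 1) / 2)%Z with (Z.of_nat (r - 1)).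
  2:{ replace (2 * Z.of_nat r - 3 + 1)%Z with (Z.of_nat (r - 1) * 2)%Z by lia. now rewrite Z.div_mul. }
  rewrite !Nat2Z.id. destruct r as [|r]; [lia|]. replace (S r - 1)%nat with r by lia.
  simpl seq. rewrite <- seq_shift. cbn [map fold_right]. rewrite map_map. f_equal; [lia|].
  f_equal. apply map_ext. intros j. lia.
Qed.

Lemma half_falling_double_factorial (r : nat) : (1 <= r)%nat ->
  (-1) ^ (r + 1) * half_falling r = IZR (double_factorial (2 * Z.of_nat r - 3)) / 2 ^ r.
Proof.
  induction r as [|r IH]; intros Hr; [lia|]. destruct (Nat.eq_dec r 0) as [->|Hr0].
  - assert (E : double_factorial (2 * Z.of_nat 1 - 3) = 1%Z) by reflexivity. rewrite E. simpl. field.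
  - rewrite double_factorial_step, mult_IZR by lia.
    replace (IZR (2 * Z.of_nat r - 1)) with (2 * INR r - 1) by (rewrite minus_IZR, mult_IZR, <- INR_IZR_INZ; reflexivity).
    replace ((-1) ^ (S r + 1) * half_falling (S r)) with ((2 * INR r - 1) / 2 * ((-1) ^ (r + 1) * half_falling r))
      by (simpl; field).
    rewrite IH by lia. simpl. field. apply pow_nonzero. lra.
Qed.

Lemma half_falling_neq_0 (r : nat) : half_falling r <> 0.
Proof.
  induction r as [|r IH]; simpl; [lra|]. apply Rmult_integral_contrapositive_currified; [|exact IH].
  destruct r as [|r]; [simpl; lra|]. assert (1 <= INR (S r)) by (apply (le_INR 1); lia). lra.
Qed.

(** The denominator 6 (2k + 1) of [rate] is 2 * 3 (2k + 1); the factor 2 / sqrt 2 = sqrt 2 in front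
    turns 2^r into 2^(r - 1/2). *)
Lemma constant_identity (k r : nat) : (1 <= r)%nat ->
  PI * IZR (double_factorial (2 * Z.of_nat r - 3)) * sqrt (5 * INR k + 2)
    / (Rpower 2 (INR r - 1 / 2) * sqrt (3 * (2 * INR k + 1))) =
  (-1) ^ (r + 1) * (2 * sqrt (rate k) * half_falling r).
Proof.
  intros Hr. assert (P := pos_INR k). assert (HP := PI_RGT_0).
  replace ((-1) ^ (r + 1) * (2 * sqrt (rate k) * half_falling r)) with
    (2 * sqrt (rate k) * ((-1) ^ (r + 1) * half_falling r)) by ring.
  rewrite half_falling_double_factorial by exact Hr.
  assert (S1 : 0 < sqrt (3 * (2 * INR k + 1))) by (apply sqrt_lt_R0; lra).
  assert (S2 : 0 < sqrt 2) by (apply sqrt_lt_R0; lra).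
  assert (S22 : sqrt 2 * sqrt 2 = 2) by (apply sqrt_sqrt; lra).
  assert (E1 : sqrt (rate k) = PI * sqrt (5 * INR k + 2) / (sqrt 2 * sqrt (3 * (2 * INR k + 1)))).
  { unfold rate. replace (6 * (2 * INR k + 1)) with (2 * (3 * (2 * INR k + 1))) by ring.
    rewrite sqrt_div, !sqrt_mult, sqrt_pow2; try lra.
    - apply pow_le; lra.
    - apply Rmult_le_pos; [apply pow_le; lra|lra]. }
  assert (E2 : Rpower 2 (INR r - 1 / 2) = 2 ^ r / sqrt 2).
  { unfold Rminus. rewrite Rpower_plus, Rpower_pow by lra. rewrite Rpower_Ropp.
    replace (1 / 2) with (/ 2) by lra. rewrite Rpower_sqrt by lra. reflexivity. }
  rewrite E1, E2. assert (0 < 2 ^ r) by (apply pow_lt; lra).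
  set (d := IZR (double_factorial (2 * Z.of_nat r - 3))).
  set (s5 := sqrt (5 * INR k + 2)). set (s3 := sqrt (3 * (2 * INR k + 1))) in *.
  transitivity (sqrt 2 * sqrt 2 * (PI * s5 / (sqrt 2 * s3)) * (d / 2 ^ r)).
  - field. lra.
  - now rewrite S22.
Qed.

Theorem theorem1p21 (r k : nat) (hr : (1 <= r)%nat) (hk : (1 <= k)%nat) :
  is_equiv eventually
    (fun n : nat =>
       (-1) ^ (r + 1) * Delta_iter r (fun m => ln (broken_diamond k m)) n)
    (fun n : nat =>
       PI * IZR (double_factorial (2 * Z.of_nat r - 3)) * sqrt (5 * INR k + 2)
       / (Rpower 2 (INR r - 1 / 2) * sqrt (3 * (2 * INR k + 1)))
       * Rpower (INR n) (1 / 2 - INR r)).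
Proof.
  rewrite constant_identity by exact hr.
  set (K := 2 * sqrt (rate k) * half_falling r).
  assert (HA := rate_pos k). assert (OB := offset_bounds k).
  destruct (bess_log_diff (rate k) r HA hr) as [C1 [HC1 H1]].
  destruct (nO_ln_ratio k r r hr) as [C2 [HC2 H2]].
  set (a := 1 / 2 - INR r).
  (* The cost of replacing x = n + offset by n in the main term, of order n^(a - 1). *)
  set (C3 := Rabs K * (Rabs a * Rabs (offset k) * Rpower 2 (Rabs (a - 1)))).
  set (C := C1 * Rpower 2 (Rabs (- INR r)) + C2 + C3).
  assert (HC3 : 0 <= C3).
  { unfold C3. repeat apply Rmult_le_pos; try apply Rabs_pos. left; apply Rpower_pos. }
  (* The errors come from the expansion of log F, from the ratio and from the shift by the offset.
     All are O(n^(- r)), half a power below the main term. *)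
  assert (Hmain : eventually (fun n =>
    Rabs (Delta_iter r (fun m => ln (broken_diamond k m)) n - K * Rpower (INR n) a) <= C * Rpower (INR n) (- INR r))).
  { apply (filter_imp _ _) with (2 := filter_and _ _ (filter_and _ _ (ev_nat k _ H1) H2)
      (filter_and _ _ (eventually_ge (2 * k + 2 + r)) (eventually_ge 1))).
    intros n [[B1 B2] [Hn Hn1]].
    assert (N1 : 1 <= INR n) by now apply (le_INR 1).
    assert (Hk : INR (2 * k + 2) <= INR n) by (apply le_INR; lia).
    replace (INR (2 * k + 2)) with (2 * INR (k + 1)) in Hk by (rewrite !plus_INR, mult_INR; simpl; ring).
    set (x := INR n + offset k) in *.
    assert (Hx : INR n / 2 <= x <= INR n) by (unfold x; lra).
    assert (ED : Delta_iter r (fun m => ln (broken_diamond k m)) n =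
      Nat.iter r diff1 (fun t => ln (bess (rate k) t)) x + Delta_iter r (fun n => ln (ratio k n)) n).
    { rewrite (Delta_iter_ext r _ (fun m => ln (model k m) + ln (ratio k m))).
      - rewrite Delta_iter_plus. f_equal.
        apply (Delta_iter_diff1 (fun t => ln (bess (rate k) t)) (fun m => ln (model k m)) (offset k) (k + 1)); [|lia].
        intros l Hl. now rewrite model_large.
      - intros m. rewrite <- ln_mult by (apply model_pos || apply ratio_pos). now rewrite ratio_model. }
    rewrite ED. fold K a in B1.
    assert (Y1 : C1 * Rpower x (- INR r) <= C1 * Rpower 2 (Rabs (- INR r)) * Rpower (INR n) (- INR r)).
    { rewrite Rmult_assoc. apply Rmult_le_compat_l; [lra|]. apply Rpower_comparable; lra. }
    assert (Y2 : C2 / INR n ^ r = C2 * Rpower (INR n) (- INR r)).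
    { rewrite Rpower_Ropp, Rpower_pow by lra. reflexivity. }
    assert (Y3 : Rabs (K * (Rpower x a - Rpower (INR n) a)) <= C3 * Rpower (INR n) (- INR r)).
    { destruct (ex_MVT (fun t => Rpower t a) (fun t => a * Rpower t (a - 1)) x (INR n)) as [c [Hc E]];
        [lra|intros; apply is_derive_Rpower; lra|].
      rewrite Rabs_mult, (Rabs_minus_sym (Rpower x a)), E.
      replace (INR n - x) with (- offset k) by (unfold x; ring).
      rewrite !Rabs_mult, Rabs_Ropp, (Rabs_pos_eq (Rpower c (a - 1))) by (left; apply Rpower_pos).
      assert (Z : Rpower c (a - 1) <= Rpower 2 (Rabs (a - 1)) * Rpower (INR n) (- INR r)).
      { eapply Rle_trans; [apply (Rpower_comparable (INR n)); lra|].
        apply Rmult_le_compat_l; [left; apply Rpower_pos|]. apply Rpower_weaken; [exact N1|]. unfold a. lra. }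
      unfold C3. rewrite (Rmult_assoc (Rabs K) (Rabs a * Rabs (offset k) * Rpower 2 (Rabs (a - 1)))).
      apply Rmult_le_compat_l; [apply Rabs_pos|].
      apply Rle_trans with (Rabs a * Rabs (offset k) * (Rpower 2 (Rabs (a - 1)) * Rpower (INR n) (- INR r))).
      - replace (Rabs a * Rpower c (a - 1) * Rabs (offset k)) with (Rabs a * Rabs (offset k) * Rpower c (a - 1)) by ring.
        apply Rmult_le_compat_l; [|exact Z]. apply Rmult_le_pos; apply Rabs_pos.
      - right; ring. }
    rewrite Y2 in B2.
    replace (Nat.iter r diff1 (fun t => ln (bess (rate k) t)) x + Delta_iter r (fun n => ln (ratio k n)) n - K * Rpower (INR n) a) with
      ((Nat.iter r diff1 (fun t => ln (bess (rate k) t)) x - K * Rpower x a) + Delta_iter r (fun n => ln (ratio k n)) n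
        + K * (Rpower x a - Rpower (INR n) a)) by ring.
    eapply Rle_trans; [apply Rabs_triang|]. eapply Rle_trans; [apply Rplus_le_compat_r, Rabs_triang|].
    unfold C. lra. }
  assert (HK : 0 < Rabs K).
  { apply Rabs_pos_lt. unfold K. apply Rmult_integral_contrapositive_currified; [|apply half_falling_neq_0].
    apply Rgt_not_eq, Rmult_lt_0_compat; [lra|now apply sqrt_lt_R0]. }
  assert (HC : 0 <= C).
  { unfold C. assert (0 < C1 * Rpower 2 (Rabs (- INR r))) by (apply Rmult_lt_0_compat; [lra|apply Rpower_pos]). lra. }
  (* Relative to the main term the error is at most C / |K| times n^(-1/2), where K is nonzero
     because [half_falling] never vanishes. *)
  intros [eps Heps]. simpl pos.
  destruct (Rpower_small (1 / 2) (eps * Rabs K / (C + 1)) ltac:(lra)) as [x0 Hs].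
  { apply Rdiv_lt_0_compat; [now apply Rmult_lt_0_compat|lra]. }
  apply (filter_imp _ _) with (2 := filter_and _ _ Hmain (eventually_INR_ge x0)).
  intros n [B Hn]. specialize (Hs (INR n) Hn).
  set (s := (-1) ^ (r + 1)).
  assert (Hsa : Rabs s = 1) by apply pow_1_abs.
  set (D := Delta_iter r (fun m => ln (broken_diamond k m)) n) in *. set (p := Rpower (INR n) a) in *.
  change (Rabs (s * K * p - s * D) <= eps * Rabs (s * K * p)).
  replace (s * K * p - s * D) with (s * (K * p - D)) by ring.
  rewrite (Rmult_assoc s K p), !Rabs_mult, Hsa, !Rmult_1_l, Rabs_minus_sym.
  assert (Hp : 0 < p) by apply Rpower_pos. rewrite (Rabs_pos_eq p) by lra.
  eapply Rle_trans; [exact B|].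
  replace (- INR r) with (a + - (1 / 2)) by (unfold a; field). rewrite Rpower_plus. fold p.
  set (h := Rpower (INR n) (- (1 / 2))) in *. assert (Hh : 0 < h) by apply Rpower_pos.
  apply Rle_trans with (p * ((C + 1) * h)).
  - replace (C * (p * h)) with (p * (C * h)) by ring. apply Rmult_le_compat_l; [lra|].
    apply Rmult_le_compat_r; lra.
  - replace (eps * (Rabs K * p)) with (p * ((C + 1) * (eps * Rabs K / (C + 1)))) by (field; lra).
    apply Rmult_le_compat_l; [lra|]. apply Rmult_le_compat_l; lra.
Qed.
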